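(* Let $p>3$ be a prime, let $q=p^h$ be a power of $p$, let $d=(q-1)/2$ (so $q=2d+1$), and let $e_0,e_1,e_2\in\mathbb{F}_q$ be arbitrary. Let $\mathcal{C}$ be the plane curve $$\mathcal{C}:\; C(X_0,X_1,X_2)=X_0^d+X_1^d+X_2^d+(e_0X_0+e_1X_1+e_2X_2)^d=0.$$ If $\mathcal{C}$ is not the union of $d$ lines, then the following hold. (i) The curve $\mathcal{C}$ is the union of $N\in\{0,1,2,3\}$ lines defined over $\mathbb{F}_q$ and a nonsingular classical curve $\mathcal{G}$ of some degree $n$. (ii) One has $$\#\mathcal{G}(\mathbb{F}_q)=\frac12 n(n+q-1)-\frac12 i(n-2)\quad\text{for some } i\in\{0,1,2,3,n,3n\}.$$ In particular, $\mathcal{G}$ attains the Stöhr–Voloch bound; that is, if $\mathfrak{P}_1,\dots,\mathfrak{P}_s$ are the distinct inflection points of $\mathcal{G}$ defined over $\mathbb{F}_q$, $\mathcal{L}_j$ is the tangent line to $\mathcal{G}$ at $\mathfrak{P}_j$, and $\mathfrak{m}_j=I(\mathfrak{P}_j,\mathcal{G}\cap\mathcal{L}_j)\geqslant 3$, then $$\#\mathcal{G}(\mathbb{F}_q)=\frac{n(n+q-1)-\sum_{j=1}^{s}(\mathfrak{m}_j-2)}{2}.$$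
   Context: Curves are projective plane curves in $\mathbb{P}^2$ over the algebraic closure $\overline{\mathbb{F}}_q$. In the theorem, $\mathcal{G}$ denotes the union of the nonlinear components of $\mathcal{C}$. For a curve $\mathcal{F}$ defined over $\mathbb{F}_q$, $\#\mathcal{F}(\mathbb{F}_q)$ is the number of points of $\mathbb{P}^2(\mathbb{F}_q)$ on $\mathcal{F}$. $I(P,\mathcal{X}\cap\mathcal{Y})$ is the intersection multiplicity of the curves $\mathcal{X}$ and $\mathcal{Y}$ at $P$. An inflection point of a nonsingular curve is a point at which the tangent line meets the curve with intersection multiplicity at least $3$. A curve is classical if it has only finitely many inflection points. *)

(* Defs.v *)
From HB Require Import structures.
From mathcomp Require Import all_boot all_order all_algebra all_field.
From mathcomp Require Import fraction.
From mathcomp.multinomials Require Import mpoly.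

Set Implicit Arguments.
Unset Strict Implicit.
Unset Printing Implicit Defensive.

Import GRing.Theory.

Local Open Scope ring_scope.

(* Each point of the projective plane is represented by its unique vector of
   homogeneous coordinates whose first nonzero coordinate is 1. *)
Definition normalized (R : fieldType) (v : 'rV[R]_3) : bool :=
  [exists i : 'I_3, (v 0 i == 1) && [forall j : 'I_3, (j < i)%N ==> (v 0 j == 0)]].

Notation PG2 R := {v : 'rV[R]_3 | normalized v}.

Lemma normalized_unique (R : fieldType) (v : 'rV[R]_3) :
  v != 0 -> exists! P : PG2 R, exists2 c : R, c != 0 & v = c *: val P.
Proof.
move=> v0.
have [i vi0 Hmin] : exists2 i : 'I_3, v 0 i != 0 &
    forall j : 'I_3, (j < i)%N -> v 0 j = 0.
  have [i0 vi0] : exists i, v 0 i != 0.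
    by apply/existsP; apply: contraNT v0 => /existsPn H; apply/eqP/rowP=> i;
       rewrite mxE; apply/eqP; have := H i; rewrite negbK.
  case: (arg_minnP (P := fun i => v 0 i != 0) (fun i => nat_of_ord i) vi0) => i vi Hi.
  exists i => // j ji; apply/eqP; apply/negPn/negP => /Hi; by rewrite leqNgt ji.
have nP : normalized ((v 0 i)^-1 *: v).
  apply/existsP; exists i; rewrite mxE mulVf // eqxx /=.
  by apply/forallP => j; apply/implyP => /Hmin vj; rewrite mxE vj mulr0.
exists (exist (fun w => is_true (normalized w)) _ nP); split.
  by exists (v 0 i); rewrite //= scalerA divff // scale1r.
move=> [w nw] /= [c c0 Ew]; apply: val_inj => /=.
case/existsP: nw => k /andP [/eqP wk /forallP Hk].
have ki : k = i.
  apply: val_inj; case: (ltngtP k i) => // [lt|lt].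
    by have := Hmin _ lt; rewrite Ew mxE wk mulr1 => /eqP; rewrite (negPf c0).
  by have := implyP (Hk i) lt => /eqP wi; move: vi0; rewrite Ew mxE wi mulr0 eqxx.
by rewrite {2}Ew scalerA Ew mxE -ki wk mulr1 mulVf // scale1r.
Qed.

Lemma normalized_map (F K : fieldType) (iota : {rmorphism F -> K}) (P : PG2 F) :
  normalized (map_mx iota (val P)).
Proof.
case: P => v /existsP [i /andP [/eqP vi /forallP H]] /=.
apply/existsP; exists i; rewrite mxE vi rmorph1 eqxx /=.
by apply/forallP => j; apply/implyP => /(implyP (H j)) /eqP vj; rewrite mxE vj rmorph0.
Qed.

Definition PG2_map (F K : fieldType) (iota : {rmorphism F -> K}) (P : PG2 F) : PG2 K :=
  exist (fun v => is_true (normalized v)) (map_mx iota (val P)) (normalized_map iota P).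

(* Curves are given by forms in three variables, up to a nonzero scalar. *)
Definition eval_pt (R : fieldType) (f : {mpoly R[3]}) (P : PG2 R) : R :=
  f.@[val P 0].

Definition same_curve (R : fieldType) (f g : {mpoly R[3]}) : Prop :=
  exists2 c : R, c != 0 & f = c *: g.

Definition distinct_curves (R : fieldType) (s : seq {mpoly R[3]}) : Prop :=
  forall i j, (i < j)%N -> (j < size s)%N -> ~ same_curve s`_i s`_j.

Definition is_line (R : fieldType) (f : {mpoly R[3]}) : bool :=
  (f != 0) && (f \is 1.-homog).

Definition irreducible_mpoly (R : fieldType) (f : {mpoly R[3]}) : Prop :=
  [/\ f != 0, f \isn't a GRing.unit &
      forall g h, f = g * h -> g \is a GRing.unit \/ h \is a GRing.unit].

(* [s] lists the distinct components of the curve [f]; [mu] gives their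
   multiplicities.  Factors of a form are forms, so homogeneity of the
   components need not be required. *)
Definition components (R : fieldType) (f : {mpoly R[3]}) (s : seq {mpoly R[3]}) : Prop :=
  [/\ {in s, forall H, irreducible_mpoly H}, distinct_curves s &
      exists2 mu : {mpoly R[3]} -> nat, {in s, forall H, (0 < mu H)%N} &
        same_curve f (\prod_(H <- s) H ^+ mu H)].

Definition union_of_lines (R : fieldType) (d : nat) (f : {mpoly R[3]}) : Prop :=
  exists s, [/\ components f s, size s = d & all (@is_line R) s].

Definition union_of_nonlinear_components (R : fieldType) (f g : {mpoly R[3]}) : Prop :=
  exists2 s, components f s & same_curve g (\prod_(H <- s | ~~ is_line H) H).

Definition nonsingular (R : fieldType) (f : {mpoly R[3]}) : Prop :=
  forall P : PG2 R, eval_pt f P = 0 -> exists i : 'I_3, eval_pt f^`M(i) P != 0.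

Definition tangent_line (R : fieldType) (f : {mpoly R[3]}) (P : PG2 R) : {mpoly R[3]} :=
  \sum_(i < 3) eval_pt f^`M(i) P *: 'X_i.

Local Notation "x %:F" := (tofrac x).

(* The local ring of the plane at P, as a subring of the fraction field of the
   homogeneous coordinate ring. *)
Definition in_local_ring (R : fieldType) (P : PG2 R) (phi : {fraction {mpoly R[3]}}) : Prop :=
  exists (k : nat) (a s : {mpoly R[3]}),
    [/\ a \is k.-homog, s \is k.-homog, eval_pt s P != 0 & phi = a%:F / s%:F].

(* The ideal of the local ring generated by the (dehomogenized) equations f, g:
   its elements are the (a f + b g) / s with both a f and b g of the degree of s. *)
Definition in_local_ideal (R : fieldType) (P : PG2 R) (f g : {mpoly R[3]})
    (phi : {fraction {mpoly R[3]}}) : Prop :=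
  exists (k : nat) (a b s : {mpoly R[3]}),
    [/\ a * f \is k.-homog, b * g \is k.-homog, s \is k.-homog, eval_pt s P != 0 &
        phi = (a * f + b * g)%:F / s%:F].

(* The dimension of the quotient of the local ring by the ideal (f, g) is at
   least m: there are m elements whose classes are linearly independent. *)
Definition intersection_mult_ge (R : fieldType) (P : PG2 R) (f g : {mpoly R[3]})
    (m : nat) : Prop :=
  exists phi : 'I_m -> {fraction {mpoly R[3]}},
    (forall i, in_local_ring P (phi i)) /\
    (forall c : 'I_m -> R,
       in_local_ideal P f g (\sum_(i < m) (c i)%:MP%:F * phi i) -> forall i, c i = 0).

Definition intersection_mult (R : fieldType) (P : PG2 R) (f g : {mpoly R[3]})
    (m : nat) : Prop :=
  intersection_mult_ge P f g m /\ ~ intersection_mult_ge P f g m.+1.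

Definition inflection_point (R : fieldType) (f : {mpoly R[3]}) (P : PG2 R) : Prop :=
  eval_pt f P = 0 /\ intersection_mult_ge P f (tangent_line f P) 3.

Definition classical_curve (R : fieldType) (f : {mpoly R[3]}) : Prop :=
  exists s : seq (PG2 R), forall P, inflection_point f P -> P \in s.

Definition nb_points (F : finFieldType) (f : {mpoly F[3]}) : nat :=
  #|[set P : PG2 F | eval_pt f P == 0]|.

(* [s] is the list of the inflection points of f (over K) that are defined over
   F, and [m P] is the intersection multiplicity of f with its tangent at P. *)
Definition attains_Stohr_Voloch (F : finFieldType) (K : fieldType)
    (iota : {rmorphism F -> K}) (n : nat) (f : {mpoly F[3]}) : Prop :=
  let fK := map_mpoly iota f in
  exists (s : seq (PG2 F)) (m : PG2 F -> nat),
    [/\ uniq s,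
        forall P, P \in s <-> inflection_point fK (PG2_map iota P),
        {in s, forall P,
           intersection_mult (PG2_map iota P) fK (tangent_line fK (PG2_map iota P)) (m P)
           /\ (3 <= m P)%N} &
        (nb_points f)%:R =
          (n%:R * (n%:R + #|F|%:R - 1) - \sum_(P <- s) ((m P)%:R - 2)) / 2 :> rat].

Definition four_term_form (F : fieldType) (d : nat) (e : 'I_3 -> F) : {mpoly F[3]} :=
  \sum_(i < 3) 'X_i ^+ d + (\sum_(i < 3) e i *: 'X_i) ^+ d.

(* Main.v *)
Require Import Defs.
From HB Require Import structures.
From mathcomp Require Import all_boot all_order all_algebra all_field ring.
From mathcomp Require Import fraction.
From mathcomp.multinomials Require Import mpoly.

Set Implicit Arguments.
Unset Strict Implicit.
Unset Printing Implicit Defensive.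

Import GRing.Theory.

Local Open Scope ring_scope.

(* Write X_3 for the fourth term e_0 X_0 + e_1 X_1 + e_2 X_2.  At a singular point of C the
   gradient equations and the Frobenius map show that the ratios y_i = e_i X_i / X_3, whose sum is
   1, satisfy sum y_i^3 = 1, hence (y_0 + y_1)(y_0 + y_2)(y_1 + y_2) = 0.  Unless C consists of d
   concurrent lines, the singular points therefore lie on lines X_3 = e_k X_k with e_k^d = -1 and
   (e_0 e_1 e_2)^d = (-1)^d, which are components of C.  The residual curve G is nonsingular because
   its singular points would have multiplicity at least 3 on C.

   On F_q the d-th power is the quadratic character, so a rational point lies on C exactly when its
   four signs sum to zero: either two are 1 and two are -1, or two are 0 and the others opposite.
   A computation with the Hessian shows that points of the first kind on G are never inflections.
   Points of the second kind are total inflections (multiplicity d) when C has no linear component,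
   and lie on a linear component, hence off G, otherwise.  The points of each kind are counted by
   convolving functions of the form a + b [x = 0] + c chi(x).

   Finally G is classical because some line meets C only in points which are not inflections of G,
   so that G and its Hessian have finitely many points in common. *)

(** Local geometry is read off one-variable polynomials: when f(P + t Q) is nonzero, its order at t
    = 0 is the intersection multiplicity with the line PQ, and its coefficients of degree at most 2
    carry the tangent and the Hessian. The local rings serve only to justify this reading.
    Components are irreducible factors, so the nonsingular G must be proved irreducible. This takes
    a weak form of Bezout, built from resultants along a pencil of lines; the same resultants give
    the finiteness behind classicality. Multiplicity 3 is impossible once a component line exists
    and X_3 is nonzero: the quadratic part of C is a diagonal form plus a multiple of the square of
    the fourth linear form, and its mixed coefficients are multiples of e_i e_j, all nonzero. The
    bound p > 3 makes 2, 3, d and d - 1 invertible: 3 in the cubic identity, d and d - 1 in the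
    Taylor coefficients, 2 and 3 so that a sum of four signs does not vanish by accident. A residual
    curve of degree 0 contradicts the hypothesis on C, and degree 1 is excluded by parity. *)

(** * Gradings and factors of forms *)

Lemma mpoly_ring_ind n (R : ringType) (P : {mpoly R[n]} -> Prop) :
  (forall c, P c%:MP) -> (forall i, P 'X_i) ->
  (forall p q, P p -> P q -> P (p + q)) -> (forall p q, P p -> P q -> P (p * q)) ->
  forall p, P p.
Proof.
move=> PC PX PD PM; elim/mpolyind => [|c m p _ _ Pp]; first by rewrite -mpolyC0.
apply: (PD) => //; rewrite -mul_mpolyC; apply: (PM) => //.
rewrite mpolyXE_id; apply: (big_ind P) => [|x y Px Py|i _]; [by rewrite -mpolyC1 | exact: PM|].
elim: (m i) => [|k IH]; first by rewrite expr0 -mpolyC1.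
by rewrite exprS; apply: PM.
Qed.

Lemma rmorph_mmap n (R : ringType) (S T : comRingType) (f : {rmorphism R -> S})
    (g : {rmorphism S -> T}) (h : 'I_n -> S) p :
  g (mmap f h p) = mmap (g \o f) (g \o h) p.
Proof.
rewrite /mmap rmorph_sum; apply: eq_bigr => m _; rewrite rmorphM /=; congr (_ * _).
by rewrite /mmap1 rmorph_prod; apply: eq_bigr => i _; rewrite rmorphXn.
Qed.

Lemma eq_mmap n (R S : ringType) (f g : R -> S) (h k : 'I_n -> S) p :
  f =1 g -> h =1 k -> mmap f h p = mmap g k p.
Proof. by move=> fg hk; apply: eq_bigr => m _; rewrite fg (mmap1_eq _ hk). Qed.

Lemma mmap_map n (R R' S : ringType) (f : {additive R' -> S}) (g : {additive R -> R'})
    (h : 'I_n -> S) p :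
  mmap f h (map_mpoly g p) = mmap (f \o g) h p.
Proof.
have hk := leq_maxl (msize p) (msize (map_mpoly g p)).
have hk' := leq_maxr (msize p) (msize (map_mpoly g p)).
rewrite (mmapE _ hk') (mmapE (f := f \o g) _ hk).
by apply: eq_bigr => m _; rewrite mcoeff_map_mpoly.
Qed.

Lemma mmap_homog n (R : ringType) (S : comRingType) (f : {rmorphism R -> S}) (h : 'I_n -> S)
    (s : S) k p :
  p \is k.-homog -> mmap f (fun i => s * h i) p = s ^+ k * mmap f h p.
Proof.
move/dhomogP => hp; rewrite /mmap mulr_sumr; apply: eq_big_seq => m /hp mk.
rewrite mulrCA; congr (_ * _); rewrite /mmap1.
under eq_bigr do rewrite exprMn.
by rewrite big_split /= prodrXr -mdegE mk.
Qed.

Lemma meval_homog n (R : comRingType) (h : 'I_n -> R) s k (p : {mpoly R[n]}) :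
  p \is k.-homog -> p.@[fun i => s * h i] = s ^+ k * p.@[h].
Proof. exact: mmap_homog. Qed.

(* The grading is recorded as the degree in an extra variable: [homogenize p] is the image of
   p under X_i |-> X_i T. *)
Definition homogenize n (R : comRingType) : {mpoly R[n]} -> {poly {mpoly R[n]}} :=
  mmap (polyC \o @mpolyC n R) (fun i => 'X_i *: 'X).

Lemma coef_homogenize n (R : comRingType) (p : {mpoly R[n]}) k m :
  ((homogenize p)`_k)@_m = if mdeg m == k then p@_m else 0.
Proof.
rewrite /homogenize /mmap coef_sum raddf_sum /=.
have E m1 : (((p@_m1)%:MP_[n])%:P * mmap1 (fun i => 'X_i *: 'X) m1)`_k@_m =
   (p@_m1 * (m1 == m)%:R) * (mdeg m1 == k)%:R.
  rewrite coefCM /mmap1; under eq_bigr do rewrite exprZn.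
  rewrite scaler_prod /= prodrXr -mdegE -mpolyXE_id coefZ coefXn mul_mpolyC mcoeffZ.
  by rewrite eq_sym; case: eqP => _; rewrite ?mulr1 ?mulr0 ?mcoeffX ?mcoeff0 ?mulr0.
under eq_bigr do rewrite E.
have [m_p|/memN_msupp_eq0 p0] := boolP (m \in msupp p).
  rewrite (bigD1_seq m) //= eqxx big1 ?addr0 => [|m1 /negPf ->]; last by rewrite mulr0 mul0r.
  by case: eqP; rewrite ?mulr0 ?mulr1.
rewrite p0 if_same big1_seq // => m1 /andP[_ m1p]; case: eqP => [E1|]; last by rewrite mulr0 mul0r.
by rewrite E1 p0 !mul0r.
Qed.

Lemma homogenize_homog n (R : comRingType) (p : {mpoly R[n]}) k :
  p \is k.-homog -> homogenize p = p *: 'X^k.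
Proof.
move=> hp; apply/polyP => j; apply/mpolyP => m.
rewrite coef_homogenize coefZ coefXn; have [->|nk] := eqVneq j k.
  by rewrite mulr1; case: eqP => // /eqP /(dhomog_nemf_coeff hp) ->.
rewrite mulr0 mcoeff0; case: eqP => // Ej.
by apply: (dhomog_nemf_coeff hp); rewrite /= Ej.
Qed.

Lemma homog_homogenize n (R : comRingType) (p a : {mpoly R[n]}) k :
  homogenize p = a *: 'X^k -> p \is k.-homog.
Proof.
move=> E; apply/dhomogP => m; rewrite mcoeff_msupp => pm; apply/eqP; apply: contraNT pm => /negPf mk.
have := coef_homogenize p (mdeg m) m; rewrite eqxx => <-.
by rewrite E coefZ coefXn mk mulr0 mcoeff0.
Qed.

(** Splitting off the powers of ['X] leaves factors with nonzero value at 0; their product is again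
    a monomial, hence a constant, so both are constants. *)
Lemma monomial_factor (R : idomainType) (p q : {poly R}) (a : R) n :
  a != 0 -> p * q = a *: 'X^n -> exists b k, p = b *: 'X^k.
Proof.
move=> a0 E; have : p * q != 0 by rewrite E -mul_polyC mulf_neq0 ?polyC_eq0 ?expf_neq0 ?polyX_eq0.
rewrite mulf_eq0 negb_or => /andP[p0 q0].
have [i [p' Hp' Ep]] := multiplicity_XsubC p 0; have [j [q' Hq' Eq]] := multiplicity_XsubC q 0.
rewrite p0 q0 /= in Hp' Hq'; rewrite subr0 in Ep Eq.
have r0 : ~~ root (p' * q') 0 by rewrite rootM negb_or Hp'.
have E' : p' * q' * 'X^(i + j) = a *: 'X^n by rewrite -E Ep Eq exprD mulrACA.
have nij : n = (i + j)%N.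
  case: (ltngtP n (i + j)) => // lt.
    have /(congr1 (fun r : {poly R} => r`_n)) := E'.
    by rewrite coefMXn lt coefZ coefXn eqxx mulr1 => /esym/eqP; rewrite (negPf a0).
  have /(congr1 (fun r : {poly R} => r`_(i + j))) := E'.
  rewrite coefMXn ltnn subnn coefZ coefXn (ltn_eqF lt) mulr0 => /eqP.
  by rewrite -horner_coef0 -/(root _ _) (negPf r0).
have Epq : p' * q' = a%:P.
  apply: (mulIf (_ : 'X^(i + j) != 0)); first by rewrite expf_neq0 // polyX_eq0.
  by rewrite E' nij mul_polyC.
have : size (p' * q') == 1%N by rewrite Epq size_polyC a0.
rewrite size_mul_eq1 => /andP[/size_poly1P [b _ Eb] _].
by exists b, i; rewrite Ep Eb mul_polyC.
Qed.

(** Homogeneity of p means that [homogenize p] is a monomial in the extra variable, and over a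
    domain a factor of a monomial is a monomial. *)
Lemma homog_factor n (R : idomainType) (p q : {mpoly R[n]}) k :
  p * q != 0 -> p * q \is k.-homog -> exists2 i, p \is i.-homog & (i <= k)%N && (q \is (k - i).-homog).
Proof.
move=> pq0 hpq; have /andP[p0 q0] : (p != 0) && (q != 0) by rewrite -negb_or -mulf_eq0.
have E : homogenize p * homogenize q = (p * q) *: 'X^k by rewrite -homogenize_homog // /homogenize rmorphM.
have [a [i /homog_homogenize hp]] := monomial_factor pq0 E.
rewrite mulrC in E; have [b [j /homog_homogenize hq]] := monomial_factor pq0 E.
have kij : k = (i + j)%N := dhomog_uniq pq0 hpq (dhomogM hp hq).
by exists i => //; rewrite kij leq_addr addKn.
Qed.

Lemma coef_mul_top (R : nzRingType) (p q : {poly R}) k l :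
  (size p <= k.+1)%N -> (size q <= l.+1)%N ->
  (size (p * q)%R <= (k + l).+1)%N /\ (p * q)`_(k + l) = p`_k * q`_l.
Proof.
move=> sp sq; split.
  apply: leq_trans (size_mul_leq _ _) _; rewrite -subn1 leq_subLR.
  by apply: leq_trans (leq_add sp sq) _; rewrite addSn addnS add1n.
have kl : (k < (k + l).+1)%N by rewrite ltnS leq_addr.
rewrite coefM (bigD1 (Ordinal kl)) //= addKn big1 ?addr0 // => j /eqP jk.
have [lt|le] := ltnP k j; first by rewrite (nth_default _ (leq_trans sp lt)) mul0r.
rewrite [X in _ * X]nth_default ?mulr0 //; apply: leq_trans sq _.
have jk' : (j < k)%N by rewrite ltn_neqAle le andbT; apply/eqP => jk'; apply: jk; apply/val_inj.
by rewrite ltn_subRL ltn_add2r.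
Qed.

(** * Restriction of forms to a parametrized line *)

Section Restriction.
Variables (n : nat) (R S : comNzRingType) (f : {rmorphism R -> S}).
Implicit Types (P Q : 'I_n -> S) (p q : {mpoly R[n]}).

(** Pullback along t |-> P + t Q. The coefficients go through [f], so the line may have parameters
    in a larger ring: polynomials in the parameters of a pencil, or the fraction field of the
    forms. *)
Definition restr P Q : {mpoly R[n]} -> {poly S} :=
  mmap (polyC \o f) (fun i => (P i)%:P + Q i *: 'X).

HB.instance Definition _ P Q := GRing.RMorphism.copy (restr P Q) (restr P Q).

Lemma restrC P Q c : restr P Q c%:MP = (f c)%:P.
Proof. exact: mmapC. Qed.

Lemma restrX P Q i : restr P Q 'X_i = (P i)%:P + Q i *: 'X.
Proof. by rewrite /restr mmapX mmap1U. Qed.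

Lemma restr_horner P Q p t : (restr P Q p).[t] = mmap f (fun i => P i + Q i * t) p.
Proof.
rewrite -[LHS]/(horner_eval t (restr P Q p)) /restr rmorph_mmap; apply: eq_mmap => x /=.
  by rewrite /horner_eval hornerC.
by rewrite /horner_eval !hornerE.
Qed.

Lemma coef0_restr P Q p : (restr P Q p)`_0 = mmap f P p.
Proof.
rewrite -horner_coef0 restr_horner; apply: eq_mmap => // i.
by rewrite mulr0 addr0.
Qed.

Lemma coef1_restr P Q p : (restr P Q p)`_1 = \sum_i Q i * mmap f P p^`M(i).
Proof.
elim/mpoly_ring_ind: p => [c|i|p q IHp IHq|p q IHp IHq].
- rewrite restrC coefC /= big1 // => i _; by rewrite mderivC mmap0 mulr0.
- rewrite restrX coefD coefC coefZ coefX add0r mulr1 (bigD1 i) //= big1 => [|j ji].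
    by rewrite mderivX mnm1E eqxx scale1r -{1}[U_(i)%MM]add0m addmK mpolyX0 rmorph1 mulr1 addr0.
  by rewrite mderivX mnm1E eq_sym (negPf ji) scale0r mmap0 mulr0.
- rewrite rmorphD coefD IHp IHq -big_split; apply: eq_bigr => i _.
  by rewrite mderivD mmapD mulrDr.
rewrite rmorphM coefM !big_ord_recl big_ord0 /= addr0 IHp IHq !coef0_restr.
rewrite mulr_sumr mulr_suml -big_split; apply: eq_bigr => i _.
rewrite mderivM rmorphD !rmorphM /= [RHS]mulrDr addrC mulrA.
by rewrite (mulrC (mmap f P p)) !mulrA.
Qed.

(** The coefficient of degree k is the value at t = infinity, that is at Q. *)
Lemma restr_homog P Q p k : p \is k.-homog ->
  (size (restr P Q p) <= k.+1)%N /\ (restr P Q p)`_k = mmap f Q p.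
Proof.
move=> /dhomogP hp; rewrite /restr /mmap.
have T m : (size (mmap1 (fun i => (P i)%:P + Q i *: 'X)%R m) <= (mdeg m).+1)%N /\
   (mmap1 (fun i => (P i)%:P + Q i *: 'X) m)`_(mdeg m) = mmap1 Q m.
  rewrite /mmap1 mdegE.
  apply: (big_ind3 (fun (r : {poly S}) d c => (size r <= d.+1)%N /\ r`_d = c)).
  - by rewrite size_poly1 coef1.
  - by move=> r1 d1 c1 r2 d2 c2 [s1 <-] [s2 <-]; exact: coef_mul_top.
  move=> i _; elim: (m i) => [|j [sj cj]]; first by rewrite !expr0 size_poly1 coef1.
  have s1 : (size ((P i)%:P + Q i *: 'X)%R <= 1.+1)%N.
    rewrite (leq_trans (size_polyD _ _)) // geq_max (leq_trans (size_polyC_leq1 _)) //.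
    by rewrite (leq_trans (size_scale_leq _ _)) // size_polyX.
  have [] := coef_mul_top s1 sj; rewrite -!exprS add1n => -> ->; split=> //.
  by rewrite cj coefD coefC coefZ coefX /= add0r mulr1 -exprS.
split.
  rewrite (leq_trans (size_sum _ _ _)) //; apply/bigmax_leqP_seq => m mp _.
  by rewrite mul_polyC (leq_trans (size_scale_leq _ _)) // -(hp _ mp); case: (T m).
rewrite coef_sum; apply: eq_big_seq => m mp.
by rewrite coefCM -(hp _ mp); case: (T m) => _ ->.
Qed.

End Restriction.

(** * Common points of two plane curves: pencils and resultants *)

Lemma ord3P (i : 'I_3) : [\/ i = ord0, i = lift ord0 ord0 | i = ord_max].
Proof.
by case: i => -[|[|[|//]]] Hi; [constructor 1 | constructor 2 | constructor 3]; apply: val_inj.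
Qed.

Lemma digits_inj N a b c a' b' c' : (a < N)%N -> (b < N)%N -> (a' < N)%N -> (b' < N)%N ->
  (a + (b + c * N) * N = a' + (b' + c' * N) * N)%N -> [/\ a = a', b = b' & c = c'].
Proof.
move=> aN bN aN' bN' E; have N0 : (0 < N)%N by case: N aN {E bN aN' bN'}.
have Ea : a = a' by have := congr1 (modn^~ N) E; rewrite !(addnC _ (_ * N)%N) !modnMDl !modn_small.
have E2 : (b + c * N = b' + c' * N)%N.
  have := congr1 (divn^~ N) E; rewrite !(addnC _ (_ * N)%N) !divnMDl // !divn_small // !addn0.
  by rewrite !(addnC (_ * N)%N).
have Eb : b = b' by have := congr1 (modn^~ N) E2; rewrite !(addnC _ (_ * N)%N) !modnMDl !modn_small.
split=> //; have := congr1 (divn^~ N) E2.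
by rewrite !(addnC _ (_ * N)%N) !divnMDl // !divn_small // !addn0.
Qed.

(** Kronecker substitution: with N above every exponent, the variables become X, X^N and X^(N^2),
    and distinct monomials become distinct powers of X by uniqueness of base-N digits. *)
Lemma mpoly3_nonzero (K : closedFieldType) (p : {mpoly K[3]}) :
  p != 0 -> exists v, p.@[v] != 0.
Proof.
move=> p0; pose N := msize p.
pose w (m : 'X_{1..3}) := (m ord0 + (m (lift ord0 ord0) + m ord_max * N) * N)%N.
pose h (i : 'I_3) := if i == ord0 then 1%N else if i == lift ord0 ord0 then N else (N * N)%N.
have lt_mN m i : m \in msupp p -> (m i < N)%N.
  move/msize_mdeg_lt; apply: leq_ltn_trans.
  by rewrite mdegE (bigD1 i) //= leq_addr.
have wE m : mmap1 (fun i => 'X^(h i) : {poly K}) m = 'X^(w m).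
  rewrite /mmap1 !big_ord_recl big_ord0 /= mulr1 -!exprM -!exprD /w /h /=; congr ('X^_).
  rewrite (_ : lift ord0 (lift ord0 ord0) = ord_max); last exact: val_inj.
  by rewrite /= mul1n mulnDl [(N * N * _)%N]mulnC mulnA [(N * m _)%N]mulnC.
pose r := mmap (@polyC K) (fun i => 'X^(h i)) p.
have r0 : r != 0.
  have mp := mlead_supp p0; set m := mlead p in mp.
  suff : r`_(w m) != 0 by apply: contraNneq => ->; rewrite coef0.
  rewrite /r /mmap coef_sum (bigD1_seq m) //= big1_seq => [|m' /andP[m'm m'p]].
    by rewrite addr0 wE coefCM coefXn eqxx mulr1 -mcoeff_msupp.
  rewrite wE coefCM coefXn; case: eqP => [E|]; last by rewrite mulr0.
  have [] := digits_inj (lt_mN _ _ mp) (lt_mN _ _ mp) (lt_mN _ _ m'p) (lt_mN _ _ m'p) E.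
  move=> E0 E1 E2; case/eqP: m'm; apply/mnmP => i.
  by case: (ord3P i) => ->.
have [x rx] : exists x, ~~ root r x by apply/closed_nonrootP.
exists (fun i => x ^+ h i); apply: contraNneq rx => /esym E; rewrite rootE E.
rewrite -[_.[x]]/(horner_eval x r) /r rmorph_mmap; apply/eqP/eq_mmap => i /=.
  by rewrite /horner_eval hornerC.
by rewrite /horner_eval hornerXn.
Qed.

Lemma size_restr n (R : comNzRingType) (S : comNzRingType) (f : {rmorphism R -> S}) (P Q : 'I_n -> S) (p : {mpoly R[n]}) k :
  p \is k.-homog -> mmap f Q p != 0 ->
  size (restr f P Q p) = k.+1 /\ lead_coef (restr f P Q p) = mmap f Q p.
Proof.
move=> hp pQ; have [sz ck] := restr_homog f P Q hp.
have E : size (restr f P Q p) = k.+1.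
  by apply/eqP; rewrite eqn_leq sz ltnNge; apply: contra pQ => /leq_sizeP /(_ k (leqnn k)); rewrite ck => ->.
by rewrite lead_coefE E.
Qed.

Lemma map_restr n (R S T : comNzRingType) (f : {rmorphism R -> S}) (g : {rmorphism S -> T})
    (P Q : 'I_n -> S) p :
  map_poly g (restr f P Q p) = restr (g \o f) (g \o P) (g \o Q) p.
Proof.
rewrite /restr rmorph_mmap; apply: eq_mmap => x /=; first by rewrite map_polyC.
by rewrite rmorphD /= map_polyC linearZ_LR /= map_polyX.
Qed.

Lemma eq_restr n (R S : comNzRingType) (f g : {rmorphism R -> S}) (P P' Q Q' : 'I_n -> S) p :
  f =1 g -> P =1 P' -> Q =1 Q' -> restr f P Q p = restr g P' Q' p.
Proof. by move=> fg PP QQ; apply: eq_mmap => x /=; rewrite ?fg ?PP ?QQ. Qed.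

Lemma resultant_common_root (K : closedFieldType) (p q : {poly K}) : p != 0 ->
  reflect (exists2 z, root p z & root q z) (resultant p q == 0).
Proof.
move=> p0; rewrite resultant_eq0; apply: (iffP idP) => [sz|[z pz qz]].
  have /closed_rootP [z] : size (gcdp p q) != 1%N by rewrite neq_ltn sz orbT.
  by rewrite root_gcd => /andP[]; exists z.
apply: (root_size_gt1 (a := z)); last by rewrite root_gcd pz.
by rewrite gcdp_eq0 (negPf p0).
Qed.

Lemma row_free_extend_in (K : fieldType) n k m (A : 'M[K]_(k, n)) (U : 'M[K]_(m, n)) :
  row_free A -> (k < \rank U)%N -> exists i, row_free (col_mx A (row i U)).
Proof.
move=> /eqP rA kU; have : ~~ (U <= A)%MS.
  by apply/negP => /mxrankS; rewrite rA leqNgt kU.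
case/row_subPn => i wA; exists i; set w := row i _ in wA *.
have lt : (\rank A < \rank (col_mx A w))%N.
  rewrite -addsmxE ltn_neqAle mxrankS ?addsmxSl // andbT.
  apply: contra wA; rewrite (mxrank_leqif_sup (addsmxSl A w)).2 => sA.
  by apply: submx_trans sA; apply: addsmxSr.
by rewrite /row_free eqn_leq rank_leq_row -{1}rA addn1.
Qed.

Lemma row_free_extend (K : fieldType) n k (A : 'M[K]_(k, n)) : row_free A -> (k < n)%N ->
  exists w : 'rV_n, row_free (col_mx A w).
Proof.
by move=> rA kn; have [|i] := row_free_extend_in (U := 1%:M) rA; [rewrite mxrank1|exists (row i 1%:M)].
Qed.

Local Notation o0 := (ord0 : 'I_3).
Local Notation o1 := (lift ord0 ord0 : 'I_3).
Local Notation o2 := (ord_max : 'I_3).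

Lemma sum_ord3 (V : nmodType) (F : 'I_3 -> V) : \sum_i F i = F o0 + F o1 + F o2.
Proof.
rewrite !big_ord_recl big_ord0 addr0 addrA; congr (_ + F _); exact: val_inj.
Qed.

Lemma row_free_nz (K : fieldType) n (v : 'rV[K]_n) : v != 0 -> row_free v.
Proof. by move=> v0; rewrite /row_free rank_rV v0. Qed.

Lemma basis_of_pair (K : fieldType) (u v : 'rV[K]_3) : row_free (col_mx u v) ->
  exists M : 'M[K]_3, [/\ M \in unitmx, row o0 M = u & row o1 M = v].
Proof.
move=> /row_free_extend/(_ isT) [w rw]; exists (col_mx (col_mx u v) w : 'M_(1 + 1 + 1, 3)).
split; first by rewrite -row_free_unit.
  apply/rowP => j; rewrite mxE -[RHS](col_mxEu u v) -[RHS](col_mxEu _ w).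
  by congr (fun_of_matrix _ _ j); apply: val_inj.
apply/rowP => j; rewrite mxE -[RHS](col_mxEd u v) -[RHS](col_mxEu _ w).
by congr (fun_of_matrix _ _ j); apply: val_inj.
Qed.

Lemma basis_of_point (K : fieldType) (v : 'rV[K]_3) : v != 0 ->
  exists2 M : 'M[K]_3, M \in unitmx & row o0 M = v.
Proof.
move=> v0; have [w rw] := row_free_extend (row_free_nz v0) isT.
by have [M [uM M0 _]] := basis_of_pair rw; exists M.
Qed.

Section Pencil.
Variables (K : closedFieldType) (M : 'M[K]_3) (A B : {mpoly K[3]}) (k l : nat).
Hypotheses (uM : M \in unitmx) (hA : A \is k.-homog) (hB : B \is l.-homog).
Hypotheses (A0 : A.@[M o0] != 0) (B0 : B.@[M o0] != 0).

Let cK : {rmorphism K -> {poly {poly K}}} := polyC \o polyC.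
Let ev (u w : K) : {rmorphism {poly {poly K}} -> K} :=
  horner_eval w \o map_poly (horner_eval u).
Let fib (u w : K) C : {poly K} := restr idfun (fun i => u * M o1 i + w * M o2 i) (M o0) C.
(** The three polynomial layers are, from the inside, u, w and the parameter z on the line. *)
Let gen C : {poly {poly {poly K}}} :=
  restr cK (fun i => ('X * (M o1 i)%:P)%:P + (M o2 i)%:P *: 'X) (cK \o M o0) C.

(* The resultant, along the pencil of lines through the point [M o0], of the two curves; the
   line is the one through [u * M o1 + w * M o2]. *)
Let R : {poly {poly K}} := resultant (gen A) (gen B).

Let evC u w x : ev u w (cK x) = x.
Proof. by rewrite /ev /cK /= map_polyC /= /horner_eval !hornerC. Qed.

Let ev_gen u w C : map_poly (ev u w) (gen C) = fib u w C.
Proof.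
rewrite /gen map_restr; apply: eq_restr => x; rewrite /=.
- by rewrite map_polyC /= /horner_eval !hornerC.
- rewrite rmorphD /= map_polyC linearZ_LR /= map_polyX /horner_eval !hornerE /=.
  by rewrite [_ * w]mulrC.
by rewrite map_polyC /= /horner_eval !hornerC.
Qed.

Let meval_cK C : mmap cK (cK \o M o0) C = cK C.@[M o0].
Proof. by rewrite /meval rmorph_mmap; apply: eq_mmap. Qed.

Let cK_eq0 x : (cK x == 0) = (x == 0).
Proof. by rewrite /cK /= !polyC_eq0. Qed.

Let lead_gen C j u w : C \is j.-homog -> C.@[M o0] != 0 -> ev u w (lead_coef (gen C)) = C.@[M o0].
Proof.
move=> hC C0; have nz : mmap cK (cK \o M o0) C != 0 by rewrite meval_cK cK_eq0.
have [_ E] := size_restr (f := cK) (fun i => ('X * (M o1 i)%:P)%:P + (M o2 i)%:P *: 'X) hC nz.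
by rewrite /gen E meval_cK evC.
Qed.

Let ev_R u w : ev u w R = resultant (fib u w A) (fib u w B).
Proof.
by rewrite -!ev_gen /R; apply: map_resultant; rewrite -/(ev u w) (lead_gen _ _ hA, lead_gen _ _ hB).
Qed.

Let fib_neq0 u w C j : C \is j.-homog -> C.@[M o0] != 0 -> fib u w C != 0.
Proof.
by move=> hC C0; have [sz _] := size_restr (f := idfun) (fun i => u * M o1 i + w * M o2 i) hC C0;
   rewrite -size_poly_gt0 sz.
Qed.

Let fib_root u w C z : root (fib u w C) z = (C.@[(\row_j [:: z; u; w]`_j *m M) 0] == 0).
Proof.
rewrite rootE restr_horner; congr (_ == _); apply: eq_mmap => // i.
rewrite mxE sum_ord3 !mxE /=; ring.
Qed.

(** The centre [M o0] lies on neither curve, so on every line of the pencil the leading coefficients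
    in z are the nonzero values of A and B at the centre. Hence the resultant commutes with
    specializing u and w, and its vanishing means a common root z on that line. *)
Lemma pencil_resultant : exists R : {poly {poly K}}, forall u w,
  R.[w%:P].[u] = 0 <-> exists z, let v := (\row_j [:: z; u; w]`_j *m M) 0 in A.@[v] = 0 /\ B.@[v] = 0.
Proof.
exists R => u w; have -> : R.[w%:P].[u] = ev u w R.
  rewrite /ev /= /horner_eval -[w in RHS](hornerC w u).
  exact: esym (horner_map (horner_eval u) R w%:P).
rewrite ev_R; split => [/eqP/(resultant_common_root _ (fib_neq0 _ _ hA A0)) [z]|[z [Az Bz]]].
  by rewrite !fib_root => /eqP Az /eqP Bz; exists z.
apply/eqP/(resultant_common_root _ (fib_neq0 _ _ hA A0)).
by exists z; rewrite fib_root ?Az ?Bz.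
Qed.
End Pencil.

(** The pencil has its centre off both curves. Forms of positive degree vanish at the origin, so the
    resultant vanishes at u = w = 0; it then has a further zero over the closed field, and that line
    of the pencil carries a common point. *)
Lemma two_curves_meet (K : closedFieldType) (A B : {mpoly K[3]}) k l :
  A != 0 -> B != 0 -> A \is k.-homog -> B \is l.-homog -> (0 < k)%N -> (0 < l)%N ->
  exists v : 'rV[K]_3, [/\ v != 0, A.@[v 0] = 0 & B.@[v 0] = 0].
Proof.
move=> A0 B0 hA hB k0 l0.
have [h] : exists h, (A * B).@[h] != 0 by apply: mpoly3_nonzero; rewrite mulf_neq0.
pose O := \row_i h i; have -> : (A * B).@[h] = (A * B).@[O 0] by apply: meval_eq => i; rewrite mxE.
rewrite mevalM mulf_eq0 negb_or => /andP[AO BO].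
have homog0 C j : C \is j.-homog -> (0 < j)%N -> C.@[(0 : 'rV[K]_3) 0] = 0.
  move=> hC j0; have -> : C.@[(0 : 'rV[K]_3) 0] = C.@[fun i => 0 * O 0 i].
    by apply: meval_eq => i; rewrite mxE mul0r.
  by rewrite (meval_homog _ _ hC) expr0n eqn0Ngt j0 mul0r.
have On0 : O != 0 by apply: contraNneq AO => ->; rewrite (homog0 _ k).
have [M uM rM] := basis_of_point On0.
have MO C : C.@[M ord0] = C.@[O 0] by apply: meval_eq => i; rewrite -rM !mxE.
rewrite -!MO in AO BO; have [R HR] := pencil_resultant hA hB AO BO.
have done_ u w : R.[w%:P].[u] = 0 -> (u != 0) || (w != 0) ->
    exists v : 'rV[K]_3, [/\ v != 0, A.@[v 0] = 0 & B.@[v 0] = 0].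
  move=> /HR [z [Az Bz]] uw; exists (\row_j [:: z; u; w]`_j *m M); split=> //.
  apply: contraTneq uw => E0; set c := \row_j _ in E0.
  have c0 : c = 0 by rewrite -[LHS](mulmxK uM) E0 mul0mx.
  have E j : c 0 j = 0 by rewrite c0 mxE.
  by have := E o1; have := E o2; rewrite !mxE /= => -> ->; rewrite eqxx.
have R00 : R.[0%:P].[0] = 0.
  apply/HR; exists 0; rewrite (_ : \row_j _ = 0) ?mul0mx; first by split; [apply: homog0 hA k0 | apply: homog0 hB l0].
  by apply/rowP => j; rewrite !mxE; case: (ord3P j) => ->.
(* If the resultant does not involve w, its zero at (0, 0) is also one at (0, 1). Otherwise u is
   fixed at a nonzero x at which some higher coefficient in w survives, and the remaining polynomial
   in w has a root. *)
case: (eqVneq R (R`_0)%:P) => [E|nE].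
  have Ec x : R.[x] = R`_0 by rewrite {1}E hornerC.
  by apply: (done_ 0 1); [rewrite Ec -(Ec 0%:P) | rewrite oner_eq0 orbT].
have [j j0 Rj] : exists2 j, (0 < j)%N & R`_j != 0.
  have sR : (1 < size R)%N by rewrite ltnNge; apply: contra nE => /size1_polyC /eqP.
  exists (size R).-1; first by rewrite -subn1 subn_gt0.
  by rewrite -lead_coefE lead_coef_eq0 -size_poly_gt0 ltnW.
have [x] : exists x, ~~ root (R`_j * 'X) x.
  by apply/closed_nonrootP; rewrite mulf_neq0 ?polyX_eq0.
rewrite rootM rootX negb_or => /andP[xj x0].
have /closed_rootP [w] : size (map_poly (horner_eval x) R) != 1%N.
  rewrite neq_ltn; apply/orP; right; rewrite ltnNge; apply: contra xj => /leq_sizeP /(_ j j0).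
  by rewrite coef_map => /= /eqP.
rewrite rootE => /eqP E; apply: (done_ x w); rewrite ?x0 //.
rewrite -[LHS]/(horner_eval x _) -horner_map -[X in _.[X]]/(w%:P).[x] hornerC; exact: E.
Qed.

(** The projection is made from a point of the line O1 O2 off both curves. That line carries no
    common zero, so the resultant is not identically zero and only finitely many lines of the pencil
    carry common zeros; each of them meets A in finitely many points. *)
Lemma finite_common_zeros (K : closedFieldType) (A B : {mpoly K[3]}) k l (O1 O2 : 'rV[K]_3) :
  A \is k.-homog -> B \is l.-homog -> (0 < k)%N -> row_free (col_mx O1 O2) ->
  A.@[O1 0] != 0 ->
  (forall s t, (s != 0) || (t != 0) -> A.@[(s *: O1 + t *: O2) 0] = 0 ->
     B.@[(s *: O1 + t *: O2) 0] != 0) ->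
  exists vs : seq 'rV[K]_3, forall v : 'rV[K]_3, v != 0 -> A.@[v 0] = 0 -> B.@[v 0] = 0 ->
    exists2 w, w \in vs & exists2 c, c != 0 & v = c *: w.
Proof.
move=> hA hB k0 rO AO1 HO.
have HC C t : (restr idfun (O2 0) (O1 0) C).[t] = C.@[(t *: O1 + 1 *: O2) 0].
  by rewrite restr_horner; apply: meval_eq => i; rewrite !mxE mul1r addrC mulrC.
have [szA _] := size_restr (O2 0) hA AO1.
have An0 : restr idfun (O2 0) (O1 0) A != 0 by rewrite -size_poly_gt0 szA.
have Bn0 : restr idfun (O2 0) (O1 0) B != 0.
  have /closed_rootP [t] : size (restr idfun (O2 0) (O1 0) A) != 1%N.
    by rewrite szA eqSS -lt0n.
  rewrite rootE HC => /eqP /HO; rewrite oner_eq0 orbT => /(_ isT).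
  by rewrite -HC; apply: contraNneq => ->; rewrite horner0.
have [t] : exists t, ~~ root (restr idfun (O2 0) (O1 0) A * restr idfun (O2 0) (O1 0) B) t.
  by apply/closed_nonrootP; rewrite mulf_neq0.
rewrite rootM negb_or !rootE !HC => /andP[]; set O := t *: O1 + _ => AO BO.
have rO' : row_free (col_mx O O1).
  have -> : col_mx O O1 = block_mx t%:M 1%:M 1%:M 0 *m col_mx O1 O2 :> 'M_(2, 3).
    by rewrite mul_block_col !mul_scalar_mx mul0mx addr0 [1 *: O1]scale1r.
  rewrite /row_free mxrankMfree //; apply/eqP/mxrank_unit.
  pose N : 'M[K]_(1 + 1) := block_mx 0 1%:M 1%:M (- t%:M).
  set N' := block_mx _ _ _ _; suff /mulmx1_unit[] : N' *m N = 1%:M by [].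
  by rewrite mulmx_block !mul1mx !mulmx1 !mulmx0 !mul0mx ?add0r ?addr0 subrr -scalar_mx_block.
have [M [uM M0 M1]] := basis_of_pair rO'.
have MO C : C.@[M o0] = C.@[O 0].
  by apply: meval_eq => i; rewrite -M0 mxE.
rewrite -!MO in AO BO; have [R HR] := pencil_resultant hA hB AO BO.
pose roots_of (p : {poly K}) := projT1 (closed_field_poly_normal p).
have roots_ofP p z : p != 0 -> root p z -> z \in roots_of p.
  rewrite /roots_of; case: closed_field_poly_normal => r /= E p0.
  by rewrite {1}E rootZ ?lead_coef_eq0 // root_prod_XsubC.
pose r := map_poly (horner_eval 1) R.
have rE w : r.[w] = R.[w%:P].[1].
  by rewrite -[RHS]/(horner_eval 1 _) -horner_map -[X in _ = _.[X]]/(w%:P).[1] hornerC.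
(* The parameters u = 1, w = 0 give the line O1 O2 itself. *)
have r0 : r != 0.
  suff : r.[0] != 0 by apply: contraNneq => ->; rewrite horner0.
  rewrite rE; apply/eqP => /HR [z []].
  rewrite (_ : _ *m _ = (z * t + 1) *: O1 + z *: O2).
    have nz : (z * t + 1 != 0) || (z != 0).
      by have [->|_] := eqVneq z 0; rewrite ?orbT // mul0r add0r oner_eq0.
    by move=> Az; apply/eqP/HO.
  apply/rowP => j; have /rowP/(_ j) := M0; have /rowP/(_ j) := M1; rewrite !mxE.
  rewrite sum_ord3 !mxE /= => -> ->; ring.
pose pt z u w := \row_j [:: z; u; w]`_j *m M.
pose fib u w C := restr idfun (fun i => u * M o1 i + w * M o2 i) (M o0) C.
have fib_root u w C z : (fib u w C).[z] = C.@[pt z u w 0].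
  by rewrite restr_horner; apply: eq_mmap => // i; rewrite /pt mxE sum_ord3 !mxE /=; ring.
have fib0 u w : fib u w A != 0.
  by have [sz _] := size_restr (f := idfun) (fun i => u * M o1 i + w * M o2 i) hA AO;
     rewrite -size_poly_gt0 sz.
(* The line with u = 0 escapes the normalization u = 1 and is listed apart. *)
exists ([seq pt z 0 1 | z <- roots_of (fib 0 1 A)] ++
  flatten [seq [seq pt z 1 w | z <- roots_of (fib 1 w A)] | w <- roots_of r]) => v v0 Av Bv.
have [z [u [w Ev]]] : exists z u w, v = pt z u w.
  pose c := v *m invmx M; exists (c 0 o0), (c 0 o1), (c 0 o2); rewrite -[LHS](mulmxKV uM) -/c.
  by congr (_ *m _); apply/rowP => j; rewrite [RHS]mxE; case: (ord3P j) => ->.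
have scale C j x : C \is j.-homog -> x != 0 -> C.@[v 0] = 0 -> C.@[(x *: v) 0] = 0.
  move=> hC x0 Cv; have -> : C.@[(x *: v) 0] = C.@[fun i => x * v 0 i].
    by apply: meval_eq => i; rewrite mxE.
  by rewrite (meval_homog _ _ hC) Cv mulr0.
have ptZ x z' u' w' : x *: pt z' u' w' = pt (x * z') (x * u') (x * w').
  by rewrite /pt scalemxAl; congr (_ *m _); apply/rowP => j; rewrite !mxE; case: (ord3P j) => ->.
have [u0|u0] := eqVneq u 0; last first.
  have Ev' : u^-1 *: v = pt (u^-1 * z) 1 (u^-1 * w) by rewrite Ev ptZ mulVf.
  exists (u^-1 *: v); last by exists u; rewrite // scalerA divff // scale1r.
  rewrite Ev' mem_cat; apply/orP; right; apply/flattenP.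
  exists [seq pt z 1 (u^-1 * w) | z <- roots_of (fib 1 (u^-1 * w) A)].
    apply/map_f/roots_ofP => //; rewrite rootE rE; apply/eqP/HR; exists (u^-1 * z).
    rewrite /= -/(pt (u^-1 * z) 1 (u^-1 * w)) -Ev'.
    by split; [exact: scale hA (invr_neq0 u0) Av | exact: scale hB (invr_neq0 u0) Bv].
  by apply/map_f/roots_ofP => //; rewrite rootE fib_root -Ev' (scale _ _ _ hA (invr_neq0 u0)).
have w0 : w != 0.
  apply/eqP => w0; have z0 : z != 0.
    apply: contraNneq v0 => z0; rewrite Ev u0 z0 w0 /pt (_ : \row_j _ = 0) ?mul0mx //.
    by apply/rowP => j; rewrite !mxE; case: (ord3P j) => ->.
  move: AO; rewrite -(_ : A.@[pt 1 0 0 0] = A.@[M o0]).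
    have := scale _ _ _ hA (invr_neq0 z0) Av; rewrite Ev ptZ u0 w0 !mulr0 mulVf // => ->.
    by rewrite eqxx.
  by apply: meval_eq => i; rewrite /pt mxE sum_ord3 !mxE /= mul1r !mul0r !addr0.
have Ev' : w^-1 *: v = pt (w^-1 * z) 0 1 by rewrite Ev ptZ mulVf // u0 mulr0.
exists (w^-1 *: v); last by exists w; rewrite // scalerA divff // scale1r.
rewrite Ev' mem_cat; apply/orP; left.
by apply/map_f/roots_ofP => //; rewrite rootE fib_root -Ev' (scale _ _ _ hA (invr_neq0 w0)).
Qed.
Local Notation "x %:F" := (tofrac x).

(** * Intersection multiplicity of a curve with a line *)

Section LineForms.
Variables (K : fieldType) (M : 'M[K]_3).
Hypothesis uM : M \in unitmx.

(** Coordinates dual to the basis formed by the rows of M; the third one is an equation of the line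
    through the first two rows. *)
Definition dual_form (j : 'I_3) : {mpoly K[3]} := \sum_k invmx M k j *: 'X_k.

Lemma dual_form_homog j : dual_form j \is 1.-homog.
Proof. by apply: rpred_sum => k _; apply: dhomogZ; rewrite dhomogX /= mdeg1. Qed.

Lemma meval_dual_form i j : (dual_form j).@[M i] = (i == j)%:R.
Proof.
rewrite /dual_form raddf_sum /=; have /matrixP/(_ i j) := mulmxV uM; rewrite !mxE => <-.
by apply: eq_bigr => k _; rewrite mevalZ mevalXU mulrC.
Qed.

Lemma sum_dual_form k : 'X_k = \sum_j M j k *: dual_form j.
Proof.
under eq_bigr do rewrite /dual_form scaler_sumr.
rewrite exchange_big (bigD1 k) //= [X in _ + X]big1 => [|i ik].
  under eq_bigr do rewrite scalerA mulrC; rewrite -scaler_suml addr0.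
  have /matrixP/(_ k k) := mulVmx uM; rewrite !mxE eqxx => ->; by rewrite scale1r.
under eq_bigr do rewrite scalerA mulrC; rewrite -scaler_suml.
by have /matrixP/(_ i k) := mulVmx uM; rewrite !mxE (negPf ik) => ->; rewrite scale0r.
Qed.

Lemma dual_form_neq0 j : dual_form j != 0.
Proof.
apply: contra_eq_neq (meval_dual_form j j) => ->.
by rewrite meval0 eqxx eq_sym oner_eq0.
Qed.

Local Notation L0 := (dual_form o0).
Local Notation L1 := (dual_form o1).
Local Notation L2 := (dual_form o2).
Local Notation onL := (restr idfun (M o0) (M o1)).

Lemma restr_dual_form j : onL (dual_form j) = (j == o0)%:R%:P + (j == o1)%:R *: 'X.
Proof.
rewrite /dual_form rmorph_sum /=.
have E k : onL (invmx M k j *: 'X_k) =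
    (M o0 k * invmx M k j)%:P + (M o1 k * invmx M k j) *: 'X.
  by rewrite -mul_mpolyC rmorphM /= restrC restrX mulrDr -polyCM -mul_polyC -mul_polyC
     mulrA -polyCM [_ * M o0 k]mulrC [_ * M o1 k]mulrC.
rewrite (eq_bigr _ (fun k _ => E k)) big_split /= -rmorph_sum -scaler_suml /=.
have /matrixP Em := mulmxV uM; have := Em o0 j; have := Em o1 j; rewrite !mxE => -> ->.
by rewrite ![j == _]eq_sym.
Qed.

(** The lift homogenizes g in the first two dual coordinates. D may exceed the degree of g, so that
    numerators and denominators of equal degree can be formed. *)
Lemma restr_lift D (g : {poly K}) : (size g <= D.+1)%N ->
  exists2 W : {mpoly K[3]}, W \is D.-homog & onL W = g.
Proof.
move=> sg; exists (\sum_(i < D.+1) g`_i *: (L1 ^+ i * L0 ^+ (D - i))).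
  apply: rpred_sum => i _; apply: dhomogZ; rewrite -[X in X.-homog](subnKC (_ : (i <= D)%N)) ?leq_ord //.
  by apply: dhomogM; rewrite -[X in X.-homog]mul1n dhomogMn ?dual_form_homog.
have {2}-> : g = \poly_(i < D.+1) g`_i.
  by apply/polyP => i; rewrite coef_poly; case: ltnP => // Di; rewrite nth_default // (leq_trans sg).
rewrite poly_def rmorph_sum /=.
apply: eq_bigr => i _; rewrite -mul_mpolyC !rmorphM !rmorphXn /= !restr_dual_form restrC.
by rewrite /= !scale0r scale1r add0r addr0 expr1n mulr1 mul_polyC.
Qed.

(** Setting the third coordinate to zero ([sg]) changes p by a multiple of [dual_form o2]. What
    remains is, in the fraction field, L0^D times the restriction of p evaluated at L1 / L0, hence
    zero. *)
Lemma restr_eq0_dvd D (p : {mpoly K[3]}) : p \is D.-homog -> onL p = 0 ->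
  exists B, p = B * L2.
Proof.
move=> hp p0.
pose sg := mmap (@mpolyC 3 K) (fun i => M o0 i *: L0 + M o1 i *: L1).
have sgD x y : sg (x + y) = sg x + sg y by exact: mmapD.
have sgM x y : sg (x * y) = sg x * sg y by rewrite /sg rmorphM.
have [B EB] : exists B, p - sg p = B * L2.
  elim/mpoly_ring_ind: p {hp p0} => [c|i|p q [B EB] [C EC]|p q [B EB] [C EC]].
  - by exists 0; rewrite /sg mmapC subrr mul0r.
  - exists (M o2 i)%:MP; rewrite /sg mmapX mmap1U [in LHS]sum_dual_form sum_ord3.
    by rewrite -!mul_mpolyC; ring.
  - by exists (B + C); rewrite sgD opprD addrACA EB EC mulrDl.
  exists (B * q + sg p * C); rewrite sgM mulrDl mulrAC -EB -mulrA -EC; ring.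
exists B; rewrite -EB; suff -> : sg p = 0 by rewrite subr0.
apply/eqP; rewrite -tofrac_eq0 /sg rmorph_mmap.
have L0n0 : L0%:F != 0 by rewrite tofrac_eq0 dual_form_neq0.
pose cF : {rmorphism K -> {fraction {mpoly K[3]}}} := @tofrac _ \o @mpolyC 3 K.
pose t := L1%:F / L0%:F.
have -> : mmap (@tofrac _ \o @mpolyC 3 K) (@tofrac _ \o (fun i => M o0 i *: L0 + M o1 i *: L1)) p =
    mmap cF (fun i => L0%:F * (cF (M o0 i) + cF (M o1 i) * t)) p.
  apply: eq_mmap => // i /=; rewrite rmorphD -!mul_mpolyC !rmorphM /= mulrDr mulrC.
  by congr (_ + _); rewrite /t [RHS]mulrC -mulrA divfK.
rewrite (mmap_homog _ _ _ hp) -restr_horner.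
have -> : restr cF (cF \o M o0) (cF \o M o1) p = map_poly cF (onL p) by rewrite map_restr.
by rewrite p0 rmorph0 horner0 mulr0.
Qed.

Lemma homog0_const n (R : nzRingType) (p : {mpoly R[n]}) : p \is 0.-homog -> p = (p@_0%MM)%:MP.
Proof.
move=> hp; apply/mpolyP => m; rewrite mcoeffC; case: (eqVneq 0%MM m) => [<-|m0]; rewrite ?mulr1 ?mulr0 //.
by apply: (dhomog_nemf_coeff hp) => /=; rewrite mdeg_eq0 eq_sym.
Qed.

Lemma line_dual_form l : is_line l -> l.@[M o0] = 0 -> l.@[M o1] = 0 ->
  exists2 c, c != 0 & l = c *: L2.
Proof.
move=> /andP[l0 hl] E0 E1; have : onL l = 0.
  have [sz c1] := restr_homog idfun (M o0) (M o1) hl; have c0 := coef0_restr idfun (M o0) (M o1) l.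
  apply/polyP => -[|[|i]]; rewrite coef0; [by rewrite c0|by rewrite c1|].
  by apply: nth_default; apply: leq_trans sz _.
case/(restr_eq0_dvd hl) => B EB; have BL : B * L2 != 0 by rewrite -EB.
have hBL : B * L2 \is 1.-homog by rewrite -EB.
have [i hB /andP[_ hL]] := homog_factor BL hBL.
have E1i := dhomog_uniq (dual_form_neq0 o2) (dual_form_homog o2) hL.
have i0 : i = 0%N by case: (i) E1i => [|[|]].
rewrite i0 in hB; have EBc := homog0_const hB; exists (B@_0%MM); last by rewrite EB {1}EBc mul_mpolyC.
by apply: contraNneq l0 => b0; rewrite EB EBc b0 mpolyC0 mul0r.
Qed.

End LineForms.

Lemma expf_div_mul (F : fieldType) (x y : F) i k : x != 0 -> (i <= k)%N ->
  y ^+ i * x ^+ (k - i) = y ^+ i / x ^+ i * x ^+ k.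
Proof. by move=> x0 ik; rewrite -[in RHS](subnKC ik) exprD mulrA divfK ?expf_neq0. Qed.

Section IntersectionWithLine.
Variables (K : fieldType) (M : 'M[K]_3) (P : PG2 K) (f : {mpoly K[3]}) (n m : nat).
Variables (g : {poly K}) (c : K).
Hypotheses (uM : M \in unitmx) (MP : row o0 M = val P) (hf : f \is n.-homog) (c0 : c != 0).
Hypotheses (fE : restr idfun (M o0) (M o1) f = 'X^m * g) (g0 : g.[0] != 0).

Local Notation onL := (restr idfun (M o0) (M o1)).
Local Notation L j := (dual_form M j).

Let evP p : eval_pt p P = p.@[M o0].
Proof. by apply: meval_eq => i; rewrite -MP mxE. Qed.

Let onL0 p : (onL p).[0] = eval_pt p P.
Proof. by rewrite horner_coef0 coef0_restr evP. Qed.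

Let onL2 : onL (L o2) = 0.
Proof. by rewrite restr_dual_form // scale0r addr0. Qed.

Let onLL1 : onL (L o1) = 'X.
Proof. by rewrite restr_dual_form // scale1r add0r. Qed.

Let onLL0 : onL (L o0) = 1.
Proof. by rewrite restr_dual_form // scale0r addr0. Qed.

(** The witnesses are the powers below k of the local parameter L1 / L0 of the line. If a
    combination lies in the ideal, clearing denominators and restricting to the line shows that X^k
    divides s times a polynomial of degree below k; as s does not vanish at P, that polynomial is
    zero. *)
Lemma intersection_mult_line_ge k g' : onL f = 'X^k * g' -> intersection_mult_ge P f (c *: L o2) k.
Proof.
move=> fE'.
have L0n0 : (L o0)%:F != 0 by rewrite tofrac_eq0 dual_form_neq0.
exists (fun i => (L o1 ^+ i)%:F / (L o0 ^+ i)%:F); split => [i|d].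
  exists i, (L o1 ^+ i), (L o0 ^+ i); split=> //.
  - by rewrite -[X in X.-homog]mul1n dhomogMn ?dual_form_homog.
  - by rewrite -[X in X.-homog]mul1n dhomogMn ?dual_form_homog.
  by rewrite evP rmorphXn /= meval_dual_form // eqxx expr1n oner_eq0.
case=> [k' [a [b [s [_ _ _ sP E]]]]].
have s0 : s%:F != 0 by rewrite tofrac_eq0; apply: contraNneq sP => ->; rewrite evP meval0.
have {}E : s * \sum_(i < k) (d i)%:MP * (L o1 ^+ i * L o0 ^+ (k - i)) =
    (a * f + b * (c *: L o2)) * L o0 ^+ k.
  have Y : (a * f + b * (c *: L o2))%:F = (\sum_(i < k) (d i)%:MP%:F * ((L o1 ^+ i)%:F / (L o0 ^+ i)%:F)) * s%:F.
    by rewrite E divfK.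
  apply/eqP; rewrite -tofrac_eq !rmorphM /= Y rmorph_sum /= [_ * s%:F]mulrC -mulrA mulr_suml.
  apply/eqP; congr (_ * _); apply: eq_bigr => i _; rewrite !rmorphM !rmorphXn /= -[RHS]mulrA.
  congr (_ * _); move: (tofrac (L o0)) (tofrac (L o1)) L0n0 (ltnW (ltn_ord i)) => x y x0 ik.
  by have := expf_div_mul y x0 ik.
have := congr1 onL E; rewrite !rmorphM rmorphD rmorph_sum !rmorphM /= -mul_mpolyC rmorphM /=.
rewrite !rmorphXn /= onL2 onLL0 expr1n !mulr0 addr0 mulr1 fE'.
under eq_bigr do rewrite !rmorphM !rmorphXn /= onLL1 onLL0 expr1n mulr1 restrC mul_polyC.
move=> E1 i.
have co : coprimep 'X^k (onL s) by rewrite coprimep_expl // coprimep_sym coprimepX rootE onL0.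
have dv : 'X^k %| \sum_(i < k) d i *: 'X^i.
  by rewrite -(Gauss_dvdpr _ co) E1 mulrC -mulrA dvdp_mulIl.
pose d' j := if insub j is Some i then d i else 0.
have d'E (j : 'I_k) : d' j = d j by rewrite /d' valK.
have Ed : \sum_(j < k) d j *: 'X^j = \poly_(j < k) d' j.
  by rewrite poly_def; apply: eq_bigr => j _; rewrite d'E.
rewrite Ed in dv; have r0 : \poly_(j < k) d' j = 0.
  apply: contraTeq dv => r0; apply: contraTN (size_poly k d') => /(dvdp_leq r0).
  by rewrite size_polyXn -ltnNge.
by have /(congr1 (fun p : {poly K} => p`_i)) := r0; rewrite coef_poly ltn_ord d'E coef0.
Qed.

(** Among k > m functions over a common denominator, some nontrivial combination has a numerator
    that vanishes to order m on the line, and such a function lies in the local ideal. *)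
Lemma intersection_mult_line_le k : intersection_mult_ge P f (c *: L o2) k -> (k <= m)%N.
Proof.
case=> phi [Hphi Hindep]; rewrite leqNgt; apply/negP => mk.
have {Hphi}[D HD] := fin_all_exists Hphi.
have {HD}[a Ha] := fin_all_exists HD; have {Ha}[s Hs] := fin_all_exists Ha.
pose S := \prod_i s i; pose dS := (\sum_i D i)%N.
have hprod (I : finType) (A : pred I) (F : I -> {mpoly K[3]}) (e : I -> nat) :
    (forall i, A i -> F i \is (e i).-homog) -> \prod_(i | A i) F i \is (\sum_(i | A i) e i).-homog.
  move=> HF; apply: (big_rec2 (fun (p : {mpoly K[3]}) j => p \is j.-homog)); first exact: dhomog1.
  by move=> i p j Ai hp; apply: dhomogM => //; apply: HF.
have hS : S \is dS.-homog by apply: hprod => i _; case: (Hs i).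
have SP : eval_pt S P != 0.
  by rewrite /eval_pt rmorph_prod /=; apply/prodf_neq0 => i _; case: (Hs i).
pose N i := a i * \prod_(j | j != i) s j.
have hN i : N i \is dS.-homog.
  rewrite /dS (bigD1 i) //=; apply: dhomogM; first by case: (Hs i).
  by apply: hprod => j _; case: (Hs j).
have phiE i : phi i = (N i)%:F / S%:F.
  have SE : S = s i * \prod_(j | j != i) s j by rewrite /S (bigD1 i).
  have [_ _ sP ->] := Hs i; have s0 : (s i)%:F != 0.
    by rewrite tofrac_eq0; apply: contraNneq sP => ->; rewrite /eval_pt meval0.
  have t0 : (\prod_(j | j != i) s j)%:F != 0.
    rewrite tofrac_eq0; apply: contraNneq SP => t0.
    by rewrite SE t0 mulr0 /eval_pt meval0.
  rewrite /N SE !tofracM; move: (tofrac (a i)) (tofrac (s i)) s0 (tofrac _) t0 => x y y0 z z0.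
  by rewrite -mulf_div divff // mulr1.
pose T : 'M[K]_(k, m) := \matrix_(i, j) (onL (N i))`_j.
have /rowV0Pn [v vT v0] : kermx T != 0.
  rewrite -mxrank_eq0 mxrank_ker subn_eq0 -ltnNge; exact: leq_ltn_trans (rank_leq_col T) mk.
pose NN := \sum_i v 0 i *: N i.
have hNN : NN \is dS.-homog by apply: rpred_sum => i _; apply: dhomogZ.
have EN : onL NN = \sum_i v 0 i *: onL (N i).
  by rewrite rmorph_sum; apply: eq_bigr => i _; rewrite -mul_mpolyC rmorphM /= restrC mul_polyC.
have Er : onL NN = drop_poly m (onL NN) * 'X^m.
  rewrite -[LHS](poly_take_drop m) (_ : take_poly m _ = 0) ?add0r //.
  apply/polyP => j; rewrite coef_take_poly coef0; case: ltnP => // jm.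
  have := sub_kermxP vT => /matrixP /(_ 0 (Ordinal jm)); rewrite !mxE => E0.
  by rewrite EN coef_sum -[RHS]E0; apply: eq_bigr => i _; rewrite coefZ !mxE.
set r := drop_poly m _ in Er.
have sr : (size r <= dS.+1)%N.
  by rewrite size_drop_poly (leq_trans (leq_subr _ _)) //; case: (restr_homog idfun (M o0) (M o1) hNN).
(* W lifts g, so it is a unit at P, and A lifts r. On the line both NN W and A f become X^m r g, so
   their difference is a multiple of the equation of the line. *)
have [W hW EW] : exists2 W, W \is n.-homog & onL W = g.
  apply: restr_lift => //; have [sf _] := restr_homog idfun (M o0) (M o1) hf.
  apply: leq_trans sf; rewrite fE mulrC size_mulXn ?leq_addl //.
  by apply: contraNneq g0 => ->; rewrite horner0.
have [A hA EA] := restr_lift uM sr.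
have hfA : A * f \is (dS + n).-homog by exact: dhomogM.
have [B EB] : exists B, NN * W - A * f = B * L o2.
  apply: (restr_eq0_dvd uM (D := (dS + n)%N)).
    by apply: rpredB => //; exact: dhomogM.
  by rewrite rmorphB !rmorphM /= EA EW Er fE; ring.
have WP : eval_pt W P != 0 by rewrite -onL0 EW.
suff /Hindep v00 : in_local_ideal P f (c *: L o2) (\sum_(i < k) ((v 0 i)%:MP)%:F * phi i).
  by case/eqP: v0; apply/rowP => i; rewrite v00 mxE.
exists (dS + n)%N, A, (c^-1 *: B), (S * W).
have BE : c^-1 *: B * (c *: L o2) = B * L o2.
  by rewrite -scalerAl -scalerAr scalerA mulVf // scale1r.
rewrite BE -EB; split=> //.
- by apply: rpredB => //; exact: dhomogM.
- exact: dhomogM.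
- by rewrite /eval_pt mevalM mulf_neq0.
rewrite addrC subrK; have W0 : W%:F != 0.
  by rewrite tofrac_eq0; apply: contraNneq WP => ->; rewrite /eval_pt meval0.
rewrite !tofracM.
have -> : \sum_(i < k) ((v 0 i)%:MP)%:F * phi i = NN%:F / S%:F.
  rewrite /NN rmorph_sum /= mulr_suml; apply: eq_bigr => i _.
  by rewrite phiE -mul_mpolyC [in RHS]tofracM mulrA.
move: (tofrac NN) (tofrac S) (tofrac W) W0 => x y z z0.
by rewrite -mulf_div divff // mulr1.
Qed.

Lemma intersection_mult_line k : intersection_mult_ge P f (c *: L o2) k <-> (k <= m)%N.
Proof.
split; first exact: intersection_mult_line_le.
by move=> km; apply: (@intersection_mult_line_ge _ ('X^(m - k) * g)); rewrite mulrA -exprD subnKC.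
Qed.
End IntersectionWithLine.

Section IntersectionWithGivenLine.
Variables (K : fieldType) (P : PG2 K) (Q : 'rV[K]_3) (f l : {mpoly K[3]}) (n : nat).
Hypotheses (PQ : row_free (col_mx (val P) Q)) (hf : f \is n.-homog) (hl : is_line l).
Hypotheses (lP : l.@[val P 0] = 0) (lQ : l.@[Q 0] = 0).

Local Notation onL := (restr idfun (val P 0) (Q 0)).

Lemma intersection_mult_geE m g k : onL f = 'X^m * g -> g.[0] != 0 ->
  intersection_mult_ge P f l k <-> (k <= m)%N.
Proof.
move=> fE g0; have [M [uM MP MQ]] := basis_of_pair PQ.
have EP i : M o0 i = val P 0 i by rewrite -MP mxE.
have EQ i : M o1 i = Q 0 i by rewrite -MQ mxE.
have [|| c c0 ->] := line_dual_form uM hl; [by rewrite (meval_eq _ EP)|by rewrite (meval_eq _ EQ)|].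
have E : restr idfun (M o0) (M o1) f = 'X^m * g by rewrite -fE; apply: eq_restr.
exact: (intersection_mult_line uM MP hf c0 E g0).
Qed.

Lemma intersection_mult_ge_dvd k : intersection_mult_ge P f l k -> 'X^k %| onL f.
Proof.
have [-> _|f0] := eqVneq (onL f) 0; first exact: dvdp0.
have [m [g]] := multiplicity_XsubC (onL f) 0; rewrite f0 subr0 rootE /= => g0 fE.
rewrite mulrC in fE; move/(intersection_mult_geE k fE g0) => km.
by rewrite fE -(subnKC km) exprD -mulrA dvdp_mulIl.
Qed.

End IntersectionWithGivenLine.

(** * The quadratic character and its convolutions *)

Section QuadraticCharacter.
Variables (F : finFieldType) (d : nat).
Hypotheses (cardF : #|F| = d.*2.+1) (d0 : (0 < d)%N).

(** Integer values let the character sums and the counts be computed in characteristic 0. *)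
Definition qchar (x : F) : int := if x == 0 then 0 else if x ^+ d == 1 then 1 else -1.
Local Notation chi := qchar.

Lemma expf_2d (x : F) : x != 0 -> x ^+ d.*2 = 1.
Proof.
move=> x0; apply: (mulfI x0); rewrite -exprS -cardF expf_card mulr1 //.
Qed.

Lemma expf_d_sign (x : F) : x != 0 -> x ^+ d = 1 \/ x ^+ d = -1.
Proof.
move=> /expf_2d; rewrite -muln2 exprM => /eqP; rewrite sqrf_eq1.
by case/orP => /eqP; [left | right].
Qed.

Lemma qcharE (x : F) : x ^+ d = (chi x)%:~R.
Proof.
rewrite /chi; case: eqVneq => [->|x0]; first by rewrite expr0n eqn0Ngt d0.
by case: (expf_d_sign x0) => ->; rewrite ?eqxx //; case: eqP => [->//|_]; rewrite rmorphN rmorph1.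
Qed.

Hypothesis char2 : (2%:R : F) != 0.

Lemma one_neq_m1 : (1 : F) != -1.
Proof. by rewrite -subr_eq0 opprK. Qed.

Lemma qchar_cases x : [\/ x = 0 /\ chi x = 0, x != 0 /\ chi x = 1 | x != 0 /\ chi x = -1].
Proof.
rewrite /chi; case: eqVneq => [->|x0]; first by constructor 1.
by case: eqP => _; [constructor 2 | constructor 3].
Qed.

Lemma qchar_eqP x (s : int) : s \in [:: 0; 1; -1] -> (chi x == s) = (x ^+ d == s%:~R).
Proof.
move=> hs; apply/eqP/eqP => [<-|]; first exact: qcharE.
rewrite qcharE; have n1 := one_neq_m1; have n2 : (-1 : F) != 0 by rewrite oppr_eq0 oner_eq0.
move: hs; rewrite !inE; case: (qchar_cases x) => -[_ ->] /or3P[] /eqP -> //;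
  rewrite ?rmorphN ?rmorph0 ?rmorph1 => /eqP;
  by rewrite ?oppr_eq0 ?oner_eq0 ?[0 == _]eq_sym ?oppr_eq0 ?oner_eq0 ?[-1 == _]eq_sym ?(negPf n1).
Qed.

Lemma qcharM x y : chi (x * y) = chi x * chi y.
Proof.
apply/eqP; rewrite qchar_eqP; first by rewrite exprMn !qcharE rmorphM.
by case: (qchar_cases x) => -[_ ->]; case: (qchar_cases y) => -[_ ->].
Qed.

Lemma qchar0 : chi 0 = 0. Proof. by rewrite /chi eqxx. Qed.

Lemma qchar_eq0 x : (chi x == 0) = (x == 0).
Proof. by case: (qchar_cases x) => -[]; [move=> -> ->; rewrite !eqxx | move=> /negPf -> -> | move=> /negPf -> ->]. Qed.

Lemma qchar_sqr x : x != 0 -> chi x * chi x = 1.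
Proof. by case: (qchar_cases x) => -[-> ->]; rewrite ?eqxx. Qed.

Lemma exists_nonsquare : exists x, chi x = -1.
Proof.
have [/existsP[x /eqP]|/existsPn H] := boolP [exists x, chi x == -1]; first by exists x.
have p0 : 'X^d - 1 != 0 :> {poly F} by rewrite -size_poly_gt0 size_XnsubC.
have := max_poly_roots (rs := enum (predC1 (0 : F))) p0.
rewrite enum_uniq size_XnsubC // -cardE cardC1 cardF /= ltnS => lt.
suff : (d.*2 <= d)%N by rewrite -addnn -{3}[d]addn0 leq_add2l leqNgt d0.
apply: lt => //; apply/allP => x; rewrite mem_enum => x0.
rewrite /root !hornerE; case: (expf_d_sign x0) => [->|E]; first by rewrite subrr.
by have := H x; rewrite qchar_eqP // E rmorphN rmorph1 eqxx.
Qed.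

Lemma sum_qchar : \sum_x chi x = 0.
Proof.
have [g Hg] := exists_nonsquare.
have g0 : g != 0 by rewrite -qchar_eq0 Hg.
have : \sum_x chi x = - \sum_x chi x.
  rewrite {1}(reindex_inj (mulfI g0)) -sumrN; apply: eq_bigr => x _.
  by rewrite qcharM Hg mulN1r.
move/eqP; rewrite -subr_eq0 opprK -mulr2n Num.Theory.mulrn_eq0 /=; exact/eqP.
Qed.

(** For z nonzero, the substitution x |-> 1/x turns the summand into chi(e + z x), because chi(x)^2
    = 1. The sum of these over all x is 0, so minus the term at x = 0 remains. *)
Lemma qchar_correlation (e z : F) : e != 0 ->
  \sum_x chi x * chi (z + e * x) = chi e * (#|F|%:R * (z == 0)%:R - 1).
Proof.
move=> e0; rewrite (bigD1 0) //= qchar0 mul0r add0r.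
have [->|z0] := eqVneq z 0.
  under eq_bigr => x x0 do rewrite add0r qcharM mulrCA qchar_sqr // mulr1.
  rewrite sumr_const mulr1 -[in LHS]mulr_natr; congr (_ * _).
  by rewrite (cardC1 (0 : F)) cardF /= -[in RHS]addn1 natrD addrK.
rewrite mulr0 sub0r mulrN1; transitivity (\sum_(x | x != 0) chi (e + z * x)).
  rewrite [LHS](reindex_inj invr_inj) /=; apply: eq_big => x; first by rewrite invr_eq0.
  rewrite invr_eq0 => x0; rewrite -qcharM -[RHS]mul1r -[in RHS](qchar_sqr (x := x^-1)) ?invr_eq0 //.
  by rewrite -!qcharM; congr chi; field.
have := sum_qchar; rewrite (reindex_inj (addrI e)) (reindex_inj (mulfI z0)) (bigD1 0) //=.
by rewrite mulr0 addr0 addrC => /eqP; rewrite addr_eq0 => /eqP.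
Qed.

(* [(a, b, c)] stands for the function a + b [x = 0] + c chi x; these functions form an algebra
   under convolution. *)
Definition chi_fun (t : rat * rat * rat) (x : F) : rat :=
  t.1.1 + t.1.2 * (x == 0)%:R + t.2 * (chi x)%:~R.

Lemma sum_chi_fun t : \sum_x chi_fun t x = #|F|%:R * t.1.1 + t.1.2.
Proof.
have S0 : \sum_x (chi x)%:~R = 0 :> rat by rewrite -rmorph_sum sum_qchar.
rewrite /chi_fun !big_split /= sumr_const -!mulr_sumr S0 mulr0 addr0 -[X in X + _]mulr_natl; congr (_ + _).
rewrite -[RHS]mulr1; congr (_ * _).
by rewrite (bigD1 0) //= eqxx big1 ?addr0 ?mulr1 // => x /negPf ->.
Qed.

Lemma sum_indicator (G : F -> rat) (a : F) : \sum_x (x == a)%:R * G x = G a.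
Proof.
by rewrite (bigD1 a) //= eqxx mul1r big1 ?addr0 // => x /negPf ->; rewrite mul0r.
Qed.
End QuadraticCharacter.

(* [q] is the order of the field, [s] and [s1] are the characters of e and of -1. *)
Definition chi_conv (q s s1 : rat) (t t' : rat * rat * rat) : rat * rat * rat :=
  let: (a, b, c) := t in let: (a', b', c') := t' in
  if s == 0 then ((q * a + b) * a', (q * a + b) * b', (q * a + b) * c')
  else (q * a * a' + a * b' + b * a' - s * c * c', b * b' + q * s * c * c', b * c' + s1 * s * c * b').

Section QuadraticCharacter2.
Variables (F : finFieldType) (d : nat).
Hypotheses (cardF : #|F| = d.*2.+1) (d0 : (0 < d)%N) (char2 : (2%:R : F) != 0).
Local Notation chi := (@qchar F d).
Local Notation chi_fun := (@chi_fun F d).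

(** After expansion the only sum that is not immediate is that of two characters, which is
    [qchar_correlation]; the factor chi(-1) chi(e) comes from evaluating chi at the zero -z / e of z
    + e x. For e = 0 the second factor leaves the sum. *)
Lemma chi_convE e t t' z :
  \sum_x chi_fun t x * chi_fun t' (z + e * x) =
  chi_fun (chi_conv #|F|%:R (chi e)%:~R (chi (-1))%:~R t t') z.
Proof.
rewrite /chi_conv; case: t t' => [[a b] c] [[a' b'] c'].
rewrite intr_eq0 qchar_eq0 //; have [->|e0] := eqVneq e 0.
  under eq_bigr do rewrite mul0r addr0.
  rewrite -mulr_suml sum_chi_fun // /chi_fun /=; ring.
pose q : rat := #|F|%:R; pose X x : rat := (chi x)%:~R.
have S1 : \sum_x X x = 0 by rewrite /X -rmorph_sum sum_qchar.
have S2 : \sum_x X (z + e * x) = 0.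
  have := S1; rewrite (reindex_inj (addrI z)) (reindex_inj (mulfI e0)) => /= {2}<-; exact: eq_bigr.
have S3 : \sum_x X x * X (z + e * x) = X e * (q * (z == 0)%:R - 1).
  have /(congr1 (fun n : int => n%:~R : rat)) := qchar_correlation cardF d0 char2 z e0.
  rewrite rmorph_sum /= rmorphM rmorphB rmorphM /= !rmorph_nat rmorph1 => <-.
  by apply: eq_bigr => x _; rewrite rmorphM.
have E0 x : (z + e * x == 0) = (x == - z / e).
  by rewrite addrC addr_eq0 -[RHS](inj_eq (mulfI e0)) mulrCA divff // mulr1.
have S4 (G : F -> rat) : \sum_x (z + e * x == 0)%:R * G x = G (- z / e).
  under eq_bigr do rewrite E0; exact: sum_indicator.
have S5 (G : F -> rat) : \sum_x (x == 0)%:R * G x = G 0 by exact: sum_indicator.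
have S6 : X (- z / e) = X (-1) * X e * X z.
  rewrite /X -!rmorphM -!qcharM //; congr (_%:~R).
  have -> : - z / e = (- 1 * e * z) * (e^-1 * e^-1) by field.
  by rewrite [LHS]qcharM // [X in _ * X]qcharM // qchar_sqr ?mulr1 ?invr_eq0.
have N1 : \sum_(x : F) 1 = q by rewrite sumr_const.
transitivity (a * a' * \sum_(x : F) 1 + a * b' * \sum_x (z + e * x == 0)%:R * 1 + a * c' * \sum_x X (z + e * x)
   + \sum_x (x == 0)%:R * (b * chi_fun (a', b', c') (z + e * x)) + c * a' * \sum_x X x
   + c * b' * \sum_x (z + e * x == 0)%:R * X x + c * c' * \sum_x X x * X (z + e * x) : rat).
  rewrite !mulr_sumr -!big_split /=; apply: eq_bigr => x _; rewrite /chi_fun /= -/(X x) -/(X (z + e * x)).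
  move: ((x == 0)%:R) ((z + e * x == 0)%:R) (X x) (X (z + e * x)) => u v w y; ring.
have E : z + e * 0 = z by rewrite mulr0 addr0.
rewrite S4 S5 S4 S1 S2 S3 N1 S6 E /chi_fun /= -/(X z) -/(X e) -/(X (-1)) -/q.
move: ((z == 0)%:R) (X z) (X e) (X (-1)) => u v w y. ring.
Qed.
End QuadraticCharacter2.

(** * Counting vectors by the signs of the four terms *)

Lemma sum_row3 (F : finFieldType) (V : nmodType) (G : 'rV[F]_3 -> V) :
  \sum_v G v = \sum_x \sum_y \sum_z G (\row_i [:: x; y; z]`_i).
Proof.
rewrite pair_bigA pair_bigA /= (reindex (fun p : F * F * F => \row_i [:: p.1.1; p.1.2; p.2]`_i)) //.
exists (fun v : 'rV[F]_3 => (v 0 o0, v 0 o1, v 0 o2)) => [[[x y] z] _ | v _]; first by rewrite !mxE.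
by apply/rowP => i; rewrite mxE; case: (ord3P i) => ->.
Qed.

Definition sign_tri (s : int) : rat * rat * rat :=
  if s == 0 then (0, 1, 0) else (1 / 2%:R, - (1 / 2%:R), s%:~R / 2%:R).

(* Each sign is replaced by its indicator function; the value at 0 of their convolution, weighted by
   the coefficients of the fourth term, is the number of vectors with the given four signs. *)
Definition pattern_count (q a0 a1 a2 n1 : rat) (s : int * int * int * int) : rat :=
  let: (s0, s1, s2, s3) := s in
  let t := chi_conv q a0 n1 (sign_tri s0) (chi_conv q a1 n1 (sign_tri s1)
             (chi_conv q a2 n1 (sign_tri s2) (sign_tri s3))) in t.1.1 + t.1.2.

Definition signs : seq int := [:: 0; 1; -1].

Section PatternCount.
Variables (F : finFieldType) (d : nat) (e : 'I_3 -> F).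
Hypotheses (cardF : #|F| = d.*2.+1) (d0 : (0 < d)%N) (char2 : (2%:R : F) != 0).
Local Notation chi := (@qchar F d).

Definition pattern (v : 'rV[F]_3) : int * int * int * int :=
  (chi (v 0 o0), chi (v 0 o1), chi (v 0 o2), chi (\sum_i e i * v 0 i)).

Lemma chi_fun_sign s x : s \in signs -> chi_fun d (sign_tri s) x = (chi x == s)%:R.
Proof.
rewrite !inE /chi_fun /sign_tri; case: (qchar_cases d x) => -[].
- by move=> -> ->; rewrite eqxx => /or3P[] /eqP ->.
- by move=> /negPf -> ->  => /or3P[] /eqP ->.
by move=> /negPf -> ->  => /or3P[] /eqP ->.
Qed.

Lemma card_pattern s : [&& s.1.1.1 \in signs, s.1.1.2 \in signs, s.1.2 \in signs & s.2 \in signs] ->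
  #|[set v | pattern v == s]|%:R =
  pattern_count #|F|%:R (chi (e o0))%:~R (chi (e o1))%:~R (chi (e o2))%:~R (chi (-1))%:~R s.
Proof.
case: s => [[[s0 s1] s2] s3] /= /and4P[h0 h1 h2 h3].
have EV t : t.1.1 + t.1.2 = chi_fun d t (0 : F).
  by rewrite /chi_fun eqxx qchar0 mulr1 mulr0 addr0.
rewrite EV -chi_convE //.
have -> : #|[set v | pattern v == (s0, s1, s2, s3)]|%:R =
    \sum_v (pattern v == (s0, s1, s2, s3))%:R :> rat.
  by rewrite -sum1_card natr_sum big_mkcond; apply: eq_bigr => v _; rewrite inE; case: eqP.
rewrite sum_row3; apply: eq_bigr => x _; rewrite -chi_convE // mulr_sumr; apply: eq_bigr => y _.
rewrite -chi_convE // !mulr_sumr; apply: eq_bigr => z _.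
rewrite !chi_fun_sign // /pattern sum_ord3 !mxE /= add0r -!natrM !mulnb -pair_eqE /= -pair_eqE /= -pair_eqE /=.
by rewrite !andbA.
Qed.
End PatternCount.

Definition balanced_patterns : seq (int * int * int * int) :=
  [:: (1, 1, -1, -1); (1, -1, 1, -1); (1, -1, -1, 1); (-1, 1, 1, -1); (-1, 1, -1, 1); (-1, -1, 1, 1)].

Definition two_zero_patterns : seq (int * int * int * int) :=
  [:: (0, 0, 1, -1); (0, 0, -1, 1); (0, 1, 0, -1); (0, -1, 0, 1); (0, 1, -1, 0); (0, -1, 1, 0);
      (1, 0, 0, -1); (-1, 0, 0, 1); (1, 0, -1, 0); (-1, 0, 1, 0); (1, -1, 0, 0); (-1, 1, 0, 0)].

Definition sum_patterns (ps : seq (int * int * int * int)) (q a0 a1 a2 n1 : rat) : rat :=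
  \sum_(s <- ps) pattern_count q a0 a1 a2 n1 s.

Ltac eval_patterns H0 H1 H2 :=
  rewrite /sum_patterns /balanced_patterns /two_zero_patterns !big_cons !big_nil
    /pattern_count /sign_tri /chi_conv ?(H0, H1, H2) ?(eqxx, oner_eq0, oppr_eq0)
    ?rmorph0 ?rmorphN ?rmorph1 /=; by field.

Section SumPatterns.
Variables (q a0 a1 a2 n1 : rat).

(** In the suffixes of this family, n and z tell whether each coefficient is nonzero or zero:
    [chi_conv] degenerates at a zero coefficient, so each vanishing pattern has its own closed
    form. *)
Lemma sum_patterns_nnn : a0 != 0 -> a1 != 0 -> a2 != 0 ->
  let b := n1 * (a0 * a1 + a0 * a2 + a1 * a2) + (a0 + a1 + a2) in
  sum_patterns balanced_patterns q a0 a1 a2 n1 =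
    (q - 1) * (3%:R * (q ^+ 2 - 3%:R * q + 3%:R) - b + 3%:R * q * n1 * (a0 * a1 * a2)) / 8%:R /\
  sum_patterns two_zero_patterns q a0 a1 a2 n1 = (q - 1) * (6%:R - b) / 2%:R.
Proof. move=> /negPf H0 /negPf H1 /negPf H2 b; rewrite /b; split; eval_patterns H0 H1 H2.
Qed.

Lemma sum_patterns_znn : a0 = 0 -> a1 != 0 -> a2 != 0 ->
  sum_patterns balanced_patterns q a0 a1 a2 n1 =
    (q - 1) ^+ 2 * (3%:R * (q - 2%:R) + n1 * (a1 * a2) + a1 + a2) / 8%:R /\
  sum_patterns two_zero_patterns q a0 a1 a2 n1 = (q - 1) * (3%:R - n1 * (a1 * a2) - a1 - a2) / 2%:R.
Proof. by move=> H0 /negPf H1 /negPf H2; split; eval_patterns H0 H1 H2. Qed.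

Lemma sum_patterns_nzn : a0 != 0 -> a1 = 0 -> a2 != 0 ->
  sum_patterns balanced_patterns q a0 a1 a2 n1 =
    (q - 1) ^+ 2 * (3%:R * (q - 2%:R) + n1 * (a0 * a2) + a0 + a2) / 8%:R /\
  sum_patterns two_zero_patterns q a0 a1 a2 n1 = (q - 1) * (3%:R - n1 * (a0 * a2) - a0 - a2) / 2%:R.
Proof. by move=> /negPf H0 H1 /negPf H2; split; eval_patterns H0 H1 H2. Qed.

Lemma sum_patterns_nnz : a0 != 0 -> a1 != 0 -> a2 = 0 ->
  sum_patterns balanced_patterns q a0 a1 a2 n1 =
    (q - 1) ^+ 2 * (3%:R * (q - 2%:R) + n1 * (a0 * a1) + a0 + a1) / 8%:R /\
  sum_patterns two_zero_patterns q a0 a1 a2 n1 = (q - 1) * (3%:R - n1 * (a0 * a1) - a0 - a1) / 2%:R.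
Proof. by move=> /negPf H0 /negPf H1 H2; split; eval_patterns H0 H1 H2. Qed.

Lemma sum_patterns_nzz : a0 != 0 -> a1 = 0 -> a2 = 0 ->
  sum_patterns balanced_patterns q a0 a1 a2 n1 = (q - 1) ^+ 3 * (3%:R - a0) / 8%:R /\
  sum_patterns two_zero_patterns q a0 a1 a2 n1 = (q - 1) * (q - a0) / 2%:R.
Proof. by move=> /negPf H0 H1 H2; split; eval_patterns H0 H1 H2. Qed.

Lemma sum_patterns_znz : a0 = 0 -> a1 != 0 -> a2 = 0 ->
  sum_patterns balanced_patterns q a0 a1 a2 n1 = (q - 1) ^+ 3 * (3%:R - a1) / 8%:R /\
  sum_patterns two_zero_patterns q a0 a1 a2 n1 = (q - 1) * (q - a1) / 2%:R.
Proof. by move=> H0 /negPf H1 H2; split; eval_patterns H0 H1 H2. Qed.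

Lemma sum_patterns_zzn : a0 = 0 -> a1 = 0 -> a2 != 0 ->
  sum_patterns balanced_patterns q a0 a1 a2 n1 = (q - 1) ^+ 3 * (3%:R - a2) / 8%:R /\
  sum_patterns two_zero_patterns q a0 a1 a2 n1 = (q - 1) * (q - a2) / 2%:R.
Proof. by move=> H0 H1 /negPf H2; split; eval_patterns H0 H1 H2. Qed.

Lemma sum_patterns_zzz : a0 = 0 -> a1 = 0 -> a2 = 0 ->
  sum_patterns balanced_patterns q a0 a1 a2 n1 = 0 /\
  sum_patterns two_zero_patterns q a0 a1 a2 n1 = 3%:R * (q - 1) ^+ 2 / 2%:R.
Proof. by move=> H0 H1 H2; split; eval_patterns H0 H1 H2. Qed.

End SumPatterns.

(* The types of coefficients for which the curve has a linear component, and for which it is the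
   union of d concurrent lines; the arguments are the quadratic characters of the e_i and of -1. *)
Definition line_type (a0 a1 a2 n1 : int) : bool :=
  (a0 * a1 * a2 == n1) && [|| a0 == -1, a1 == -1 | a2 == -1].

Definition union_type (a0 a1 a2 : int) : bool :=
  [|| (a0 == 0) && (a1 == 0) && (a2 == -1), (a0 == 0) && (a1 == -1) && (a2 == 0)
    | (a0 == -1) && (a1 == 0) && (a2 == 0)].

Section CountBySigns.
Variables (d : nat) (a0 a1 a2 n1 : int).
Hypotheses (h0 : a0 \in signs) (h1 : a1 \in signs) (h2 : a2 \in signs) (hn : n1 \in [:: 1; -1]).

Local Notation q := (2%:R * d%:R + 1 : rat).
Local Notation sum_pat ps := (sum_patterns ps q a0%:~R a1%:~R a2%:~R n1%:~R).

Ltac split_signs := move: h0 h1 h2 hn; rewrite !inE;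
  move=> /or3P[] /eqP-> /or3P[] /eqP-> /or3P[] /eqP-> /orP[] /eqP->.

Ltac closed_forms :=
  match goal with |- context [sum_patterns balanced_patterns ?q ?x ?y ?z ?n] =>
    let E4 := fresh "E4" in let E2 := fresh "E2" in
    first [ destruct (@sum_patterns_nnn q x y z n isT isT isT) as [E4 E2]
          | destruct (@sum_patterns_znn q x y z n (erefl _) isT isT) as [E4 E2]
          | destruct (@sum_patterns_nzn q x y z n isT (erefl _) isT) as [E4 E2]
          | destruct (@sum_patterns_nnz q x y z n isT isT (erefl _)) as [E4 E2]
          | destruct (@sum_patterns_nzz q x y z n isT (erefl _) (erefl _)) as [E4 E2]
          | destruct (@sum_patterns_znz q x y z n (erefl _) isT (erefl _)) as [E4 E2]
          | destruct (@sum_patterns_zzn q x y z n (erefl _) (erefl _) isT) as [E4 E2]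
          | destruct (@sum_patterns_zzz q x y z n (erefl _) (erefl _) (erefl _)) as [E4 E2] ];
    rewrite E4 E2 ?rmorph0 ?rmorphN ?rmorph1; clear E4 E2 end.

(** A point has 2 d = q - 1 representing vectors, so B is the number of points with two vanishing
    terms. B = 3 d occurs when all coefficients vanish, B = d when a single one is nonzero, and the
    values up to 3 otherwise; every sign combination is checked on the closed forms. *)
Lemma no_line_count : ~~ line_type a0 a1 a2 n1 -> ~~ union_type a0 a1 a2 ->
  exists2 B, B \in [:: 0; 1; 2; 3; d; 3 * d]%N &
    sum_pat two_zero_patterns = 2%:R * d%:R * B%:R /\
    sum_pat balanced_patterns = d%:R * d%:R * (3%:R * d%:R - B%:R).
Proof.
split_signs => H1 H2; vm_compute in H1; vm_compute in H2; try (by []); clear H1 H2; closed_forms;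
  first [ by exists 0%N; rewrite ?inE ?eqxx ?orbT //; split; field
        | by exists 3%N; rewrite ?inE ?eqxx ?orbT //; split; field
        | by exists 1%N; rewrite ?inE ?eqxx ?orbT //; split; field
        | by exists 2%N; rewrite ?inE ?eqxx ?orbT //; split; field
        | by exists d; rewrite ?inE ?eqxx ?orbT //; split; field
        | by exists (3 * d)%N; rewrite ?inE ?eqxx ?orbT ?natrM //; split; field ].
Qed.

(** The list holds the numbers of points on N lines of which no three concur. What is left for a
    residual curve of degree n = d - N is n (n + 2 d) / 2 points, that is n (n + q - 1) / 2. *)
Lemma line_count (N : nat) : line_type a0 a1 a2 n1 -> N = ((a0 == -1)%R + (a1 == -1)%R + (a2 == -1)%R)%N ->
  sum_pat two_zero_patterns + sum_pat balanced_patterns =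
    d%:R * (d%:R - N%:R) * (3%:R * d%:R - N%:R)
      + 2%:R * d%:R * nth 0 [:: 0; q + 1; 2%:R * q + 1; 3%:R * q] N.
Proof.
split_signs => H; vm_compute in H; try (by []); clear H => ->; closed_forms; rewrite /=; by field.
Qed.

Lemma line_type_parity N : line_type a0 a1 a2 n1 -> N = ((a0 == -1)%R + (a1 == -1)%R + (a2 == -1)%R)%N ->
  n1 = (-1) ^+ N.
Proof. by split_signs => H; vm_compute in H; try (by []); clear H => ->. Qed.
End CountBySigns.

(** * Points of the projective plane and their vectors *)

Lemma normalized_neq0 (R : fieldType) (P : PG2 R) : val P != 0.
Proof.
case: P => v /existsP[i /andP[/eqP vi _]] /=; apply: contra_eq_neq vi => ->.
by rewrite mxE eq_sym oner_eq0.
Qed.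

Lemma point_coord_neq0 (R : fieldType) (P : PG2 R) : exists i, val P 0 i != 0.
Proof.
apply/existsP; apply: contraT => /existsPn H; have := normalized_neq0 P.
by case/eqP; apply/rowP => i; rewrite mxE; apply/eqP; have := H i; rewrite negbK.
Qed.

Lemma normalized_inj (R : fieldType) (P Q : PG2 R) (a b : R) :
  a != 0 -> b != 0 -> a *: val P = b *: val Q -> a = b /\ P = Q.
Proof.
move=> a0 b0 E; have v0 : a *: val P != 0 by rewrite scaler_eq0 negb_or a0 normalized_neq0.
have [X [_ U]] := normalized_unique v0.
have PQ : P = Q by rewrite -(U P); [apply: U; exists b | exists a].
split=> //; move: E; rewrite -PQ => /eqP; rewrite -subr_eq0 -scalerBl scaler_eq0.
by rewrite (negPf (normalized_neq0 P)) orbF subr_eq0 => /eqP.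
Qed.

Lemma normalize (R : fieldType) (v : 'rV[R]_3) : v != 0 ->
  exists P : PG2 R, exists2 c, c != 0 & v = c *: val P.
Proof. by move=> /normalized_unique [P [H _]]; exists P. Qed.

Lemma card_cone (F : finFieldType) (S : pred 'rV[F]_3) :
  (forall c v, c != 0 -> S (c *: v) = S v) ->
  #|[set v | (v != 0) && S v]| = (#|F|.-1 * #|[set P : PG2 F | S (val P)]|)%N.
Proof.
move=> HS; pose A := setX [set~ (0 : F)] [set P : PG2 F | S (val P)].
have -> : [set v | (v != 0) && S v] = [set x.1 *: val x.2 | x in A].
  apply/setP => v; rewrite inE; apply/andP/imsetP => [[v0 Sv]|[[c P]]].
    have [P [c c0 E]] := normalize v0; exists (c, P) => //.
    by rewrite !inE c0 /= -(HS c) // -E.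
  rewrite !inE /= => /andP[c0 SP] ->; rewrite HS // scaler_eq0 negb_or c0.
  by rewrite (negPf (normalized_neq0 P)).
rewrite card_in_imset ?cardsX ?cardsC1 // => -[a P] [b Q].
rewrite !inE /= => /andP[a0 _] /andP[b0 _] E.
by have [-> ->] := normalized_inj a0 b0 E.
Qed.

Lemma eval_ptZ (R : fieldType) (f : {mpoly R[3]}) n (v : 'rV[R]_3) (P : PG2 R) c :
  f \is n.-homog -> c != 0 -> v = c *: val P -> (f.@[v 0] == 0) = (eval_pt f P == 0).
Proof.
move=> hf c0 ->; rewrite /eval_pt (_ : f.@[_] = c ^+ n * f.@[val P 0]).
  by rewrite mulf_eq0 expf_eq0 (negPf c0) andbF.
by rewrite -(meval_homog _ _ hf); apply: meval_eq => i; rewrite !mxE.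
Qed.

Lemma points_of_vectors (R : fieldType) (vs : seq 'rV[R]_3) :
  exists s : seq (PG2 R), forall P, (exists2 w, w \in vs & exists2 c, c != 0 & val P = c *: w) -> P \in s.
Proof.
elim: vs => [|v vs [s Hs]]; first by exists [::] => P [].
have [v0|v0] := eqVneq v 0.
  exists s => P [w]; rewrite inE => /orP[/eqP->|wv] [c c0 E]; last by apply: Hs; exists w => //; exists c.
  by move: (normalized_neq0 P); rewrite E v0 scaler0 eqxx.
have [Q [b b0 Eb]] := normalize v0; exists (Q :: s) => P [w].
rewrite !inE => /orP[/eqP->|wv] [c c0 E]; last by rewrite Hs ?orbT //; exists w => //; exists c.
rewrite Eb scalerA in E; have [] := @normalized_inj _ P Q 1 (c * b); rewrite ?oner_eq0 ?mulf_neq0 ?scale1r //.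
by move=> _ ->; rewrite eqxx.
Qed.

(** * The four-term form and its linear components *)

(** Cyclic successors of an index, so that arguments about a distinguished coordinate k are made
    once for all three. *)
Definition rot1 (k : 'I_3) : 'I_3 := if k == o0 then o1 else if k == o1 then o2 else o0.
Definition rot2 (k : 'I_3) : 'I_3 := if k == o0 then o2 else if k == o1 then o0 else o1.

Lemma sum_rot (V : nmodType) (F : 'I_3 -> V) k : \sum_i F i = F k + F (rot1 k) + F (rot2 k).
Proof.
rewrite sum_ord3; case: (ord3P k) => ->; rewrite /rot1 /rot2 //=; first by rewrite -addrA addrC.
by rewrite addrC addrA.
Qed.

Lemma rot_neq k : [/\ rot1 k != k, rot2 k != k & rot1 k != rot2 k].
Proof. by case: (ord3P k) => ->. Qed.

Lemma rotP (k i : 'I_3) : [\/ i = k, i = rot1 k | i = rot2 k].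
Proof.
by case: (ord3P k) => ->; case: (ord3P i) => ->; first [by constructor 1 | by constructor 2 | by constructor 3].
Qed.

Section FourTermForm.
Variables (R : fieldType) (e : 'I_3 -> R) (d : nat).
Implicit Types (v w : 'I_3 -> R) (k : 'I_3).
Local Notation f := (four_term_form d e).

Definition fourth v : R := \sum_i e i * v i.

Lemma fourth_rot v k : fourth v = e k * v k + e (rot1 k) * v (rot1 k) + e (rot2 k) * v (rot2 k).
Proof. exact: sum_rot. Qed.

Lemma four_term_homog : f \is d.-homog.
Proof.
have X1 (i : 'I_3) : ('X_i : {mpoly R[3]}) \is 1.-homog by rewrite dhomogX /= mdeg1.
have Xd (p : {mpoly R[3]}) : p \is 1.-homog -> p ^+ d \is d.-homog.
  by move=> hp; have := dhomogMn d hp; rewrite mul1n.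
apply: rpredD; first by apply: rpred_sum => i _; apply: Xd.
by apply: Xd; apply: rpred_sum => i _; exact: dhomogZ.
Qed.

Lemma meval_four_term v : f.@[v] = \sum_i v i ^+ d + fourth v ^+ d.
Proof.
rewrite rmorphD rmorph_sum rmorphXn rmorph_sum /=; congr (_ + _ ^+ d).
  by apply: eq_bigr => i _; rewrite rmorphXn /= mevalXU.
by apply: eq_bigr => i _; rewrite mevalZ mevalXU.
Qed.

Lemma restr_four_term v w : restr idfun v w f =
  \sum_i ((v i)%:P + w i *: 'X) ^+ d + ((fourth v)%:P + fourth w *: 'X) ^+ d.
Proof.
rewrite rmorphD rmorph_sum rmorphXn rmorph_sum /=; congr (_ + _ ^+ d).
  by apply: eq_bigr => i _; rewrite rmorphXn /= restrX.
rewrite /fourth rmorph_sum scaler_suml -big_split; apply: eq_bigr => i _.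
by rewrite -mul_mpolyC rmorphM /= restrC restrX mulrDr -polyCM mul_polyC scalerA.
Qed.

Lemma coef_affine_exp (a b : R) n j :
  (((a%:P + b *: 'X) ^+ n)`_j) = (a ^+ (n - j) * b ^+ j) *+ 'C(n, j).
Proof.
rewrite exprDn coef_sum; under eq_bigr => i _ do
  rewrite coefMn -polyC_exp exprZn coefCM coefZ coefXn mulrA.
have [jn|nj] := leqP j n.
  rewrite (bigD1 (Ordinal (jn : (j < n.+1)%N))) //= eqxx mulr1 big1 ?addr0 // => i ij.
  by rewrite (_ : (j == i) = false) ?mulr0 ?mul0r ?mul0rn //; apply: contraNF ij => /eqP E; apply/eqP/val_inj.
rewrite bin_small // mulr0n big1 // => i _.
by rewrite (_ : (j == i) = false) ?mulr0 ?mul0r ?mul0rn //; apply/gtn_eqF; apply: leq_trans nj; rewrite ltnS; exact: leq_ord.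
Qed.

Lemma coef_restr_four_term v w j : (restr idfun v w f)`_j =
  (\sum_i v i ^+ (d - j) * w i ^+ j + fourth v ^+ (d - j) * fourth w ^+ j) *+ 'C(d, j).
Proof.
rewrite restr_four_term coefD coef_sum coef_affine_exp mulrnDl -sumrMnl; congr (_ + _).
by apply: eq_bigr => i _; rewrite coef_affine_exp.
Qed.

End FourTermForm.

Lemma row_free_minor (R : fieldType) (P Q : 'rV[R]_3) i j :
  P 0 i * Q 0 j - P 0 j * Q 0 i != 0 -> row_free (col_mx P Q).
Proof.
move=> m0; apply/inj_row_free => c; rewrite -[c]hsubmxK mul_row_col => /rowP E.
move: (lsubmx c) (rsubmx c) E => a b E.
have Ec k : a 0 0 * P 0 k + b 0 0 * Q 0 k = 0.
  by have := E k; rewrite !mxE !big_ord1.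
have a0 : a 0 0 = 0.
  apply: (mulIf m0); rewrite mul0r.
  transitivity (Q 0 j * (a 0 0 * P 0 i + b 0 0 * Q 0 i) - Q 0 i * (a 0 0 * P 0 j + b 0 0 * Q 0 j)); first by ring.
  by rewrite !Ec !mulr0 subrr.
have b0 : b 0 0 = 0.
  apply: (mulIf m0); rewrite mul0r.
  transitivity (P 0 i * (a 0 0 * P 0 j + b 0 0 * Q 0 j) - P 0 j * (a 0 0 * P 0 i + b 0 0 * Q 0 i)); first by ring.
  by rewrite !Ec !mulr0 subrr.
by apply/rowP => k; rewrite !mxE; case: splitP => m _; rewrite (ord1 m).
Qed.

Lemma line_dvd (R : fieldType) (P Q : 'rV[R]_3) (l p : {mpoly R[3]}) n :
  row_free (col_mx P Q) -> is_line l -> l.@[P 0] = 0 -> l.@[Q 0] = 0 -> p \is n.-homog ->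
  restr idfun (P 0) (Q 0) p = 0 -> exists B, p = B * l.
Proof.
move=> PQ hl lP lQ hp p0; have [M [uM MP MQ]] := basis_of_pair PQ.
have EP i : M o0 i = P 0 i by rewrite -MP mxE.
have EQ i : M o1 i = Q 0 i by rewrite -MQ mxE.
have [|| c c0 ->] := line_dual_form uM hl; [by rewrite (meval_eq _ EP)|by rewrite (meval_eq _ EQ)|].
have [|B ->] := restr_eq0_dvd uM hp; first by rewrite -[RHS]p0; apply: eq_restr.
by exists (c^-1 *: B); rewrite -scalerAl -scalerAr scalerA mulVf // scale1r.
Qed.

Section ComponentLines.
Variables (R : fieldType) (e : 'I_3 -> R) (d : nat).
Hypotheses (d0 : (0 < d)%N) (esq : forall i, e i != 0 -> e i ^+ d * e i ^+ d = 1).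
Implicit Types (v w : 'I_3 -> R) (k : 'I_3).
Local Notation f := (four_term_form d e).
Local Notation a k := (rot1 k).
Local Notation b k := (rot2 k).

Definition comp_line k : {mpoly R[3]} := e (a k) *: 'X_(a k) + e (b k) *: 'X_(b k).

Definition has_line k : bool := (e k ^+ d == -1) && ((e o0 * e o1 * e o2) ^+ d == (-1) ^+ d).

Lemma meval_comp_line k v : (comp_line k).@[v] = fourth e v - e k * v k.
Proof. by rewrite (fourth_rot e v k) mevalD !mevalZ !mevalXU; ring. Qed.

Lemma restr_comp_line k v w : restr idfun v w (comp_line k) =
  (fourth e v - e k * v k)%:P + (fourth e w - e k * w k) *: 'X.
Proof.
rewrite rmorphD /= -!mul_mpolyC !rmorphM /= !restrC !restrX !(fourth_rot e _ k) -!mul_polyC.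
by rewrite !(polyCB, polyCD, polyCM); ring.
Qed.

Lemma prod_rot k : e o0 * e o1 * e o2 = e k * e (a k) * e (b k).
Proof. by case: (ord3P k) => ->; rewrite /rot1 /rot2 /=; ring. Qed.

Lemma has_line_neq0 k i : has_line k -> e i != 0.
Proof.
case/andP => _; rewrite (prod_rot i) => /eqP E; apply/eqP => e0; move: E.
by rewrite e0 !mul0r expr0n eqn0Ngt d0 /= => /esym/eqP; rewrite signr_eq0.
Qed.

Lemma has_line_pair k : has_line k -> e (a k) ^+ d * e (b k) ^+ d = - (-1) ^+ d.
Proof.
case/andP; rewrite (prod_rot k) !exprMn => /eqP -> /eqP <-; ring.
Qed.

Lemma comp_line_is_line k : has_line k -> is_line (comp_line k).
Proof.
move=> hk; apply/andP; split; last first.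
  by apply: rpredD; apply: dhomogZ; rewrite dhomogX /= mdeg1.
apply: contra_neq (has_line_neq0 (a k) hk) => E.
have [_ _ /negPf ab] := rot_neq k.
have := meval_comp_line k (fun i => (i == a k)%:R); rewrite E meval0 (fourth_rot e _ k).
rewrite eqxx [b k == _]eq_sym ab /= => E2; rewrite [RHS]E2; ring.
Qed.

Lemma comp_line_neq_multiple k l c : has_line k -> has_line l -> comp_line k = c *: comp_line l -> k = l.
Proof.
move=> hk hl E; apply/eqP; apply: contraT => kl.
have := meval_comp_line k (fun i => (i == k)%:R); rewrite E mevalZ meval_comp_line.
have Fk : fourth e (fun i => (i == k)%:R) = e k.
  by rewrite /fourth (bigD1 k) //= eqxx mulr1 big1 ?addr0 // => i /negPf ->; rewrite mulr0.
rewrite Fk eqxx mulr1 subrr eq_sym (negPf kl) mulr0 subr0 => /eqP.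
rewrite mulf_eq0 (negPf (has_line_neq0 k hk)) orbF => /eqP c0.
by have /andP[/eqP] := comp_line_is_line hk; rewrite E c0 scale0r.
Qed.

Definition dirac k : 'rV[R]_3 := \row_i (i == k)%:R.
(** The point of the line X_3 = e_k X_k at which X_k and X_3 both vanish; with the k-th coordinate
    point it spans that line. *)
Definition dir_line k : 'rV[R]_3 := \row_i (if i == a k then e (b k) else if i == b k then - e (a k) else 0).

Lemma fourth_dirac k : fourth e (dirac k 0) = e k.
Proof.
by rewrite /fourth (bigD1 k) //= !mxE eqxx mulr1 big1 ?addr0 // => i /negPf ik; rewrite mxE ik mulr0.
Qed.

Lemma dir_lineE k : [/\ dir_line k 0 k = 0, dir_line k 0 (a k) = e (b k) & dir_line k 0 (b k) = - e (a k)].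
Proof.
have [ka kb ab] := rot_neq k; rewrite !mxE !eqxx [k == _]eq_sym (negPf ka) [k == _]eq_sym (negPf kb).
by rewrite [b k == _]eq_sym (negPf ab).
Qed.

Lemma fourth_dir_line k : fourth e (dir_line k 0) = 0.
Proof. by rewrite (fourth_rot e _ k); have [-> -> ->] := dir_lineE k; ring. Qed.

Lemma line_basis k : e (b k) != 0 -> row_free (col_mx (dirac k) (dir_line k)).
Proof.
have [ka _ _] := rot_neq k; have [Ek Ea _] := dir_lineE k => eb.
by apply: (row_free_minor (i := k) (j := a k)); rewrite Ea Ek mulr0 subr0 mxE eqxx mul1r.
Qed.

(** On the line X_3^d = e_k^d X_k^d = -X_k^d. The other two powers cancel as well: there e_a X_a =
    -e_b X_b, and e_a^d e_b^d = -(-1)^d by [has_line_pair]. *)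
Lemma restr_on_line k : has_line k -> restr idfun (dirac k 0) (dir_line k 0) f = 0.
Proof.
move=> hk; have [ka kb ab] := rot_neq k.
rewrite restr_four_term (sum_rot _ k) fourth_dirac fourth_dir_line; have [-> -> ->] := dir_lineE k.
rewrite !mxE eqxx (negPf ka) (negPf kb) !scale0r !addr0 !add0r -!polyC_exp !exprZn expr1n.
rewrite exprNn; case/andP: (hk) => /eqP -> _; have := has_line_pair hk; have := esq (has_line_neq0 (a k) hk).
move: (e (a k) ^+ d) (e (b k) ^+ d) => x y x2 xy.
have -> : y = - (-1) ^+ d * x by rewrite -xy -[LHS]mul1r -x2; ring.
by rewrite rmorphN polyC1 mulNr scaleNr; ring.
Qed.

Hypotheses (d1 : (1 < d)%N) (dR : d%:R != 0 :> R).

(** If the form were zero, the coordinate points would force every e_k to be nonzero, and then the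
    coefficient d e_0^(d-1) e_1 of X_0^(d-1) X_1 would survive. *)
Lemma four_term_neq0 : f != 0.
Proof.
apply/eqP => f0; have ek k : e k != 0.
  apply: contra_eq_neq (meval_four_term e d (dirac k 0)) => ek.
  rewrite f0 meval0 fourth_dirac ek expr0n eqn0Ngt d0 addr0 (bigD1 k) //= big1 => [|i ik].
    by rewrite mxE eqxx expr1n addr0 eq_sym oner_eq0.
  by rewrite mxE (negPf ik) expr0n eqn0Ngt d0.
have := coef_restr_four_term e d (dirac o0 0) (dirac o1 0) 1; rewrite f0 rmorph0 coef0 bin1 !fourth_dirac.
rewrite big1 ?add0r => [/esym/eqP|i _]; last first.
  rewrite !mxE; case: (ord3P i) => -> /=; rewrite ?mulr0 // expr0n subn_eq0 leqNgt d1 mul0r //.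
by rewrite -mulr_natr !mulf_eq0 expf_eq0 !(negPf (ek _)) (negPf dR) andbF.
Qed.

(** The lines are split off one at a time. The next one divides the quotient because the lines
    already removed do not vanish at its point [dirac k]: their value there is e_k, which is
    nonzero. *)
Lemma comp_lines_dvd (s : seq 'I_3) : uniq s -> {in s, forall k, has_line k} ->
  exists g n, [/\ f = (\prod_(k <- s) comp_line k) * g, g \is n.-homog & (n + size s = d)%N].
Proof.
elim: s => [|k s IH] /=; first by exists f, d; rewrite big_nil mul1r addn0 four_term_homog.
case/andP=> ks us Hs; have hk : has_line k by apply: Hs; rewrite inE eqxx.
have [|g [n [Ef hg ns]]] := IH us; first by move=> l ls; apply: Hs; rewrite inE ls orbT.
have g0 : g != 0 by apply: contraNneq four_term_neq0 => g0; rewrite Ef g0 mulr0.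
have PQ := line_basis (has_line_neq0 (b k) hk).
have Pl : (comp_line k).@[dirac k 0] = 0 by rewrite meval_comp_line fourth_dirac mxE eqxx mulr1 subrr.
have Ql : (comp_line k).@[dir_line k 0] = 0.
  by rewrite meval_comp_line fourth_dir_line; have [-> _ _] := dir_lineE k; rewrite mulr0 subrr.
have [|B EB] := line_dvd PQ (comp_line_is_line hk) Pl Ql hg.
  have := restr_on_line hk; rewrite Ef rmorphM rmorph_prod /= => /eqP; rewrite mulf_eq0 => /orP[|/eqP //].
  rewrite prodf_seq_eq0 => /hasP[l ls /= /eqP].
  rewrite restr_comp_line fourth_dirac mxE (_ : (l == k) = false); last first.
    by apply: contraNF ks => /eqP <-.
  rewrite mulr0 subr0 => /(congr1 (fun p : {poly R} => p`_0)).
  rewrite coefD coefC coefZ coefX mulr0 addr0 coef0 => /eqP; by rewrite (negPf (has_line_neq0 k hk)).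
have BL0 : B * comp_line k != 0 by rewrite -EB.
have hBL : B * comp_line k \is n.-homog by rewrite -EB.
have [i hB /andP[ni hl]] := homog_factor BL0 hBL.
have l0 : comp_line k != 0 by case/andP: (comp_line_is_line hk).
have /andP[_ h1] := comp_line_is_line hk.
have E1 := dhomog_uniq l0 h1 hl.
exists B, i; split=> //; first by rewrite big_cons Ef EB; ring.
by rewrite -ns -(subnKC ni) -E1 -addnA add1n.
Qed.

End ComponentLines.

Lemma bin2_neq0 (R : fieldType) d : (d%:R != 0 :> R) -> (d.-1%:R != 0 :> R) -> 'C(d, 2)%:R != 0 :> R.
Proof.
move=> dR d1R; apply: contra_neq (mulf_neq0 dR d1R) => C0.
have := bin_ffact d 2; rewrite /= ffactnS ffactn1 -natrM => <-.
by rewrite natrM C0 mul0r.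
Qed.

(** * Singular points of C *)

Section LocalStudy.
Variables (R : fieldType) (e : 'I_3 -> R) (d : nat).
Hypotheses (d1 : (1 < d)%N) (esq : forall i, e i != 0 -> e i ^+ d * e i ^+ d = 1).
Hypotheses (char2 : (2%:R : R) != 0) (char3 : (3%:R : R) != 0).
Hypotheses (dR : d%:R != 0 :> R) (dR1 : d.-1%:R != 0 :> R).
Implicit Types (v w : 'I_3 -> R) (k : 'I_3).
Local Notation f := (four_term_form d e).
Local Notation a k := (rot1 k).
Local Notation b k := (rot2 k).
Local Notation x3 v := (fourth e v).

Let d0 : (0 < d)%N. Proof. exact: ltnW. Qed.

(** The second-order term at v is a binomial factor times sum v_i^(d-2) w_i^2 + X_3^(d-2) X_3(w)^2.
    If it vanished at the coordinate vectors and at the sum of the first two, polarization would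
    leave 2 e_0 e_1 X_3^(d-2) = 0. *)
Lemma four_term_mult_lt3 k v : has_line e d k -> x3 v != 0 ->
  ~ forall w, 'X^3 %| restr idfun v w f.
Proof.
move=> hk x0 H; have C2 w : \sum_i v i ^+ (d - 2) * w i ^+ 2 + x3 v ^+ (d - 2) * x3 w ^+ 2 = 0.
  have /dvdpP[r Er] := H w; have := coef_restr_four_term e d v w 2.
  rewrite Er coefMXn /= => /esym/eqP.
  by rewrite -mulr_natr mulf_eq0 (negPf (bin2_neq0 dR dR1)) orbF => /eqP.
have Ck i : v i ^+ (d - 2) + x3 v ^+ (d - 2) * e i ^+ 2 = 0.
  have := C2 (dirac R i 0); rewrite fourth_dirac (bigD1 i) //= big1 => [|j ji]; last first.
    by rewrite mxE (negPf ji) expr0n mulr0.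
  by rewrite mxE eqxx expr1n mulr1 addr0.
have := C2 (fun i => dirac R o0 0 i + dirac R o1 0 i); rewrite sum_ord3 {2}/fourth [\sum_i e i * _]sum_ord3.
rewrite !mxE /= !(addr0, add0r, expr1n, mulr1, mulr0, expr0n) => E.
have : 2%:R * e o0 * e o1 * x3 v ^+ (d - 2) = 0.
  rewrite -E -[LHS]addr0 -(Ck o0) -[LHS]addr0 -(Ck o1); ring.
move/eqP; rewrite !mulf_eq0 (negPf char2) !(negPf (has_line_neq0 d0 _ hk)) expf_eq0 (negPf x0) andbF //.
Qed.

(** The common exit of the local arguments: a point of X_3 = e_k X_k whose d-th powers cancel in the
    pairs {3, k} and {a, b} exhibits either a component line or the degenerate form in which only
    e_k is nonzero. *)
Lemma has_line_intro k v : v (a k) != 0 -> v k != 0 -> x3 v = e k * v k ->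
  x3 v ^+ d = - v k ^+ d -> v (a k) ^+ d = - v (b k) ^+ d ->
  e k ^+ d = -1 /\ (has_line e d k \/ forall i, i != k -> e i = 0).
Proof.
move=> va vk x3k x3d vab; have ek : e k ^+ d = -1.
  by apply: (mulIf (expf_neq0 d vk)); rewrite -exprMn -x3k x3d mulN1r.
split=> //; have Eab : e (a k) * v (a k) = - (e (b k) * v (b k)).
  apply/eqP; rewrite -addr_eq0; move: x3k; rewrite (fourth_rot e v k) => /eqP.
  by rewrite -addrA -subr_eq0 addrAC subrr add0r.
have vb : v (b k) != 0.
  apply: contra_neq (expf_neq0 d va) => vb; by rewrite vab vb expr0n eqn0Ngt d0 oppr0.
have [ea|ea] := eqVneq (e (a k)) 0.
  right=> i ik; have [E|->|->] // := rotP k i; first by rewrite E eqxx in ik.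
  move/esym/eqP: Eab; rewrite ea mul0r oppr_eq0 mulf_eq0 (negPf vb) orbF => /eqP //.
have eb : e (b k) != 0.
  by apply: contra_neq (mulf_neq0 ea va) => eb; rewrite Eab eb mul0r oppr0.
left; rewrite /has_line ek eqxx (prod_rot e k) !exprMn ek.
have E1 : e (a k) ^+ d * v (a k) ^+ d = (-1) ^+ d * (e (b k) ^+ d * v (b k) ^+ d).
  by rewrite -!exprMn Eab mulN1r.
have E2 : e (a k) ^+ d = - ((-1) ^+ d * e (b k) ^+ d).
  by apply: (mulIf (expf_neq0 d vb)); apply: oppr_inj; rewrite -mulrN -vab E1; ring.
rewrite E2; apply/eqP; have := esq eb; move: (e (b k) ^+ d) ((-1) ^+ d) => x y xx.
  transitivity (y * (x * x)); [ring | by rewrite xx mulr1].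
Qed.

Lemma singular_point_line q v : q = d.*2.+1 -> (forall x y : R, (x + y) ^+ q = x ^+ q + y ^+ q) ->
  (forall i, e i ^+ q = e i) ->
  (exists i, v i != 0) -> (forall i, v i ^+ d.-1 + e i * x3 v ^+ d.-1 = 0) ->
  x3 v != 0 /\ exists k, [/\ x3 v = e k * v k, e k ^+ d = -1 & has_line e d k \/ forall i, i != k -> e i = 0].
Proof.
move=> Eq frob eq [i0 vi0] S.
have S' i : v i ^+ d.-1 = - (e i * x3 v ^+ d.-1) by apply/eqP; rewrite -addr_eq0 S.
have d10 : (0 < d.-1)%N by rewrite -ltnS prednK.
have x0 : x3 v != 0.
  apply: contra_neq (expf_neq0 d.-1 vi0) => x0.
  by rewrite S' x0 expr0n eqn0Ngt d10 mulr0 oppr0.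
split=> //; pose y i := e i * v i / x3 v.
have y1 : y o0 + y o1 + y o2 = 1 by rewrite /y -!mulrDl -(sum_ord3 (fun i => e i * v i)) divff.
(* As q - 3 = 2 (d - 1), a q-th power is a cube times the square of the (d - 1)-st power that the
   gradient controls. *)
have qd : q = (3 + d.-1.*2)%N by rewrite Eq -{1}(prednK d0) doubleS addnC !addnS addn0.
(* The gradient equations turn the Frobenius map into cubing on the ratios y_i. *)
have yq i : y i ^+ q = y i ^+ 3.
  rewrite /y !exprMn eq exprVn qd 2!exprD -addnn !exprD S'; move: (x3 v ^+ d.-1) (expf_neq0 d.-1 x0) => X X0.
  by field; rewrite x0 X0.
have y3 : y o0 ^+ 3 + y o1 ^+ 3 + y o2 ^+ 3 = 1.
  by rewrite -!yq -!frob y1 expr1n.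
(* Three times this product is (y_0 + y_1 + y_2)^3 - (y_0^3 + y_1^3 + y_2^3). *)
have : (y o0 + y o1) * (y o0 + y o2) * (y o1 + y o2) = 0.
  apply: (mulfI char3); rewrite mulr0; transitivity ((y o0 + y o1 + y o2) ^+ 3 - (y o0 ^+ 3 + y o1 ^+ 3 + y o2 ^+ 3)).
    by ring.
  by rewrite y1 y3 expr1n subrr.
move=> P0; have {P0} [k Ek] : exists k, y (a k) + y (b k) = 0.
  move/eqP: P0; rewrite !mulf_eq0 -orbA => /or3P[] /eqP E; [exists o2 | exists o1 | exists o0] => //.
  by rewrite /rot1 /rot2 /= addrC.
have yk : y k = 1 by rewrite -y1 -(sum_ord3 y) (sum_rot y k) -addrA Ek addr0.
have x3k : x3 v = e k * v k by apply: (mulIf (invr_neq0 x0)); rewrite divff // -[LHS]yk.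
have vk : v k != 0 by apply: contra_neq x0 => vk; rewrite x3k vk mulr0.
have dd : d = d.-1.+1 by rewrite prednK.
have ek : e k ^+ d = -1.
  have := S k; rewrite x3k exprMn mulrA -exprS -dd -[X in X + _]mul1r -mulrDl => /eqP.
  by rewrite mulf_eq0 expf_eq0 (negPf vk) andbF orbF addrC addr_eq0 => /eqP.
have Eab : e (a k) * v (a k) = - (e (b k) * v (b k)).
  apply/eqP; rewrite -addr_eq0; apply/eqP; apply: (mulIf (invr_neq0 x0)).
  by rewrite mulrDl mul0r -Ek.
exists k; split=> //; have [ea|ea] := eqVneq (e (a k)) 0.
  right=> i ik; have [E|->|->] // := rotP k i; first by rewrite E eqxx in ik.
  move/esym/eqP: Eab; rewrite ea mul0r oppr_eq0 mulf_eq0 => /orP[/eqP //|/eqP vb].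
  have := S (b k); rewrite vb expr0n eqn0Ngt d10 add0r => /eqP.
  by rewrite mulf_eq0 expf_eq0 (negPf x0) andbF orbF => /eqP.
have va : v (a k) != 0.
  apply: contra_neq (mulf_neq0 ea (expf_neq0 d.-1 x0)) => va.
  by have := S (a k); rewrite va expr0n eqn0Ngt d10 add0r.
have x3d : x3 v ^+ d = - v k ^+ d by rewrite x3k exprMn ek mulN1r.
have vd i : v i ^+ d = - (e i * v i * x3 v ^+ d.-1).
  by rewrite {1}dd exprS S'; ring.
have [|_ //] := has_line_intro va vk x3k x3d.
by rewrite !vd Eab; ring.
Qed.

(* The hypotheses on d-th powers hold when the coordinates lie in the field with 2 d + 1 elements. *)
Lemma singular_second_line k v : has_line e d k -> v k != 0 -> x3 v = e k * v k ->
  (forall i, v i != 0 -> v i ^+ d * v i ^+ d = 1) -> (x3 v ^+ d * x3 v ^+ d = 1) ->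
  (forall i, v i ^+ d.-1 + e i * x3 v ^+ d.-1 = 0) ->
  exists2 i, i != k & has_line e d i /\ x3 v = e i * v i.
Proof.
move=> hk vk x3k sq sq3 S.
have S' i : v i ^+ d.-1 = - (e i * x3 v ^+ d.-1) by apply/eqP; rewrite -addr_eq0 S.
have d10 : (0 < d.-1)%N by rewrite -ltnS prednK.
have e0 i : e i != 0 := has_line_neq0 d0 i hk.
have x0 : x3 v != 0 by rewrite x3k mulf_neq0.
have v0 i : v i != 0.
  apply: contra_neq (mulf_neq0 (e0 i) (expf_neq0 d.-1 x0)) => vi.
  by have := S i; rewrite vi expr0n eqn0Ngt d10 add0r.
have dd : d = d.-1.+1 by rewrite prednK.
(* Since the d-th powers are signs, each e_i X_i is X_3 or -X_3, the sign being minus the product of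
   the d-th powers of X_i and X_3. The terms of indices a and b are opposite on the line, so one of
   them equals X_3, which gives the second line. *)
have ez i : e i * v i = - (v i ^+ d * x3 v ^+ d * x3 v).
  apply: (mulIf (expf_neq0 d.-1 x0)).
  have -> : e i * v i * x3 v ^+ d.-1 = - v i ^+ d by rewrite [in RHS]dd exprS S'; ring.
  have xd : x3 v ^+ d = x3 v * x3 v ^+ d.-1 by rewrite [in LHS]dd exprS.
  transitivity (- (v i ^+ d * (x3 v ^+ d * (x3 v * x3 v ^+ d.-1)))); last by ring.
  by rewrite -xd sq3 mulr1.
have Eab : e (a k) * v (a k) = - (e (b k) * v (b k)).
  apply/eqP; rewrite -addr_eq0; move: x3k; rewrite (fourth_rot e v k) => /eqP.
  by rewrite -addrA -subr_eq0 addrAC subrr add0r.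
have X0 : x3 v ^+ d != 0 := expf_neq0 d x0.
have opp i : v i ^+ d = - x3 v ^+ d -> has_line e d i /\ x3 v = e i * v i.
  move=> vi; have xi : x3 v = e i * v i by rewrite ez vi mulNr sq3; ring.
  split=> //; case/andP: hk => _ hk; apply/andP; split=> //.
  by apply/eqP; apply: (mulIf X0); rewrite mulN1r -vi [in LHS]xi exprMn mulrA esq // mul1r.
have [ka kb _] := rot_neq k.
have : (v (a k) ^+ d == x3 v ^+ d) || (v (a k) ^+ d == - x3 v ^+ d).
  by rewrite -eqf_sqr !expr2 sq3 sq.
case/orP => /eqP E; last by exists (a k) => //; apply: opp.
exists (b k) => //; apply: opp; rewrite -E; apply: oppr_inj; rewrite opprK.
apply: (mulIf (mulf_neq0 X0 x0)); move: Eab; rewrite !ez opprK => Eab.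
by rewrite !mulrA !mulNr -Eab opprK.
Qed.
End LocalStudy.

(** * The Hessian and its rational zeros on C *)

Lemma det_mx33 (R : comNzRingType) (A : 'M[R]_3) : \det A =
  A o0 o0 * (A o1 o1 * A o2 o2 - A o1 o2 * A o2 o1)
  - A o0 o1 * (A o1 o0 * A o2 o2 - A o1 o2 * A o2 o0)
  + A o0 o2 * (A o1 o0 * A o2 o1 - A o1 o1 * A o2 o0).
Proof.
pose M (i j : nat) := A (inord i) (inord j).
have -> : A = \matrix_(i < 3, j < 3) M i j by apply/matrixP => i j; rewrite mxE /M !inord_val.
rewrite (expand_det_row _ ord0) !big_ord_recl big_ord0 /cofactor !(expand_det_row _ ord0).
rewrite !big_ord_recl !big_ord0 /cofactor !det_mx11 !mxE /= /bump /=; ring.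
Qed.

Section Hessian.
Variables (R : fieldType) (e : 'I_3 -> R) (d : nat).
Implicit Types (v w : 'I_3 -> R) (k : 'I_3).
Local Notation f := (four_term_form d e).
Local Notation a k := (rot1 k).
Local Notation b k := (rot2 k).
Local Notation x3 v := (fourth e v).

(* Up to a constant factor, the Hessian of the four-term form. *)
Definition hessian : {mpoly R[3]} :=
  'X_o0 ^+ (d - 2) * 'X_o1 ^+ (d - 2) * 'X_o2 ^+ (d - 2) +
  (\sum_i e i *: 'X_i) ^+ (d - 2) * (e o0 ^+ 2 *: ('X_o1 ^+ (d - 2) * 'X_o2 ^+ (d - 2))
    + e o1 ^+ 2 *: ('X_o0 ^+ (d - 2) * 'X_o2 ^+ (d - 2))
    + e o2 ^+ 2 *: ('X_o0 ^+ (d - 2) * 'X_o1 ^+ (d - 2))).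

Lemma hessian_homog : hessian \is (d - 2 + (d - 2) + (d - 2)).-homog.
Proof.
have hX (p : {mpoly R[3]}) n : p \is 1.-homog -> p ^+ n \is n.-homog.
  by move=> hp; have := dhomogMn n hp; rewrite mul1n.
have X1 (i : 'I_3) n : ('X_i : {mpoly R[3]}) ^+ n \is n.-homog.
  by apply: hX; rewrite dhomogX /= mdeg1.
apply: rpredD; first by apply: dhomogM => //; apply: dhomogM.
rewrite -addnA; apply: dhomogM.
  by apply: hX; apply: rpred_sum => i _; apply: dhomogZ; rewrite dhomogX /= mdeg1.
by apply: rpredD; [apply: rpredD|]; apply: dhomogZ; apply: dhomogM.
Qed.

Lemma meval_hessian v k (A := fun i => v i ^+ (d - 2)) : hessian.@[v] =
  A k * A (a k) * A (b k) + x3 v ^+ (d - 2) *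
   (e k ^+ 2 * (A (a k) * A (b k)) + e (a k) ^+ 2 * (A k * A (b k)) + e (b k) ^+ 2 * (A k * A (a k))).
Proof.
have E3 : (\sum_i e i *: 'X_i).@[v] = x3 v.
  by rewrite rmorph_sum; apply: eq_bigr => i _; rewrite /= mevalZ mevalXU.
have EX n (p : {mpoly R[3]}) : (p ^+ n).@[v] = p.@[v] ^+ n by rewrite rmorphXn.
have EA i : ('X_i ^+ (d - 2)).@[v] = A i by rewrite EX mevalXU.
have EL : ((\sum_i e i *: 'X_i) ^+ (d - 2)).@[v] = x3 v ^+ (d - 2) by rewrite EX E3.
rewrite /hessian; move: (EA o0) (EA o1) (EA o2) EL; move: (_ ^+ _) ('X_o0 ^+ _) ('X_o1 ^+ _) ('X_o2 ^+ _).
move=> L X0 X1 X2 E0 E1 E2 EL; rewrite mevalD 3!mevalM 2!mevalD 3!mevalZ 3!mevalM E0 E1 E2 EL.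
by case: (ord3P k) => ->; rewrite /rot1 /rot2 /=; ring.
Qed.

(** The matrix of second derivatives of the form at v, divided by d (d - 1): a diagonal matrix plus
    a rank one matrix from the fourth term. *)
Definition polar_mx v : 'M[R]_3 :=
  \matrix_(i, j) (v i ^+ (d - 2) *+ (i == j) + x3 v ^+ (d - 2) * e i * e j).

Lemma det_polar v : \det (polar_mx v) = hessian.@[v].
Proof.
rewrite (meval_hessian v o0) det_mx33 !mxE /= /rot1 /rot2 /= !mulr1n !mulr0n; ring.
Qed.

(** The three equations say that the symmetric matrix [polar_mx] vanishes on the plane spanned by v
    and w, and an invertible matrix of size 3 has no totally isotropic plane, by rank. *)
Lemma hessian_inflection (v w : 'rV[R]_3) : row_free (col_mx v w) ->
  \sum_i v 0 i ^+ (d - 2) * v 0 i ^+ 2 + x3 (v 0) ^+ (d - 2) * x3 (v 0) ^+ 2 = 0 ->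
  \sum_i v 0 i ^+ (d - 2) * (v 0 i * w 0 i) + x3 (v 0) ^+ (d - 2) * (x3 (v 0) * x3 (w 0)) = 0 ->
  \sum_i v 0 i ^+ (d - 2) * w 0 i ^+ 2 + x3 (v 0) ^+ (d - 2) * x3 (w 0) ^+ 2 = 0 ->
  hessian.@[v 0] = 0.
Proof.
move=> vw E0 E1 E2; rewrite -det_polar; apply/eqP; set S := polar_mx (v 0).
have B (x y : 'rV[R]_3) : (x *m S *m y^T) 0 0 =
    \sum_i v 0 i ^+ (d - 2) * (x 0 i * y 0 i) + x3 (v 0) ^+ (d - 2) * (x3 (x 0) * x3 (y 0)).
  rewrite /S /polar_mx /fourth !mxE !sum_ord3 !mxE !sum_ord3 !mxE /= !mulr1n !mulr0n; ring.
have Z : col_mx v w *m S *m (col_mx v w)^T = 0.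
  have Z1 (x y : 'rV[R]_3) : (x *m S *m y^T) 0 0 = 0 -> x *m S *m y^T = 0.
    by move=> xy; rewrite [LHS]mx11_scalar xy raddf0.
  have Zvv : v *m S *m v^T = 0 by apply: Z1; rewrite B -[RHS]E0 !expr2; congr (_ + _); apply: eq_bigr => i _; rewrite !expr2.
  have Zvw : v *m S *m w^T = 0 by apply: Z1; rewrite B.
  have Zwv : w *m S *m v^T = 0.
    apply: Z1; rewrite B -[RHS]E1 [x3 (w 0) * _]mulrC; congr (_ + _).
    by apply: eq_bigr => i _; rewrite [w 0 i * _]mulrC.
  have Zww : w *m S *m w^T = 0 by apply: Z1; rewrite B -[RHS]E2 !expr2; congr (_ + _); apply: eq_bigr => i _; rewrite !expr2.
  rewrite tr_col_mx mul_col_mx mul_col_row Zvv Zvw Zwv Zww.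
  exact: block_mx0.
apply: contraT; rewrite -unitfE => uS.
have := mulmx0_rank_max Z; rewrite mxrank_tr.
rewrite mxrankMfree ?row_free_unit ?unitmxE //.
by move: vw; rewrite /row_free => /eqP ->.
Qed.

Hypotheses (d1 : (1 < d)%N) (esq : forall i, e i != 0 -> e i ^+ d * e i ^+ d = 1).
Hypotheses (char2 : (2%:R : R) != 0).

Lemma rot_comp k : [/\ rot1 (rot1 k) = rot2 k, rot2 (rot1 k) = k, rot1 (rot2 k) = k & rot2 (rot2 k) = rot1 k].
Proof. by case: (ord3P k) => ->. Qed.

Lemma balanced_signs (s0 s1 s2 s3 : R) : s0 * s0 = 1 -> s1 * s1 = 1 -> s2 * s2 = 1 -> s3 * s3 = 1 ->
  s0 + s1 + s2 + s3 = 0 ->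
  [\/ [/\ s0 = s3, s1 = - s3 & s2 = - s3], [/\ s1 = s3, s2 = - s3 & s0 = - s3]
    | [/\ s2 = s3, s0 = - s3 & s1 = - s3]].
Proof.
have n1 : (1 : R) + 1 != 0 by [].
have cs (x y : R) : x * x = 1 -> y * y = 1 -> x = y \/ x = - y.
  move=> xx yy; have : (x == y) || (x == - y) by rewrite -eqf_sqr !expr2 xx yy.
  by case/orP => /eqP; [left | right].
move=> h0 h1 h2 h3; have s30 : s3 != 0 by apply: contra_eq_neq h3 => ->; rewrite mul0r eq_sym oner_eq0.
have n2 : (1 + 1) * s3 != 0 by rewrite mulf_neq0.
have n4 : (1 + 1) * ((1 + 1) * s3) != 0 by rewrite mulf_neq0.
case: (cs _ _ h0 h3) => ->; case: (cs _ _ h1 h3) => ->; case: (cs _ _ h2 h3) => -> E;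
 first [ by constructor 1 | by constructor 2 | by constructor 3
       | by case/eqP: n4; rewrite -[RHS]E; ring | by case/eqP: n2; rewrite -[RHS]E; ring
       | by case/eqP: n2; rewrite -[RHS]oppr0 -[X in _ = - X]E; ring ].
Qed.

(** Let k be the index whose d-th power agrees with that of X_3. Multiplied by the squares of X_0,
    X_1, X_2 and X_3, the Hessian involves d-th powers, that is signs, and becomes up to sign 2 (e_k
    X_k + e_a X_a)(e_k X_k + e_b X_b). A vanishing factor puts the point on X_3 = e_b X_b or X_3 =
    e_a X_a, with opposite d-th powers, as [has_line_intro] requires. *)
Lemma hessian_rational v : (forall i, v i ^+ d * v i ^+ d = 1) -> x3 v ^+ d * x3 v ^+ d = 1 ->
  f.@[v] = 0 -> hessian.@[v] = 0 ->
  exists k, [/\ x3 v = e k * v k, e k ^+ d = -1 & has_line e d k \/ forall i, i != k -> e i = 0].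
Proof.
move=> sq sq3 fv hv; have d0 : (0 < d)%N := ltnW d1.
have v0 i : v i != 0.
  by apply: contra_eq_neq (sq i) => ->; rewrite expr0n eqn0Ngt d0 mul0r eq_sym oner_eq0.
have [k [uk ua ub]] : exists k, [/\ v k ^+ d = x3 v ^+ d, v (a k) ^+ d = - x3 v ^+ d & v (b k) ^+ d = - x3 v ^+ d].
  move: fv; rewrite meval_four_term sum_ord3.
  by case/(balanced_signs (sq _) (sq _) (sq _) sq3) => -[? ? ?]; [exists o0 | exists o1 | exists o2].
have dd : d = (d - 2).+2 by rewrite -addn2 subnK.
have sqd (x : R) : x ^+ (d - 2) * x ^+ 2 = x ^+ d by rewrite -exprD -addn2 subnK.
have P0 : (e k * v k + e (a k) * v (a k)) * (e k * v k + e (b k) * v (b k)) = 0.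
  have u0 : x3 v ^+ d != 0 by apply: contra_eq_neq sq3 => ->; rewrite mul0r eq_sym oner_eq0.
  apply: (mulfI (mulf_neq0 char2 u0)); rewrite mulr0.
  rewrite (meval_hessian v k) in hv.
  have := congr1 (fun x => x * (v k ^+ 2 * v (a k) ^+ 2 * v (b k) ^+ 2 * x3 v ^+ 2)) hv.
  rewrite mul0r => <-.
  transitivity ((v k ^+ (d - 2) * v k ^+ 2) * (v (a k) ^+ (d - 2) * v (a k) ^+ 2) *
      (v (b k) ^+ (d - 2) * v (b k) ^+ 2) * x3 v ^+ 2 +
     (x3 v ^+ (d - 2) * x3 v ^+ 2) *
     ((e k * v k) ^+ 2 * (v (a k) ^+ (d - 2) * v (a k) ^+ 2) * (v (b k) ^+ (d - 2) * v (b k) ^+ 2)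
     + (e (a k) * v (a k)) ^+ 2 * (v k ^+ (d - 2) * v k ^+ 2) * (v (b k) ^+ (d - 2) * v (b k) ^+ 2)
     + (e (b k) * v (b k)) ^+ 2 * (v k ^+ (d - 2) * v k ^+ 2) * (v (a k) ^+ (d - 2) * v (a k) ^+ 2)));
    last by ring.
  rewrite !sqd uk ua ub; move: sq3; move: (x3 v ^+ d) => u uu.
  transitivity (u * (u * u) * x3 v ^+ 2 + u * (u * u) * ((e k * v k) ^+ 2 - (e (a k) * v (a k)) ^+ 2 - (e (b k) * v (b k)) ^+ 2)); last by ring.
  by rewrite uu (fourth_rot e v k); ring.
have [aa ba ab bb] := rot_comp k.
move/eqP: P0; rewrite mulf_eq0 => /orP[] /eqP Z.
  exists (b k); have x3b : x3 v = e (b k) * v (b k) by rewrite (fourth_rot e v k) Z add0r.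
  have x3d : x3 v ^+ d = - v (b k) ^+ d by rewrite ub opprK.
  have vab : v (a (b k)) ^+ d = - v (b (b k)) ^+ d by rewrite ab bb uk ua opprK.
  by have [E1 E2] := has_line_intro d1 esq (v0 _) (v0 _) x3b x3d vab.
exists (a k); have x3a : x3 v = e (a k) * v (a k) by rewrite (fourth_rot e v k) addrAC Z add0r.
have x3d : x3 v ^+ d = - v (a k) ^+ d by rewrite ua opprK.
have vab : v (a (a k)) ^+ d = - v (b (a k)) ^+ d by rewrite aa ba ub uk.
by have [E1 E2] := has_line_intro d1 esq (v0 _) (v0 _) x3a x3d vab.
Qed.

End Hessian.

(** * The residual curve G *)

Lemma dvdX_restr (R : fieldType) n (p : {mpoly R[n]}) (v w : 'I_n -> R) :
  p.@[v] = 0 -> 'X %| restr idfun v w p.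
Proof.
move=> pv; have := dvdp_XsubCl (restr idfun v w p) 0; rewrite subr0 => ->.
by rewrite rootE horner_coef0 coef0_restr; apply/eqP.
Qed.

Lemma restr_dvdXn_le (R : fieldType) n (p : {mpoly R[n]}) (v w : 'I_n -> R) j m :
  (j < m)%N -> 'X^m %| restr idfun v w p -> (restr idfun v w p)`_j = 0.
Proof. by move=> jm /dvdpP[r ->]; rewrite coefMXn jm. Qed.

Section Residual.
Variables (R : fieldType) (e : 'I_3 -> R) (d : nat) (ks : seq 'I_3) (G : {mpoly R[3]}).
Hypotheses (d1 : (1 < d)%N) (esq : forall i, e i != 0 -> e i ^+ d * e i ^+ d = 1).
Hypotheses (char2 : (2%:R : R) != 0) (char3 : (3%:R : R) != 0).
Hypotheses (dR : d%:R != 0 :> R) (dR1 : d.-1%:R != 0 :> R).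
Local Notation f := (four_term_form d e).
Local Notation x3 v := (fourth e v).
Hypotheses (ksE : forall k, (k \in ks) = has_line e d k).
Hypothesis fE : f = (\prod_(k <- ks) comp_line e k) * G.
Implicit Types (v w : 'I_3 -> R) (k : 'I_3).

Let d0 : (0 < d)%N. Proof. exact: ltnW. Qed.

Lemma comp_line_dvd_restr k v w : has_line e d k -> x3 v = e k * v k ->
  'X %| restr idfun v w (\prod_(k <- ks) comp_line e k).
Proof.
rewrite -ksE => kks vk; rewrite (big_rem _ kks) /= rmorphM /= dvdp_mulr //.
by apply: dvdX_restr; rewrite meval_comp_line vk subrr.
Qed.

Lemma comp_line2_dvd_restr k i v w : has_line e d k -> has_line e d i -> i != k ->
  x3 v = e k * v k -> x3 v = e i * v i -> 'X^2 %| restr idfun v w (\prod_(k <- ks) comp_line e k).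
Proof.
rewrite -!ksE => kks iks ik vk vi.
have irem : i \in rem k ks by move: iks; rewrite (perm_mem (perm_to_rem kks)) inE (negPf ik).
rewrite (big_rem _ kks) (big_rem _ irem) /= !rmorphM /= mulrA dvdp_mulr // expr2.
by apply: dvdp_mul; apply: dvdX_restr; rewrite meval_comp_line; [rewrite vk subrr | rewrite vi subrr].
Qed.

Lemma singular_eqs v : (forall w, (restr idfun v w f)`_1 = 0) ->
  forall i, v i ^+ d.-1 + e i * x3 v ^+ d.-1 = 0.
Proof.
move=> S i; have := S (dirac R i 0); rewrite coef_restr_four_term bin1 fourth_dirac expr1 -mulr_natr.
move/eqP; rewrite mulf_eq0 (negPf dR) orbF (bigD1 i) //= mxE eqxx expr1 mulr1 subn1.
rewrite big1 => [|j ji]; last by rewrite mxE (negPf ji) expr1 mulr0.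
by move: (v i ^+ d.-1) (x3 v ^+ d.-1) => x y /eqP <-; ring.
Qed.

Lemma singular_fourth_neq0 v : (exists i, v i != 0) ->
  (forall i, v i ^+ d.-1 + e i * x3 v ^+ d.-1 = 0) -> x3 v != 0.
Proof.
move=> [i0 vi0] S; have d10 : (0 < d.-1)%N by rewrite -ltnS prednK.
apply: contra_neq (expf_neq0 d.-1 vi0) => x0.
by have := S i0; rewrite x0 expr0n eqn0Ngt d10 mulr0 addr0.
Qed.

Lemma residual_two_lines k i v : has_line e d k -> has_line e d i -> i != k ->
  x3 v = e k * v k -> x3 v = e i * v i -> x3 v != 0 -> G.@[v] != 0.
Proof.
move=> hk hi ik vk vi x0; apply/eqP => Gv.
apply: (four_term_mult_lt3 d1 char2 dR dR1 hk x0) => w.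
rewrite fE rmorphM exprSr; apply: dvdp_mul; first exact: (comp_line2_dvd_restr w hk hi ik vk vi).
exact: dvdX_restr.
Qed.

Lemma residual_sing_on_f v : G.@[v] = 0 -> (forall w, 'X^2 %| restr idfun v w G) \/
   (exists2 k, has_line e d k & x3 v = e k * v k) -> forall w, (restr idfun v w f)`_1 = 0.
Proof.
move=> Gv H w; apply: (@restr_dvdXn_le _ _ _ _ _ 1 2) => //; rewrite fE rmorphM.
case: H => [H|[k hk vk]]; first exact: dvdp_mull (H w).
by rewrite expr2; apply: dvdp_mul; [exact: (comp_line_dvd_restr w hk vk) | exact: dvdX_restr].
Qed.

Lemma residual_nonsingular q v : q = d.*2.+1 -> (forall x y : R, (x + y) ^+ q = x ^+ q + y ^+ q) ->
  (forall i, e i ^+ q = e i) -> ~ (exists k, e k ^+ d = -1 /\ forall i, i != k -> e i = 0) ->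
  (exists i, v i != 0) -> G.@[v] = 0 -> exists i, G^`M(i).@[v] != 0.
Proof.
move=> Eq frob eq nu v0 Gv.
have [/existsP //|/existsPn H] := boolP [exists i, G^`M(i).@[v] != 0].
have H' w : 'X^2 %| restr idfun v w G.
  rewrite -[restr _ _ _ _](poly_take_drop 2) (_ : take_poly 2 _ = 0) ?add0r ?dvdp_mulIr //.
  apply/polyP => -[|[|j]]; rewrite coef_take_poly coef0 //=; first by rewrite coef0_restr.
  by rewrite coef1_restr big1 // => i _; have := H i; rewrite negbK => /eqP E; rewrite -/(meval v _) E mulr0.
have S := singular_eqs (residual_sing_on_f Gv (or_introl H')).
have [x0 [k [vk ek hk]]] := singular_point_line d1 esq char3 Eq frob eq v0 S.
case: hk => [hk|hk]; last by case: nu; exists k.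
case: (four_term_mult_lt3 d1 char2 dR dR1 hk x0) => w.
rewrite fE rmorphM exprS; apply: dvdp_mul; last exact: H'.
exact: (comp_line_dvd_restr w hk vk).
Qed.

(** A point common to G and a component line is singular on C. Its d-th powers being signs,
    [singular_second_line] puts it on a second component line, and G together with two lines exceeds
    the bound on the multiplicity. *)
Lemma residual_rational_off_lines k v : (exists i, v i != 0) -> G.@[v] = 0 -> has_line e d k ->
  (forall i, v i != 0 -> v i ^+ d * v i ^+ d = 1) -> (x3 v != 0 -> x3 v ^+ d * x3 v ^+ d = 1) ->
  x3 v != e k * v k.
Proof.
move=> v0 Gv hk sq sq3; apply/eqP => vk.
have S := singular_eqs (residual_sing_on_f Gv (or_intror (ex_intro2 _ _ k hk vk))).
have x0 := singular_fourth_neq0 v0 S.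
have vk0 : v k != 0 by apply: contra_neq x0 => E; rewrite vk E mulr0.
have [i ik [hi vi]] := singular_second_line d1 esq hk vk0 vk sq (sq3 x0) S.
by have := residual_two_lines hk hi ik vk vi x0; rewrite Gv eqxx.
Qed.

End Residual.

(** * Tangent lines and inflections *)

Section Tangent.
Variables (R : fieldType).
Implicit Types (G : {mpoly R[3]}) (P : PG2 R).

Lemma meval_tangent_line G P (v : 'I_3 -> R) :
  (tangent_line G P).@[v] = \sum_i v i * G^`M(i).@[val P 0].
Proof. by rewrite rmorph_sum; apply: eq_bigr => i _; rewrite /= mevalZ mevalXU mulrC. Qed.

Lemma coef1_restr_tangent G P (v : 'I_3 -> R) :
  (restr idfun (val P 0) v G)`_1 = (tangent_line G P).@[v].
Proof. by rewrite coef1_restr meval_tangent_line. Qed.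

Lemma tangent_is_line G P : (exists i, eval_pt G^`M(i) P != 0) -> is_line (tangent_line G P).
Proof.
case=> i Gi; apply/andP; split; last first.
  by apply: rpred_sum => j _; apply: dhomogZ; rewrite dhomogX /= mdeg1.
apply: contra_neq Gi => E; have := meval_tangent_line G P (dirac R i 0).
rewrite E meval0 (bigD1 i) //= mxE eqxx mul1r big1 ?addr0 // => j ji.
by rewrite mxE (negPf ji) mul0r.
Qed.

(** Euler's relation, read off the restriction in the direction of P itself, which is (1 + t)^n
    G(P). *)
Lemma tangent_through G n P : G \is n.-homog -> eval_pt G P = 0 ->
  (tangent_line G P).@[val P 0] = 0.
Proof.
move=> hG GP; rewrite -coef1_restr_tangent.
have -> : restr idfun (val P 0) (val P 0) G = (1 + 'X) ^+ n * (G.@[val P 0])%:P.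
  rewrite -[in RHS]/(polyC _) /meval rmorph_mmap -(mmap_homog _ _ _ hG).
  apply: eq_mmap => // i /=; rewrite -mul_polyC; ring.
by rewrite -/(eval_pt G P) GP mulr0 coef0.
Qed.

Lemma line_second_point (l : {mpoly R[3]}) (v : 'rV[R]_3) : is_line l -> v != 0 -> l.@[v 0] = 0 ->
  exists2 w : 'rV[R]_3, row_free (col_mx v w) & l.@[w 0] = 0.
Proof.
move=> /andP[_ hl] v0 lv; pose c : 'cV[R]_3 := \col_i l@_U_(i).
have lE (w : 'rV[R]_3) : l.@[w 0] = (w *m c) 0 0.
  rewrite mxE.
  have -> : l = \sum_i l@_U_(i) *: 'X_i.
    apply/mpolyP => m; rewrite raddf_sum /=; have [|m1] := eqVneq (mdeg m) 1%N.
      move/eqP; rewrite mdeg_eq1 => /existsP[i /eqP ->].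
      rewrite (bigD1 i) //= mcoeffZ mcoeffX eqxx mulr1 big1 ?addr0 // => j ji.
      by rewrite mcoeffZ mcoeffX eq_mnm1 (negPf ji) mulr0.
    rewrite (dhomog_nemf_coeff hl m1) big1 // => i _; rewrite mcoeffZ mcoeffX.
    by case: eqP => [E|]; rewrite ?mulr0 //; case/eqP: m1; rewrite -E mdeg1.
  by rewrite rmorph_sum; apply: eq_bigr => i _; rewrite /= mevalZ mevalXU mulrC mxE.
have rk : (1 < \rank (kermx c))%N.
  by have := rank_leq_col c; rewrite mxrank_ker; case: (\rank c) => [|[|]].
have [i vi] := row_free_extend_in (row_free_nz v0) rk.
by exists (row i (kermx c)); rewrite // lE -row_mul mulmx_ker !mxE.
Qed.

Lemma inflection_dvd G n P : G \is n.-homog -> (exists i, eval_pt G^`M(i) P != 0) ->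
  inflection_point G P -> exists2 w : 'rV[R]_3, row_free (col_mx (val P) w) &
    'X^3 %| restr idfun (val P 0) (w 0) G.
Proof.
move=> hG nsP [GP I3]; have hl := tangent_is_line nsP.
have lP := tangent_through hG GP.
have [w Pw lw] := line_second_point hl (normalized_neq0 P) lP.
by exists w => //; apply: (intersection_mult_ge_dvd Pw hG hl lP lw I3).
Qed.

(** As G divides the form, its inflectional tangent meets C with multiplicity at least 3 too.
    Divided by 1, d and d (d - 1) / 2, the three lowest coefficients say that the polar quadratic
    form vanishes on that tangent. *)
Lemma inflection_hessian (e : 'I_3 -> R) d (L G : {mpoly R[3]}) n P : (1 < d)%N ->
  d%:R != 0 :> R -> d.-1%:R != 0 :> R -> four_term_form d e = L * G ->
  G \is n.-homog -> (exists i, eval_pt G^`M(i) P != 0) ->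
  inflection_point G P -> (hessian e d).@[val P 0] = 0.
Proof.
move=> d1 dR dR1 fE hG nsP IP; have [w Pw X3] := inflection_dvd hG nsP IP.
have {}X3 : 'X^3 %| restr idfun (val P 0) (w 0) (four_term_form d e).
  by rewrite fE rmorphM; apply: dvdp_mull.
have dd j : (j <= 2)%N -> (d - j = (d - 2) + (2 - j))%N.
  by move=> j2; rewrite addnBA // subnK.
have C j : (j < 3)%N -> 'C(d, j)%:R != 0 :> R ->
  \sum_i val P 0 i ^+ (d - j) * w 0 i ^+ j + fourth e (val P 0) ^+ (d - j) * fourth e (w 0) ^+ j = 0.
  move=> j3 Cj; have := restr_dvdXn_le j3 X3; rewrite coef_restr_four_term -mulr_natr => /eqP.
  by rewrite mulf_eq0 (negPf Cj) orbF => /eqP.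
apply: (hessian_inflection Pw).
- rewrite -[RHS](C 0) ?bin0 ?oner_eq0 // (dd 0) //; congr (_ + _); last by rewrite exprD expr0 mulr1.
  by apply: eq_bigr => i _; rewrite exprD expr0 mulr1.
- rewrite -[RHS](C 1) ?bin1 // (dd 1) //; congr (_ + _); last by rewrite exprD !expr1 mulrA.
  by apply: eq_bigr => i _; rewrite exprD !expr1 mulrA.
by rewrite -[RHS](C 2) ?bin2_neq0.
Qed.

End Tangent.

(** * A rational line that avoids the inflections of G *)

Definition rotv (R : fieldType) (k : 'I_3) (x y z : R) : 'rV[R]_3 :=
  \row_i if i == k then x else if i == rot1 k then y else z.

Lemma rotvE (R : fieldType) k (x y z : R) :
  [/\ rotv k x y z 0 k = x, rotv k x y z 0 (rot1 k) = y & rotv k x y z 0 (rot2 k) = z].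
Proof.
have [ka kb ab] := rot_neq k; rewrite !mxE !eqxx (negPf ka) (negPf kb).
by rewrite [rot2 k == _]eq_sym (negPf ab).
Qed.

Lemma fourth_rotv (R : fieldType) e k (x y z : R) :
  fourth e (rotv k x y z 0) = e k * x + e (rot1 k) * y + e (rot2 k) * z.
Proof. by rewrite (fourth_rot e _ k); have [-> -> ->] := rotvE k x y z. Qed.

Lemma affine_scale (R : comNzRingType) (l x y : R) :
  (l * x)%:P + (l * y) *: 'X = l%:P * (x%:P + y *: 'X).
Proof. by rewrite -scalerA polyCM -mul_polyC -mulrDr. Qed.

Section SpecialLine.
Variables (F : finFieldType) (d : nat) (e : 'I_3 -> F).
Hypotheses (cardF : #|F| = d.*2.+1) (d1 : (1 < d)%N).
Hypotheses (char2 : (2%:R : F) != 0) (char3 : (3%:R : F) != 0).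
Local Notation f := (four_term_form d e).
Local Notation x3 v := (fourth e v).
Local Notation a k := (rot1 k).
Local Notation b k := (rot2 k).

Let d0 : (0 < d)%N. Proof. exact: ltnW. Qed.

Lemma combE (A B : 'rV[F]_3) z i : (A + z *: B) 0 i = A 0 i + z * B 0 i.
Proof. by rewrite !mxE. Qed.

Lemma fourth_comb (A B : 'rV[F]_3) z : x3 ((A + z *: B) 0) = x3 (A 0) + z * x3 (B 0).
Proof.
rewrite /fourth mulr_sumr -big_split; apply: eq_bigr => i _ /=.
by rewrite combE; ring.
Qed.

Lemma rootN1_neq0 (z : F) : z ^+ d = -1 -> z != 0.
Proof. by apply: contra_eq_neq => ->; rewrite expr0n eqn0Ngt d0 eq_sym oppr_eq0 oner_eq0. Qed.

(** A nonzero affine function x l + y has at most one zero, while g and 4 g are two distinct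
    nonsquares because 3 is invertible. *)
Lemma nonsquare_avoid (x y : F) : (x != 0) || (y != 0) -> exists2 l, l ^+ d = -1 & x * l + y != 0.
Proof.
move=> xy; have [g Hg] := exists_nonsquare cardF d0 char2.
have gd : g ^+ d = -1 by rewrite (qcharE cardF d0) Hg rmorphN rmorph1.
have g0 : g != 0 := rootN1_neq0 gd.
have [E|nE] := eqVneq (x * g + y) 0; last by exists g.
have x0 : x != 0.
  by apply: contraTneq xy => x0; move: E; rewrite x0 mul0r add0r => ->; rewrite eqxx.
exists (2%:R * 2%:R * g); first by rewrite !exprMn -expr2 -exprM muln2 (expf_2d cardF) // mul1r.
have -> : x * (2%:R * 2%:R * g) + y = 3%:R * (x * g) + (x * g + y) by ring.
by rewrite E addr0 !mulf_neq0.
Qed.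

(* A line cut out on the curve in the d points with X_i = z X_j, where z^d = -1, none of which is
   an inflection point outside the linear components. *)
Lemma special_line : ~ (exists k, e k ^+ d = -1 /\ forall i, i != k -> e i = 0) ->
  (exists i, e i != 0) ->
  exists O1 O2 : 'rV[F]_3, [/\ row_free (col_mx O1 O2), restr idfun (O2 0) (O1 0) f = 'X^d + 1 &
    forall z, z ^+ d = -1 -> let v := (O2 + z *: O1) 0 in
      (exists i, v i != 0) /\
      (((forall i, v i != 0) /\ x3 v != 0) \/ exists2 k, has_line e d k & x3 v = e k * v k)].
Proof.
move=> nu e0; case: (boolP [forall k, e k ^+ d == -1]) => [/forallP H|].
  have ed k : e k ^+ d = -1 by apply/eqP.
  have en k : e k != 0.
    exact: rootN1_neq0.
  (* The line is X_2 = l X_3 with l a nonsquare, parametrized by X_0 = t, X_1 = 1: the d-th powers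
     of X_2 and X_3 cancel and t^d + 1 is left. Solving for X_3 introduces the denominator D = 1 -
     e_2 l. *)
  have [|l ld l0] := @nonsquare_avoid (- e o2) 1; first by rewrite oner_eq0 orbT.
  pose D := - e o2 * l + 1; have DD : D != 0 by [].
  exists (rotv o2 (l * (e o0 / D)) 1 0), (rotv o2 (l * (e o1 / D)) 0 1).
  have [E12 E10 E11] := rotvE o2 (l * (e o0 / D)) 1 0.
  have [E22 E20 E21] := rotvE o2 (l * (e o1 / D)) 0 1.
  have F1 : x3 (rotv o2 (l * (e o0 / D)) 1 0 0) = e o0 / D.
    by rewrite fourth_rotv /rot1 /rot2 /= /D; field.
  have F2 : x3 (rotv o2 (l * (e o1 / D)) 0 1 0) = e o1 / D.
    by rewrite fourth_rotv /rot1 /rot2 /= /D; field.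
  split.
  - by apply: (row_free_minor (i := a o2) (j := b o2)); rewrite E10 E11 E20 E21 !mulr1 mul0r subr0 oner_eq0.
  - rewrite restr_four_term (sum_rot _ o2) F1 F2 E12 E10 E11 E22 E20 E21 !scale0r !addr0 add0r scale1r.
    have -> : (l * (e o1 / D))%:P + (l * (e o0 / D)) *: 'X = l%:P * ((e o1 / D)%:P + (e o0 / D) *: 'X).
      exact: affine_scale.
    by rewrite exprMn -!polyC_exp ld ?expr1n polyCN polyC1; ring.
  move=> z zd v; have z0 := rootN1_neq0 zd.
  have v0 : v o0 = z by rewrite /v combE E10 E20 add0r mulr1.
  have v1 : v o1 = 1 by rewrite /v combE E11 E21 mulr0 addr0.
  have x3v : x3 v = (e o0 * z + e o1) / D by rewrite /v fourth_comb F1 F2; ring.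
  have v2 : v o2 = l * x3 v by rewrite x3v /v combE E12 E22; ring.
  have l1 := rootN1_neq0 ld; split; first by exists o0; rewrite v0.
  have [x30|x30] := eqVneq (x3 v) 0.
    right; exists o2; last by rewrite v2 x30 !mulr0.
    have Ez : e o0 * z = - e o1.
      by move: x30; rewrite x3v => /eqP; rewrite mulf_eq0 invr_eq0 (negPf DD) orbF addr_eq0 => /eqP.
    have L1 : (e o0 * z) ^+ d = 1 by rewrite exprMn ed zd mulrNN mulr1.
    have L2 : (- e o1) ^+ d = - (-1) ^+ d by rewrite -[- e o1]mulN1r exprMn ed mulrN1.
    have m1 : (-1) ^+ d = -1 :> F by rewrite -[LHS]opprK -L2 -Ez L1.
    by rewrite /has_line ed eqxx !exprMn !ed m1 /=; apply/eqP; ring.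
  left; split=> // i; case: (ord3P i) => ->; rewrite ?v0 ?v1 ?oner_eq0 //.
  by rewrite v2 mulf_neq0.
rewrite negb_forall => /existsP[k0 ek0].
have [k ek eab] : exists2 k, e k ^+ d != -1 & (e (a k) != 0) || (e (b k) != 0).
  have [/eqP Ea|na] := boolP (e (a k0) == 0); last by exists k0; rewrite ?na.
  have [/eqP Eb|nb] := boolP (e (b k0) == 0); last by exists k0; rewrite ?nb ?orbT.
  have [aa ba _ _] := rot_comp k0.
  exists (a k0); first by rewrite Ea expr0n eqn0Ngt d0 eq_sym oppr_eq0 oner_eq0.
  case: e0 => i ei; rewrite aa ba; have [Ei|Ei|Ei] := rotP k0 i; rewrite Ei ?Ea ?Eb ?eqxx // in ei.
  by rewrite ei orbT.
(* Here the line is X_a = l X_b, parametrized by X_k = t, X_3 = 1. The choice of k with e_k^d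
   different from -1 keeps X_b = (1 - e_k t) / D from vanishing when t^d = -1. *)
have [l ld l0] := nonsquare_avoid eab; set D := _ + _ in l0.
exists (rotv k 1 (l * (- e k / D)) (- e k / D)), (rotv k 0 (l / D) (1 / D)).
have [E1k E1a E1b] := rotvE k 1 (l * (- e k / D)) (- e k / D).
have [E2k E2a E2b] := rotvE k 0 (l / D) (1 / D).
have F1 : x3 (rotv k 1 (l * (- e k / D)) (- e k / D) 0) = 0 by rewrite fourth_rotv /D; field.
have F2 : x3 (rotv k 0 (l / D) (1 / D) 0) = 1 by rewrite fourth_rotv /D; field.
have l1 := rootN1_neq0 ld.
split.
- apply: (row_free_minor (i := k) (j := b k)).
  by rewrite E1k E1b E2k E2b mulr0 subr0 mul1r mulf_neq0 ?invr_eq0 ?oner_eq0.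
- rewrite restr_four_term (sum_rot _ k) F1 F2 E1k E1a E1b E2k E2a E2b !scale0r !addr0 add0r scale1r.
  have -> : (l / D)%:P + (l * (- e k / D)) *: 'X = l%:P * ((1 / D)%:P + (- e k / D) *: 'X).
    by rewrite -affine_scale mul1r.
  by rewrite exprMn -!polyC_exp ld ?expr1n polyCN polyC1; ring.
move=> z zd v; have z0 := rootN1_neq0 zd.
have x3v : x3 v = 1 by rewrite /v fourth_comb F1 F2 mulr0 addr0.
have vk : v k = z by rewrite /v combE E1k E2k add0r mulr1.
have vb : v (b k) = (1 - e k * z) / D by rewrite /v combE E1b E2b; ring.
have va : v (a k) = l * v (b k) by rewrite vb /v combE E1a E2a; ring.
have vb0 : v (b k) != 0.
  rewrite vb mulf_neq0 ?invr_eq0 //; apply: contra_neq ek => /eqP; rewrite subr_eq0 => /eqP E.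
  by have := congr1 (fun x => x ^+ d) E; rewrite expr1n exprMn zd mulrN1 => ->; rewrite opprK.
split; [by exists k; rewrite vk | left]; split=> [i|]; last by rewrite x3v oner_eq0.
by have [->|->|->] := rotP k i; rewrite ?vk // va mulf_neq0.
Qed.

End SpecialLine.

(** * Passage to the closed field: nonsingularity and classicality *)

Section BaseChange.
Variables (F K : fieldType) (iota : {rmorphism F -> K}) (e : 'I_3 -> F) (d : nat).
Local Notation eK := (fun i => iota (e i)).

Lemma meval_map_mpoly n (p : {mpoly F[n]}) (v : 'I_n -> F) :
  (map_mpoly iota p).@[fun i => iota (v i)] = iota p.@[v].
Proof. by rewrite /meval mmap_map rmorph_mmap; apply: eq_mmap. Qed.

Lemma restr_map_mpoly n (p : {mpoly F[n]}) (v w : 'I_n -> F) :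
  restr idfun (fun i => iota (v i)) (fun i => iota (w i)) (map_mpoly iota p) =
  map_poly iota (restr idfun v w p).
Proof. by rewrite map_restr /restr mmap_map; apply: eq_mmap. Qed.

Lemma map_four_term : map_mpoly iota (four_term_form d e) = four_term_form d eK.
Proof.
rewrite rmorphD rmorphXn !rmorph_sum /=; congr (_ + _ ^+ d).
  by apply: eq_bigr => i _; rewrite rmorphXn /= map_mpolyX.
by apply: eq_bigr => i _; rewrite map_mpolyZ map_mpolyX.
Qed.

Lemma map_comp_line k : map_mpoly iota (comp_line e k) = comp_line eK k.
Proof. by rewrite rmorphD /= !map_mpolyZ !map_mpolyX. Qed.

Lemma has_line_map k : has_line eK d k = has_line e d k.
Proof.
rewrite /has_line -!rmorphM -!rmorphXn -(rmorph1 iota) -rmorphN -rmorphXn.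
by rewrite !(inj_eq (fmorph_inj iota)).
Qed.

Lemma fourth_map (v : 'I_3 -> F) : fourth eK (fun i => iota (v i)) = iota (fourth e v).
Proof. by rewrite rmorph_sum; apply: eq_bigr => i _; rewrite rmorphM. Qed.

Lemma meval_hessian_map (v : 'I_3 -> F) :
  (hessian eK d).@[fun i => iota (v i)] = iota (hessian e d).@[v].
Proof.
rewrite !(meval_hessian _ _ _ o0) fourth_map.
by rewrite !(rmorphD, rmorphM, rmorphXn).
Qed.

End BaseChange.

Section Rational.
Variables (F : finFieldType) (d : nat) (e : 'I_3 -> F) (ks : seq 'I_3) (G : {mpoly F[3]}).
Hypotheses (cardF : #|F| = d.*2.+1) (d1 : (1 < d)%N).
Hypothesis char2 : (2%:R : F) != 0.
Hypotheses (dR : d%:R != 0 :> F) (dR1 : d.-1%:R != 0 :> F).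
Hypotheses (nu : ~ (exists k, e k ^+ d = -1 /\ forall i, i != k -> e i = 0)).
Hypotheses (ksE : forall k, (k \in ks) = has_line e d k).
Hypothesis fE : four_term_form d e = (\prod_(k <- ks) comp_line e k) * G.
Local Notation x3 v := (fourth e v).

Lemma sqr_pow_d (x : F) : x != 0 -> x ^+ d * x ^+ d = 1.
Proof. by move=> x0; rewrite -exprD addnn (expf_2d cardF). Qed.

Lemma rational_off_lines k (v : 'I_3 -> F) : (exists i, v i != 0) -> G.@[v] = 0 -> has_line e d k ->
  x3 v != e k * v k.
Proof.
move=> v0 Gv hk.
by apply: (residual_rational_off_lines d1 _ char2 dR dR1 ksE fE v0 Gv hk) => // *; apply: sqr_pow_d.
Qed.

Lemma rational_hessian_neq0 (v : 'I_3 -> F) : (forall i, v i != 0) -> x3 v != 0 -> G.@[v] = 0 ->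
  (hessian e d).@[v] != 0.
Proof.
move=> v0 v3 Gv; apply/eqP => hv.
have fv : (four_term_form d e).@[v] = 0 by rewrite fE mevalM Gv mulr0.
have [k [vk ek hk]] := hessian_rational d1 (fun i => @sqr_pow_d (e i)) char2
  (fun i => sqr_pow_d (v0 i)) (sqr_pow_d v3) fv hv.
case: hk => hk; last by case: nu; exists k.
by have := rational_off_lines (ex_intro _ o0 (v0 o0)) Gv hk; rewrite vk eqxx.
Qed.
End Rational.

Lemma finField_roots (F : finFieldType) (K : fieldType) (iota : {rmorphism F -> K}) (z : K) :
  z ^+ #|F| = z -> exists x, z = iota x.
Proof.
move=> zq; have : root (map_poly iota ('X^#|F| - 'X)) z.
  by rewrite rmorphB /= map_polyXn map_polyX rootE !hornerE zq subrr.
rewrite finField_genPoly rmorph_prod /=.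
under eq_bigr do rewrite rmorphB /= map_polyX map_polyC.
rewrite -(big_map iota predT (fun y => 'X - y%:P)) root_prod_XsubC => /mapP[x _ ->].
by exists x.
Qed.

Section OverClosedField.
Variables (F : finFieldType) (K : closedFieldType) (iota : {rmorphism F -> K}).
Variables (d : nat) (e : 'I_3 -> F) (ks : seq 'I_3) (G : {mpoly F[3]}) (n : nat).
Hypotheses (cardF : #|F| = d.*2.+1) (d1 : (1 < d)%N).
Hypotheses (char2 : (2%:R : F) != 0) (char3 : (3%:R : F) != 0).
Hypotheses (dR : d%:R != 0 :> F) (dR1 : d.-1%:R != 0 :> F).
Hypotheses (frob : forall x y : K, (x + y) ^+ d.*2.+1 = x ^+ d.*2.+1 + y ^+ d.*2.+1).
Hypotheses (nu : ~ (exists k, e k ^+ d = -1 /\ forall i, i != k -> e i = 0)).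
Hypotheses (ksE : forall k, (k \in ks) = has_line e d k).
Hypothesis fE : four_term_form d e = (\prod_(k <- ks) comp_line e k) * G.
Hypotheses (hG : G \is n.-homog) (n0 : (0 < n)%N).
Local Notation eK := (fun i => iota (e i)).
Local Notation GK := (map_mpoly iota G).

Let d0 : (0 < d)%N. Proof. exact: ltnW. Qed.

Let natK m : m%:R != 0 :> F -> m%:R != 0 :> K.
Proof. by rewrite -(rmorph_nat iota) fmorph_eq0. Qed.

Lemma map_factorization : four_term_form d eK = (\prod_(k <- ks) comp_line eK k) * GK.
Proof.
rewrite -map_four_term fE rmorphM rmorph_prod /=; congr (_ * _).
by apply: eq_bigr => k _; rewrite map_comp_line.
Qed.

Lemma map_homog j (p : {mpoly F[3]}) : p \is j.-homog -> map_mpoly iota p \is j.-homog.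
Proof.
move/dhomogP => hp; apply/dhomogP => m mp; apply: hp; move: mp.
by rewrite (perm_mem (msupp_map_mpoly _ (fmorph_inj iota))).
Qed.

Let ksEK k : (k \in ks) = has_line eK d k. Proof. by rewrite has_line_map. Qed.

Let esqK i : eK i != 0 -> eK i ^+ d * eK i ^+ d = 1.
Proof. by rewrite fmorph_eq0 -rmorphXn -rmorphM => /(sqr_pow_d cardF) ->; rewrite rmorph1. Qed.

Lemma residual_nonsingular_closed : nonsingular GK.
Proof.
move=> P GP; apply: (residual_nonsingular d1 esqK (natK char2) (natK char3) (natK dR) (natK dR1) ksEK
  map_factorization (erefl _) frob) => //.
- by move=> i; rewrite -rmorphXn -cardF expf_card.
- case=> k [ek Hk]; case: nu; exists k; split=> [|i ik].
    by apply: (fmorph_inj iota); rewrite rmorphXn rmorphN rmorph1.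
  by apply/eqP; rewrite -(fmorph_eq0 iota) Hk.
exact: point_coord_neq0.
Qed.

Lemma inflection_on_hessian (P : PG2 K) : inflection_point GK P -> (hessian eK d).@[val P 0] = 0.
Proof.
move=> IP; apply: (inflection_hessian d1 (natK dR) (natK dR1) map_factorization (map_homog hG) _ IP).
by apply: residual_nonsingular_closed; case: IP.
Qed.

Lemma finite_inflections (O1 O2 : 'rV[K]_3) : row_free (col_mx O1 O2) -> GK.@[O1 0] != 0 ->
  (forall s t, (s != 0) || (t != 0) -> GK.@[(s *: O1 + t *: O2) 0] = 0 ->
     (hessian eK d).@[(s *: O1 + t *: O2) 0] != 0) ->
  classical_curve GK.
Proof.
move=> fO GO HO; have [vs Hvs] := finite_common_zeros (map_homog hG) (hessian_homog eK d) n0 fO GO HO.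
have [s Hs] := points_of_vectors vs; exists s => P IP; apply: Hs; apply: Hvs.
- exact: normalized_neq0.
- by case: IP.
exact: inflection_on_hessian.
Qed.

Lemma residual_classical : classical_curve GK.
Proof.
have [/existsP e0|/existsPn e0] := boolP [exists i, e i != 0].
  have [O1 [O2 [fO fr Hz]]] := special_line cardF d1 char2 char3 nu e0.
  have fO1 : (four_term_form d e).@[O1 0] = 1.
    have [_ E] := restr_homog idfun (O2 0) (O1 0) (four_term_homog e d).
    by rewrite -[LHS]E fr coefD coefXn eqxx coef1 eqn0Ngt d0 addr0.
  have GO1 : G.@[O1 0] != 0.
    apply: contra_eq_neq fO1 => GO1; by rewrite fE mevalM GO1 mulr0 eq_sym oner_eq0.
  pose MO (O : 'rV[F]_3) : 'rV[K]_3 := map_mx iota O.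
  have MOE O p : (map_mpoly iota p).@[MO O 0] = iota p.@[O 0].
    by rewrite -meval_map_mpoly; apply: meval_eq => i; rewrite mxE.
  have GKO1 : GK.@[MO O1 0] != 0 by rewrite MOE fmorph_eq0.
  apply: (@finite_inflections (MO O1) (MO O2)) => //.
    by rewrite -map_col_mx row_free_map.
  move=> s t st.
  have [t0|t0] := eqVneq t 0.
    have s0 : s != 0 by rewrite t0 eqxx orbF in st.
    rewrite t0 scale0r addr0 => E; case/eqP: GKO1; apply: (mulfI (expf_neq0 n s0)).
    rewrite mulr0 -(meval_homog _ _ (map_homog hG)) -[RHS]E; apply: meval_eq => i; by rewrite !mxE.
  pose z := s / t.
  have vE C j : C \is j.-homog -> C.@[(s *: MO O1 + t *: MO O2) 0] = t ^+ j * C.@[(MO O2 + z *: MO O1) 0].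
    move=> hC; rewrite -(meval_homog _ _ hC); apply: meval_eq => i; rewrite !mxE /z; by field.
  rewrite (vE _ _ (map_homog hG)) => /eqP; rewrite mulf_eq0 expf_eq0 (negPf t0) andbF /= => /eqP Gz.
  have zd : z ^+ d = -1.
    have : (four_term_form d eK).@[(MO O2 + z *: MO O1) 0] = 0 by rewrite map_factorization mevalM Gz mulr0.
    rewrite -map_four_term.
    have -> : (map_mpoly iota (four_term_form d e)).@[(MO O2 + z *: MO O1) 0] = (map_poly iota (restr idfun (O2 0) (O1 0) (four_term_form d e))).[z].
      rewrite -restr_map_mpoly restr_horner; apply: meval_eq => i; rewrite !mxE; ring.
    rewrite fr rmorphD /= map_polyXn rmorph1 !hornerE => /eqP; rewrite addr_eq0 => /eqP //.
  (* As z^d = -1 gives z^q = z, the points of the line on G come from F, where the Hessian is known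
     not to vanish on G. *)
  have [x zx] : exists x, z = iota x.
    by apply: finField_roots; rewrite cardF exprS -muln2 exprM zd sqrrN expr1n mulr1.
  have xd : x ^+ d = -1 by apply: (fmorph_inj iota); rewrite rmorphXn rmorphN rmorph1 /= -zx.
  have vx : MO O2 + z *: MO O1 = MO (O2 + x *: O1) by rewrite /MO map_mxD map_mxZ zx.
  have [v0 Hv] := Hz x xd.
  have Gv : G.@[(O2 + x *: O1) 0] = 0 by apply: (fmorph_inj iota); rewrite rmorph0 -MOE -vx.
  rewrite (vE _ _ (hessian_homog _ _)) mulf_neq0 ?expf_neq0 // vx.
  rewrite (meval_eq (v2 := fun i => iota ((O2 + x *: O1) 0 i))) => [|i]; last by rewrite mxE.
  rewrite meval_hessian_map fmorph_eq0; case: Hv => [[vn v3]|[k hk vk]].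
    exact: (rational_hessian_neq0 cardF d1 char2 dR dR1 nu ksE fE vn v3 Gv).
  by have := rational_off_lines cardF d1 char2 dR dR1 ksE fE v0 Gv hk; rewrite vk eqxx.
have {}e0 i : e i = 0 by apply/eqP; have := e0 i; rewrite negbK.
(* For e = 0 the curve is Fermat's and its Hessian is a power of X_0 X_1 X_2. On the line X_2 = c
   X_0 + X_1, with X_0 = s and X_1 = t, the choice c^d = 2 gives the form the values 2 t^d, 3 s^d
   and (1 + 2 (-1)^d) s^d on the three axes, and none of them is zero. *)
have [c Hc] : exists c : K, c ^+ d = 2%:R.
  have /closed_rootP [c] : size ('X^d - (2%:R)%:P : {poly K}) != 1%N by rewrite size_XnsubC // eqSS -lt0n.
  by rewrite rootE !hornerE subr_eq0 => /eqP; exists c.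
have m2 := natK char2; have m3 := natK char3.
have fourth0 (v : 'I_3 -> K) : fourth eK v = 0 by rewrite /fourth big1 // => i _; rewrite e0 rmorph0 mul0r.
have fv (v : 'I_3 -> K) : (four_term_form d eK).@[v] = v o0 ^+ d + v o1 ^+ d + v o2 ^+ d.
  by rewrite meval_four_term fourth0 expr0n eqn0Ngt d0 addr0 sum_ord3.
pose O1 : 'rV[K]_3 := rotv o0 1 0 c; pose O2 : 'rV[K]_3 := rotv o0 0 1 1.
have [E10 E11 E12] := rotvE o0 (1 : K) 0 c; have [E20 E21 E22] := rotvE o0 (0 : K) 1 1.
apply: (@finite_inflections O1 O2).
- by apply: (row_free_minor (i := o0) (j := rot1 o0)); rewrite E10 E11 E20 E21 mulr0 subr0 mulr1 oner_eq0.
- have : (four_term_form d eK).@[O1 0] != 0.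
    rewrite fv E10 -[o1]/(rot1 o0) E11 -[o2]/(rot2 o0) E12 Hc expr1n expr0n eqn0Ngt d0 addr0.
    by rewrite (_ : 1 + 2%:R = 3%:R :> K) //; ring.
  by rewrite map_factorization mevalM mulf_eq0 negb_or => /andP[].
move=> s t st; set w := s *: O1 + t *: O2 => Gw.
have comb i : w 0 i = s * O1 0 i + t * O2 0 i by rewrite /w !mxE.
have w0 : w 0 o0 = s by rewrite comb E10 E20; ring.
have w1 : w 0 o1 = t by rewrite comb -[o1]/(rot1 o0) E11 E21; ring.
have w2 : w 0 o2 = c * s + t by rewrite comb -[o2]/(rot2 o0) E12 E22; ring.
have fw : s ^+ d + t ^+ d + (c * s + t) ^+ d = 0.
  by have := fv (w 0); rewrite map_factorization mevalM Gw mulr0 w0 w1 w2 => <-.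
have s0 : s != 0.
  apply: contraTneq st => s0; rewrite s0 eqxx /=; move/eqP: fw.
  rewrite s0 mulr0 add0r expr0n eqn0Ngt d0 add0r -mulr2n -mulr_natr mulf_eq0 (negPf m2) orbF expf_eq0 d0.
  by case/andP=> _ ->.
have t0 : t != 0.
  apply: contra_eq_neq fw => ->.
  rewrite expr0n eqn0Ngt d0 !addr0 exprMn Hc -[X in X + _]mul1r -mulrDl (_ : 1 + 2%:R = 3%:R :> K); last by ring.
  by rewrite mulf_neq0 // expf_neq0.
have u0 : c * s + t != 0.
  apply: contra_eq_neq fw => u; have -> : t = - (c * s) by apply/eqP; rewrite -addr_eq0 addrC u.
  rewrite subrr expr0n eqn0Ngt d0 addr0 exprNn exprMn Hc.
  have -> : s ^+ d + (-1) ^+ d * (2%:R * s ^+ d) = (1 + (-1) ^+ d * 2%:R) * s ^+ d by ring.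
  rewrite mulf_neq0 ?expf_neq0 // -signr_odd; case: (odd d).
    have -> : 1 + (-1) ^+ true * 2%:R = -1 :> K by rewrite expr1; ring.
    by rewrite oppr_eq0 oner_eq0.
  have -> : 1 + (-1) ^+ false * 2%:R = 3%:R :> K by rewrite expr0; ring.
  by [].
rewrite (meval_hessian _ _ _ o0) !e0 rmorph0 expr0n /= !mul0r !addr0 mulr0 addr0.
by rewrite w0 -[rot1 o0]/o1 -[rot2 o0]/o2 w1 w2 !mulf_neq0 // expf_neq0.
Qed.

End OverClosedField.

(** * Irreducibility and lists of components *)

Lemma homog_meval0 n (R : comNzRingType) (p : {mpoly R[n]}) k : p \is k.-homog -> (0 < k)%N ->
  p.@[fun=> 0] = 0.
Proof.
move=> hp k0; have -> : p.@[fun=> 0] = p.@[fun i => 0 * 0] by apply: meval_eq => i; rewrite mul0r.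
by rewrite (meval_homog _ _ hp) expr0n eqn0Ngt k0 mul0r.
Qed.

Lemma homog_not_unit n (R : fieldType) (p : {mpoly R[n]}) k : p \is k.-homog -> (0 < k)%N ->
  p \isn't a GRing.unit.
Proof.
move=> hp k0; apply/negP => /(rmorph_unit (meval (fun=> 0))).
by rewrite /= (homog_meval0 hp k0) unitr0.
Qed.

Lemma homog0_unit n (R : fieldType) (p : {mpoly R[n]}) : p \is 0.-homog -> p != 0 ->
  p \is a GRing.unit.
Proof.
move=> /homog0_const ->; rewrite mpolyC_eq0 => c0.
by apply: (rmorph_unit (@mpolyC n R)); rewrite unitfE.
Qed.

Lemma line_irreducible (R : fieldType) (l : {mpoly R[3]}) : is_line l -> irreducible_mpoly l.
Proof.
case/andP=> l0 hl; split=> //; first exact: homog_not_unit hl _.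
move=> g h E; have gh0 : g * h != 0 by rewrite -E.
have hgh : g * h \is 1.-homog by rewrite -E.
have [i hg /andP[i1 hh]] := homog_factor gh0 hgh.
have /andP[g0 h0] : (g != 0) && (h != 0) by rewrite -negb_or -mulf_eq0.
case: i i1 hg hh => [|[|//]] _ hg hh; first by left; apply: homog0_unit.
by right; apply: homog0_unit.
Qed.

(** Two nonconstant factors would vanish at a common point by [two_curves_meet], and there both the
    product and its gradient vanish. *)
Lemma nonsingular_irreducible (K : closedFieldType) (G : {mpoly K[3]}) n :
  G != 0 -> G \is n.-homog -> (0 < n)%N -> nonsingular G -> irreducible_mpoly G.
Proof.
move=> G0 hG n0 ns; split=> //; first exact: homog_not_unit hG n0.
move=> g h E; have gh0 : g * h != 0 by rewrite -E.
have hgh : g * h \is n.-homog by rewrite -E.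
have [i hg /andP[i1 hh]] := homog_factor gh0 hgh.
have /andP[g0 h0] : (g != 0) && (h != 0) by rewrite -negb_or -mulf_eq0.
case: (posnP i) => [i0|ip]; first by rewrite i0 in hg; left; apply: homog0_unit.
case: (posnP (n - i)) => [i0|nip]; first by rewrite i0 in hh; right; apply: homog0_unit.
have [v [v0 gv hv]] := two_curves_meet g0 h0 hg hh ip nip.
have [P [c c0 Ev]] := normalize v0.
have gP : eval_pt g P = 0 by apply/eqP; rewrite -(eval_ptZ hg c0 Ev) gv.
have hP : eval_pt h P = 0 by apply/eqP; rewrite -(eval_ptZ hh c0 Ev) hv.
have GP : eval_pt G P = 0 by rewrite E /eval_pt mevalM -/(eval_pt g P) gP mul0r.
have [j] := ns P GP; rewrite E mderivM /eval_pt mevalD !mevalM -/(eval_pt g P) -/(eval_pt h P).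
by rewrite gP hP mulr0 mul0r addr0 eqxx.
Qed.

Lemma reduced_components (R : fieldType) (f : {mpoly R[3]}) s :
  {in s, forall H, irreducible_mpoly H} -> distinct_curves s -> same_curve f (\prod_(H <- s) H) ->
  components f s.
Proof. by move=> ir ds sf; split=> //; exists (fun=> 1%N). Qed.

Lemma homogenized_roots (K L : fieldType) (iota : {rmorphism K -> L}) (r : seq K) d (x y : L) :
  'X^d + 1 = \prod_(z <- r) ('X - z%:P) -> y != 0 -> size r = d ->
  x ^+ d + y ^+ d = \prod_(z <- r) (x - iota z * y).
Proof.
move=> E y0 sr; have := congr1 (fun p => (map_poly iota p).[x / y] * y ^+ d) E.
rewrite rmorphD /= map_polyXn rmorph1 !hornerE mulrDl mul1r exprMn exprVn divfK ?expf_neq0 // => ->.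
rewrite -sr rmorph_prod horner_prod /=; elim: (r) => [|z s IH]; first by rewrite !big_nil mulr1.
have step : (map_poly iota ('X - z%:P)).[x / y] * y = x - iota z * y.
  by rewrite rmorphB /= map_polyX map_polyC !hornerE mulrBl divfK.
by rewrite !big_cons exprS mulrACA step IH.
Qed.

(** The fourth term is e_k X_k, whose d-th power cancels X_k^d, and X_a^d + X_b^d splits into d
    lines through one point. They are distinct because d is invertible; the factorization is checked
    in the fraction field, where X_b can be divided out. *)
Lemma union_of_lines_degenerate (K : closedFieldType) (e : 'I_3 -> K) d k : (0 < d)%N ->
  d%:R != 0 :> K -> e k ^+ d = -1 -> (forall i, i != k -> e i = 0) ->
  union_of_lines d (four_term_form d e).
Proof.
move=> d0 dR ek e0; have [ka kb ab] := rot_neq k; set a := rot1 k in ka ab *; set b := rot2 k in kb ab *.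
have [r Er] := closed_field_poly_normal ('X^d + 1 : {poly K}).
have lc : lead_coef ('X^d + 1 : {poly K}) = 1 by rewrite -polyC1 lead_coefXnaddC.
rewrite lc scale1r in Er.
have sr : size r = d by apply: succn_inj; rewrite -(size_prod_XsubC r id) -Er -polyC1 size_XnaddC.
have ur : uniq r.
  rewrite -separable_prod_XsubC -Er separable_poly.unlock derivD derivXn derivC addr0.
  apply/Bezout_coprimepP; exists (1, - (d%:R^-1)%:P * 'X) => /=.
  rewrite mul1r -scaler_nat -mul_polyC mulrACA mulNr -polyCM mulVf // -exprS prednK //.
  by rewrite mulN1r addrAC subrr add0r eqpxx.
pose l z : {mpoly K[3]} := 'X_a - z *: 'X_b.
have lE z v : (l z).@[v] = v a - z * v b by rewrite mevalB mevalZ !mevalXU.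
have l_line z : is_line (l z).
  apply/andP; split; last by apply: rpredB; [|apply: dhomogZ]; rewrite dhomogX /= mdeg1.
  apply: contra_eq_neq (lE z (dirac K a 0)) => ->.
  by rewrite meval0 !mxE eqxx [b == _]eq_sym (negPf ab) mulr0 subr0 eq_sym oner_eq0.
exists [seq l z | z <- r]; split; [|by rewrite size_map|by apply/allP => H /mapP[z _ ->]].
apply: reduced_components.
- by move=> H /mapP[z _ ->]; apply: line_irreducible.
- rewrite /distinct_curves size_map => i j ij jr [c c0].
  have ir := ltn_trans ij jr; rewrite !(nth_map 0) // => E.
  have := congr1 (meval (dirac K a 0)) E; have := congr1 (meval (dirac K b 0)) E.
  rewrite !mevalZ !lE !mxE !eqxx (negPf ab) [b == _]eq_sym (negPf ab) !mulr0 !subr0 !sub0r !mulr1.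
  move=> E1 E2; move: E1; rewrite -E2 mul1r => /oppr_inj /eqP.
  by rewrite nth_uniq // => /eqP Eij; rewrite Eij ltnn in ij.
exists 1; rewrite ?oner_eq0 // scale1r; apply/eqP; rewrite -tofrac_eq; apply/eqP.
rewrite big_map rmorph_prod /=.
have Xb0 : tofrac ('X_b : {mpoly K[3]}) != 0.
  rewrite tofrac_eq0; apply: contra_eq_neq (mevalXU (dirac K b 0) b) => ->.
  by rewrite meval0 !mxE eqxx eq_sym oner_eq0.
pose cF : {rmorphism K -> {fraction {mpoly K[3]}}} := @tofrac _ \o @mpolyC 3 K.
have := homogenized_roots cF (tofrac 'X_a) Er Xb0 sr; rewrite -!rmorphXn -rmorphD /=.
have -> : four_term_form d e = 'X_a ^+ d + 'X_b ^+ d.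
  rewrite /four_term_form (sum_rot _ k) -/a -/b (bigD1 k) //= big1 => [|i ik]; last by rewrite e0 ?scale0r.
  by rewrite addr0 exprZn ek scaleN1r; ring.
move=> ->; apply: eq_bigr => z _.
by rewrite /l rmorphB -mul_mpolyC rmorphM.
Qed.

Section Components.
Variables (K : fieldType) (e : 'I_3 -> K) (d : nat) (ks : seq 'I_3) (G : {mpoly K[3]}) (n : nat).
Hypotheses (d1 : (1 < d)%N) (dR : d%:R != 0 :> K).
Hypotheses (uks : uniq ks) (ksE : {in ks, forall k, has_line e d k}).
Hypothesis fE : four_term_form d e = (\prod_(k <- ks) comp_line e k) * G.
Hypotheses (hG : G \is n.-homog) (nks : (n + size ks = d)%N).
Local Notation f := (four_term_form d e).
Local Notation lines := [seq comp_line e k | k <- ks].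

Let d0 : (0 < d)%N. Proof. exact: ltnW. Qed.

Lemma lines_distinct : distinct_curves lines.
Proof.
move=> i j ij js [c c0]; rewrite size_map in js; have is_ := ltn_trans ij js.
rewrite !(nth_map o0) // => E.
have := comp_line_neq_multiple d0 (ksE (mem_nth o0 is_)) (ksE (mem_nth o0 js)) E.
by move/eqP; rewrite nth_uniq // => /eqP Eij; rewrite Eij ltnn in ij.
Qed.

Lemma lines_are_lines l : l \in lines -> is_line l.
Proof. by case/mapP=> k kks ->; apply: (comp_line_is_line d0 (ksE kks)). Qed.

Lemma residual_neq0 : G != 0.
Proof. by apply: contraNneq (four_term_neq0 e d0 d1 dR) => G0; rewrite fE G0 mulr0. Qed.

Lemma union_of_lines_const : n = 0%N -> union_of_lines d f.
Proof.
move=> n0; exists lines; split; last first.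
- by apply/allP => l; apply: lines_are_lines.
- by rewrite size_map -nks n0.
apply: reduced_components; [|exact: lines_distinct|].
  by move=> l ls; apply/line_irreducible/lines_are_lines.
have hG0 : G \is 0.-homog by move: hG; rewrite n0.
have GC := homog0_const hG0; exists (G@_0%MM).
  by apply: contra_neq residual_neq0 => E; rewrite GC E mpolyC0.
by rewrite fE {1}GC big_map mulrC mul_mpolyC.
Qed.

End Components.

(** The bound n > 1 keeps G itself from counting as a line among the components. *)
Lemma residual_components (K : closedFieldType) (e : 'I_3 -> K) (d : nat) (ks : seq 'I_3) (G : {mpoly K[3]}) n
    (f := four_term_form d e) (lines := [seq comp_line e k | k <- ks]) :
  (1 < d)%N -> d%:R != 0 :> K -> uniq ks -> {in ks, forall k, has_line e d k} ->
  f = (\prod_(k <- ks) comp_line e k) * G -> G \is n.-homog -> (1 < n)%N -> nonsingular G ->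
  union_of_nonlinear_components f G.
Proof.
move=> d1 dR uks ksE fE hG n1 ns; have d0 := ltnW d1.
have lines_are_lines l : l \in lines -> is_line l by apply: (lines_are_lines d1 ksE).
have residual_neq0 : G != 0 by apply: residual_neq0 d1 dR fE.
have lines_distinct : distinct_curves lines by apply: lines_distinct d1 uks ksE.
have G_nl : ~~ is_line G.
  apply/negP => /andP[G0 h1]; have := dhomog_uniq G0 hG h1; by move=> E; rewrite E in n1.
exists (rcons lines G); last first.
  exists 1; rewrite ?oner_eq0 // scale1r -cats1 big_cat /= [X in _ * X]big_cons big_nil G_nl mulr1.
  rewrite big_seq_cond big1 ?mul1r //.
  by move=> l /andP[/lines_are_lines ->].
apply: reduced_components.
- move=> H; rewrite mem_rcons inE => /orP[/eqP ->|/lines_are_lines /line_irreducible //].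
  exact: nonsingular_irreducible residual_neq0 hG (ltnW n1) ns.
- move=> i j ij; rewrite size_rcons ltnS leq_eqVlt !nth_rcons => /orP[/eqP Ej|js].
    rewrite Ej ltnn eqxx -Ej ij => -[c c0 E].
    have hl : is_line (lines`_i) by apply/lines_are_lines/mem_nth; rewrite -Ej.
    case/negP: G_nl; apply/andP; split; first exact: residual_neq0.
    have -> : G = c^-1 *: lines`_i by rewrite E scalerA mulVf // scale1r.
    by apply: dhomogZ; case/andP: hl.
  by rewrite js (ltn_trans ij js); apply: lines_distinct.
exists 1; rewrite ?oner_eq0 // scale1r fE -cats1 big_cat /= big_map big_seq1 //.
Qed.

(** * Rational points with two vanishing terms *)

Section TwoZeroPoints.
Variables (F : finFieldType) (d : nat) (e : 'I_3 -> F).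
Hypotheses (cardF : #|F| = d.*2.+1) (d1 : (1 < d)%N) (char2 : (2%:R : F) != 0).
Local Notation f := (four_term_form d e).
Local Notation x3 v := (fourth e v).
Local Notation a k := (rot1 k).
Local Notation b k := (rot2 k).
Implicit Types (v w : 'rV[F]_3).

Let d0 : (0 < d)%N. Proof. exact: ltnW. Qed.
Let esq i : e i != 0 -> e i ^+ d * e i ^+ d = 1. Proof. exact: sqr_pow_d cardF _. Qed.

(** The two vanishing terms either leave out the fourth term ([two_zero_out]) or contain it
    ([two_zero_in]); k is the index of the term that behaves like X_3. *)
Definition two_zero_out k v := [/\ v 0 (a k) = 0, v 0 (b k) = 0, v 0 k != 0 & x3 (v 0) ^+ d = - v 0 k ^+ d].
Definition two_zero_in k v := [/\ v 0 k = 0, x3 (v 0) = 0, v 0 (a k) != 0 & v 0 (a k) ^+ d = - v 0 (b k) ^+ d].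

Lemma opp_qchar (x y : F) (s : int) : qchar d x == s -> qchar d y == - s -> s \in [:: 1; -1] ->
  [/\ x != 0, y ^+ d = - x ^+ d & x ^+ d = - y ^+ d].
Proof.
move=> /eqP Ex /eqP Ey hs; split; [|by rewrite !(qcharE cardF d0) Ex Ey rmorphN
  |by rewrite !(qcharE cardF d0) Ex Ey rmorphN opprK].
by rewrite -(qchar_eq0 d) Ex; move: hs; rewrite !inE => /orP[] /eqP ->.
Qed.

Lemma two_zero_cases v : pattern d e v \in two_zero_patterns ->
  exists k, two_zero_out k v \/ two_zero_in k v.
Proof.
rewrite /pattern -/(x3 (v 0)) !inE !xpair_eqE.
have Z (x : F) : qchar d x == 0 -> x = 0 by rewrite qchar_eq0 => /eqP.
move=> H; repeat (case/orP: H => H); move: H; rewrite -!andbA => /and4P[H0 H1 H2 H3];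
  first
  [ by exists o2; left; rewrite /two_zero_out /two_zero_in /rot1 /rot2 /=; split; rewrite ?(Z _ H0) ?(Z _ H1) //; have [] := opp_qchar H2 H3 isT
  | by exists o1; left; rewrite /two_zero_out /two_zero_in /rot1 /rot2 /=; split; rewrite ?(Z _ H0) ?(Z _ H2) //; have [] := opp_qchar H1 H3 isT
  | by exists o0; left; rewrite /two_zero_out /two_zero_in /rot1 /rot2 /=; split; rewrite ?(Z _ H2) ?(Z _ H1) //; have [] := opp_qchar H0 H3 isT
  | by exists o0; right; rewrite /two_zero_out /two_zero_in /rot1 /rot2 /=; split; rewrite ?(Z _ H0) ?(Z _ H3) //; have [] := opp_qchar H1 H2 isT
  | by exists o1; right; rewrite /two_zero_out /two_zero_in /rot1 /rot2 /=; split; rewrite ?(Z _ H1) ?(Z _ H3) //; have [] := opp_qchar H2 H0 isT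
  | by exists o2; right; rewrite /two_zero_out /two_zero_in /rot1 /rot2 /=; split; rewrite ?(Z _ H2) ?(Z _ H3) //; have [] := opp_qchar H0 H1 isT ].
Qed.

Hypotheses (nu : ~ (exists k, e k ^+ d = -1 /\ forall i, i != k -> e i = 0)).

Let fourthD (v w : 'I_3 -> F) : x3 (fun i => v i + w i) = x3 v + x3 w.
Proof. by rewrite /fourth -big_split /=; apply: eq_bigr => i _; rewrite mulrDr. Qed.

(** The direction w is chosen so that X_k and X_3 vanish at one of v, w, and X_a and X_b at the
    other. Along the line the pair that is nonzero at v stays constant and cancels, and the other
    pair contributes c t^d. If c were zero, v + w would satisfy [has_line_intro]. *)
Lemma two_zero_total v : pattern d e v \in two_zero_patterns -> (forall k, ~~ has_line e d k) ->
  exists w, exists2 c, row_free (col_mx v w) & c != 0 /\ restr idfun (v 0) (w 0) f = c *: 'X^d.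
Proof.
move=> /two_zero_cases [k [[va vb vk xd]|[vk x30 va vab]]] nl.
  have E : x3 (v 0) = e k * v 0 k by rewrite (fourth_rot e _ k) va vb !mulr0 !addr0.
  have ek : e k ^+ d = -1.
    by apply: (mulIf (expf_neq0 d vk)); rewrite -exprMn -E xd mulN1r.
  have [Wk Wa Wb] := dir_lineE e k; have F0 := fourth_dir_line e k.
  have eab : (e (a k) != 0) || (e (b k) != 0).
    apply: contraT; rewrite negb_or !negbK => /andP[/eqP ea /eqP eb]; case: nu; exists k.
    by split=> // i ik; have [Ei|->|->] := rotP k i; rewrite // Ei eqxx in ik.
  exists (dir_line e k), (e (b k) ^+ d + (- e (a k)) ^+ d).
    case/orP: eab => en; [apply: (row_free_minor (i := k) (j := b k))|apply: (row_free_minor (i := k) (j := a k))].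
      by rewrite Wk Wb mulr0 subr0 mulf_neq0 ?oppr_eq0.
    by rewrite Wk Wa mulr0 subr0 mulf_neq0.
  split; last first.
    rewrite restr_four_term (sum_rot _ k) F0 va vb Wk Wa Wb !scale0r !addr0 !add0r -!polyC_exp xd !exprZn.
    by rewrite polyCN scalerDl; ring.
  apply/eqP => c0; have eb0 : e (b k) != 0.
    apply: contraTneq eab => eb; rewrite eb eqxx orbF negbK; move/eqP: c0.
    by rewrite eb expr0n eqn0Ngt d0 add0r expf_eq0 oppr_eq0 => /andP[_].
  have [|||||_ [hl|H]] := @has_line_intro F e d d1 esq k (fun i => v 0 i + dir_line e k 0 i).
  - by rewrite va Wa add0r.
  - by rewrite Wk addr0.
  - by rewrite fourthD F0 Wk !addr0.
  - by rewrite fourthD F0 Wk !addr0.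
  - by rewrite va vb Wa Wb !add0r; apply/eqP; rewrite -addr_eq0 c0.
  - by move: (nl k); rewrite hl.
  by case: nu; exists k.
have [ka kb ab] := rot_neq k.
have Wk : dirac F k 0 k = 1 by rewrite mxE eqxx.
have Wa : dirac F k 0 (a k) = 0 by rewrite mxE (negPf ka).
have Wb : dirac F k 0 (b k) = 0 by rewrite mxE (negPf kb).
have F0 := fourth_dirac e k.
exists (dirac F k), (1 + e k ^+ d).
  by apply: (row_free_minor (i := a k) (j := k)); rewrite vk mul0r subr0 Wk mulr1.
split; last first.
  rewrite restr_four_term (sum_rot _ k) F0 vk x30 Wk Wa Wb !scale0r !addr0 !add0r -!polyC_exp vab !exprZn.
  by rewrite polyCN scalerDl expr1n; ring.
apply/eqP => c0.
have [|||||ek [hl|H]] := @has_line_intro F e d d1 esq k (fun i => v 0 i + dirac F k 0 i).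
- by rewrite Wa addr0.
- by rewrite vk Wk add0r oner_neq0.
- by rewrite fourthD F0 x30 vk Wk !add0r mulr1.
- by rewrite fourthD F0 x30 vk Wk !add0r expr1n; apply/eqP; rewrite -addr_eq0 addrC c0.
- by rewrite Wa Wb !addr0.
- by move: (nl k); rewrite hl.
by case: nu; exists k.
Qed.

(** For [two_zero_in] the equation X_3 = e_k X_k is trivial, and e_k^d = -1 follows from e_a X_a =
    -e_b X_b and the known d-th power of e_0 e_1 e_2. *)
Lemma two_zero_on_line k0 v : has_line e d k0 -> pattern d e v \in two_zero_patterns ->
  exists2 k, has_line e d k & x3 (v 0) = e k * v 0 k.
Proof.
move=> hk0 /two_zero_cases [k [[va vb vk xd]|[vk x30 va vab]]].
  have E : x3 (v 0) = e k * v 0 k by rewrite (fourth_rot e _ k) va vb !mulr0 !addr0.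
  exists k => //; apply/andP; split; last by case/andP: hk0.
  by apply/eqP/(mulIf (expf_neq0 d vk)); rewrite -exprMn -E xd mulN1r.
exists k; last by rewrite x30 vk mulr0.
have ea := has_line_neq0 d0 (a k) hk0; have ek := has_line_neq0 d0 k hk0.
have eb := esq (has_line_neq0 d0 (b k) hk0).
case/andP: hk0 => _ /eqP hp; rewrite /has_line hp eqxx andbT.
have E : (e (a k) * v 0 (a k)) ^+ d = (- (e (b k) * v 0 (b k))) ^+ d.
  congr (_ ^+ d); apply/eqP; rewrite -subr_eq0 opprK -x30 (fourth_rot e _ k) vk mulr0 add0r.
  exact: eqxx.
move: E; rewrite exprNn !exprMn vab => E; move: E hp eb; rewrite (prod_rot e k) !exprMn.
have vb : v 0 (b k) ^+ d != 0 by rewrite -oppr_eq0 -vab expf_neq0.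
have s1 : (-1 : F) ^+ d * (-1) ^+ d = 1 by rewrite -expr2 sqrr_sign.
move: ((-1) ^+ d) (v 0 (b k) ^+ d) (e (a k) ^+ d) (e (b k) ^+ d) (e k ^+ d) vb s1 => s y x2 x3 x1 y0 s1 E hp xx.
have eab : x2 = - s * x3 by apply: (mulIf y0); rewrite -[LHS]opprK -mulrN E; ring.
apply/eqP; transitivity (- (s * (x1 * x2 * x3))); last by rewrite hp s1.
by rewrite eab; transitivity (x1 * (s * s) * (x3 * x3)); [rewrite s1 xx !mulr1|ring].
Qed.
End TwoZeroPoints.

(** * Rational points of C and their sign patterns *)

Section RationalPoints.
Variables (F : finFieldType) (d : nat) (e : 'I_3 -> F).
Hypotheses (cardF : #|F| = d.*2.+1) (d0 : (0 < d)%N).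
Hypotheses (char2 : (2%:R : F) != 0) (char3 : (3%:R : F) != 0).
Local Notation f := (four_term_form d e).
Local Notation chi := (@qchar F d).

Definition root_patterns := balanced_patterns ++ two_zero_patterns.

Lemma qchar_sign (x : F) : chi x \in signs.
Proof. by case: (qchar_cases d x) => -[_ ->]. Qed.

Lemma meval_pattern (v : 'rV[F]_3) (s := pattern d e v) :
  f.@[v 0] = (s.1.1.1 + s.1.1.2 + s.1.2 + s.2)%:~R.
Proof. by rewrite meval_four_term sum_ord3 !(qcharE cardF d0) !rmorphD. Qed.

Lemma small_int_neq0 (z : int) : z \in [:: 1; 2; 3; 4; -1; -2; -3; -4] -> (z%:~R : F) != 0.
Proof.
have h4 : (4%:R : F) != 0 by rewrite (natrM _ 2 2) mulf_neq0.
by rewrite !inE; do 7! (case/orP; first by move=> /eqP ->; rewrite ?rmorphN ?oppr_eq0 // oner_eq0);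
  move=> /eqP ->; rewrite rmorphN oppr_eq0.
Qed.

(** The value of the form is the image in F of the sum of the four signs, an integer between -4 and
    4; with 2 and 3 invertible it vanishes in F only if it is the integer 0. *)
Lemma four_term_root (v : 'rV[F]_3) : v != 0 -> (f.@[v 0] == 0) = (pattern d e v \in root_patterns).
Proof.
move=> v0; rewrite meval_pattern; apply/idP/idP; last first.
  have H : all (fun s => s.1.1.1 + s.1.1.2 + s.1.2 + s.2 == 0 :> int) root_patterns by vm_compute.
  by move=> /(allP H) /eqP ->.
have [n0 s3] : ~~ [&& chi (v 0 o0) == 0, chi (v 0 o1) == 0 & chi (v 0 o2) == 0] /\ chi (\sum_i e i * v 0 i) \in signs.
  split; last exact: qchar_sign.
  rewrite !qchar_eq0; apply: contra v0 => /and3P[/eqP h0 /eqP h1 /eqP h2].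
  by apply/eqP/rowP => i; rewrite mxE; case: (ord3P i) => ->.
rewrite /pattern /=; move: n0 s3 (qchar_sign (v 0 o0)) (qchar_sign (v 0 o1)) (qchar_sign (v 0 o2)).
move: (chi (v 0 o0)) (chi (v 0 o1)) (chi (v 0 o2)) (chi (\sum_i e i * v 0 i)) => s0 s1 s2 s3 n0 h3 h0 h1 h2.
apply: contraLR => nin; apply: small_int_neq0; move: h0 h1 h2 h3 n0 nin; rewrite !inE.
move=> /or3P[] /eqP-> /or3P[] /eqP-> /or3P[] /eqP-> /or3P[] /eqP-> n0 nin.
all: by vm_compute in n0; vm_compute in nin.
Qed.

Lemma card_patterns ps : uniq ps ->
  all (fun s => [&& s.1.1.1 \in signs, s.1.1.2 \in signs, s.1.2 \in signs & s.2 \in signs]) ps ->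
  #|[set v | pattern d e v \in ps]|%:R = sum_patterns ps #|F|%:R
    (chi (e o0))%:~R (chi (e o1))%:~R (chi (e o2))%:~R (chi (-1))%:~R.
Proof.
rewrite /sum_patterns; elim: ps => [|s ps IH] /=.
  by rewrite big_nil (_ : [set _ | _] = set0) ?cards0 //; apply/setP => v; rewrite !inE.
case/andP=> sps /IH {}IH /andP[hs /IH {}IH]; rewrite big_cons -card_pattern // -IH -natrD -cardsUI.
rewrite (_ : _ :&: _ = set0) ?cards0 ?addn0.
  by congr (_%:R); apply: eq_card => v; rewrite !inE.
by apply/setP => v; rewrite !inE; apply/andP => -[/eqP -> sp]; rewrite sp in sps.
Qed.

Lemma pattern_scale ps c v :
  all (fun s : int * int * int * int => (- s.1.1.1, - s.1.1.2, - s.1.2, - s.2) \in ps) ps -> c != 0 ->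
  (pattern d e (c *: v) \in ps) = (pattern d e v \in ps).
Proof.
move=> /allP H c0.
have -> : pattern d e (c *: v) =
    (chi c * chi (v 0 o0), chi c * chi (v 0 o1), chi c * chi (v 0 o2), chi c * chi (\sum_i e i * v 0 i)).
  rewrite /pattern -!(qcharM cardF d0 char2) !mxE mulr_sumr; congr (_, _, _, chi _).
  by apply: eq_bigr => i _; rewrite mxE; ring.
rewrite /pattern; case: (qchar_cases d c) => -[h ->]; first by rewrite h eqxx in c0.
  by rewrite !mul1r.
rewrite !mulN1r; apply/idP/idP => /H /=; rewrite ?opprK //.
Qed.

(** A set of patterns closed under negation is invariant under scaling, so each point accounts for 2
    d = q - 1 vectors; the last condition keeps the zero vector out. *)
Lemma card_points ps : uniq ps ->
  all (fun s => [&& s.1.1.1 \in signs, s.1.1.2 \in signs, s.1.2 \in signs & s.2 \in signs]) ps ->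
  all (fun s : int * int * int * int => (- s.1.1.1, - s.1.1.2, - s.1.2, - s.2) \in ps) ps ->
  (0, 0, 0, 0) \notin ps ->
  2%:R * d%:R * #|[set P : PG2 F | pattern d e (val P) \in ps]|%:R = sum_patterns ps #|F|%:R
    (chi (e o0))%:~R (chi (e o1))%:~R (chi (e o2))%:~R (chi (-1))%:~R :> rat.
Proof.
move=> ups sps Nps ps0; rewrite -card_patterns // -!natrM.
have := @card_cone F (fun v => pattern d e v \in ps) (fun c v c0 => pattern_scale v Nps c0).
rewrite {1}cardF /= -mul2n => <-; congr (_%:R); apply: eq_card => v; rewrite !inE.
case: eqVneq => //= ->; rewrite /pattern !mxE big1 => [|i _]; last by rewrite mxE mulr0.
by rewrite /qchar eqxx (negPf ps0).
Qed.
End RationalPoints.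

(** * Rational inflections and the sizes of the pattern classes *)

Section RationalInflections.
Variables (F : finFieldType) (K : closedFieldType) (iota : {rmorphism F -> K}).
Variables (d : nat) (e : 'I_3 -> F) (ks : seq 'I_3) (G : {mpoly F[3]}) (n : nat).
Hypotheses (cardF : #|F| = d.*2.+1) (d1 : (1 < d)%N).
Hypotheses (char2 : (2%:R : F) != 0) (char3 : (3%:R : F) != 0).
Hypotheses (dR : d%:R != 0 :> F) (dR1 : d.-1%:R != 0 :> F).
Hypotheses (frob : forall x y : K, (x + y) ^+ d.*2.+1 = x ^+ d.*2.+1 + y ^+ d.*2.+1).
Hypotheses (nu : ~ (exists k, e k ^+ d = -1 /\ forall i, i != k -> e i = 0)).
Hypotheses (ksE : forall k, (k \in ks) = has_line e d k).
Hypothesis fE : four_term_form d e = (\prod_(k <- ks) comp_line e k) * G.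
Hypothesis hG : G \is n.-homog.
Local Notation f := (four_term_form d e).
Local Notation GK := (map_mpoly iota G).
Implicit Types P : PG2 F.

Let d0 : (0 < d)%N. Proof. exact: ltnW. Qed.

Lemma eval_pt_map (p : {mpoly F[3]}) P : eval_pt (map_mpoly iota p) (PG2_map iota P) = iota (eval_pt p P).
Proof. by rewrite /eval_pt -meval_map_mpoly; apply: meval_eq => i; rewrite mxE. Qed.

Lemma residual_root_pattern P : eval_pt G P = 0 -> pattern d e (val P) \in root_patterns.
Proof.
by move=> GP; rewrite -(four_term_root e cardF d0 char2 char3) ?normalized_neq0 // fE mevalM [X in _ * X]GP mulr0.
Qed.

Lemma balanced_not_inflection P : pattern d e (val P) \in balanced_patterns ->
  ~ inflection_point GK (PG2_map iota P).
Proof.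
move=> bP IP; have GP : eval_pt G P = 0.
  by apply: (fmorph_inj iota); rewrite -eval_pt_map rmorph0; case: IP.
have := inflection_on_hessian cardF d1 char2 char3 dR dR1 frob nu ksE fE hG IP.
rewrite (meval_eq (v2 := fun i => iota (val P 0 i))) => [|i]; last by rewrite mxE.
rewrite meval_hessian_map => /eqP; rewrite fmorph_eq0; apply/negP.
have H : all (fun s : int * int * int * int => [&& s.1.1.1 != 0, s.1.1.2 != 0, s.1.2 != 0 & s.2 != 0]) balanced_patterns by [].
have := allP H _ bP; rewrite /pattern /= !qchar_eq0 => /and4P[v0 v1 v2 v3].
apply: (rational_hessian_neq0 cardF d1 char2 dR dR1 nu ksE fE) => // i.
by case: (ord3P i) => ->.
Qed.

Lemma two_zero_intersection P k : ks = [::] -> pattern d e (val P) \in two_zero_patterns ->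
  intersection_mult_ge (PG2_map iota P) GK (tangent_line GK (PG2_map iota P)) k <-> (k <= d)%N.
Proof.
move=> ks0 tP; have nl j : ~~ has_line e d j by rewrite -ksE ks0.
have [w [c vw [c0 E]]] := two_zero_total cardF d1 nu tP nl.
have fG : f = G by rewrite fE ks0 big_nil mul1r.
have GP : eval_pt GK (PG2_map iota P) = 0.
  rewrite eval_pt_map -fG; apply/eqP; rewrite fmorph_eq0 /eval_pt.
  by rewrite (four_term_root e cardF d0 char2 char3) ?normalized_neq0 // mem_cat tP orbT.
have tl : is_line (tangent_line GK (PG2_map iota P)).
  apply: tangent_is_line.
  exact: (residual_nonsingular_closed cardF d1 char2 char3 dR dR1 frob nu ksE fE GP).
have Ew : restr idfun (val (PG2_map iota P) 0) ((map_mx iota w) 0) GK = 'X^d * (iota c)%:P.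
  rewrite (eq_restr (g := idfun) (P' := fun i => iota (val P 0 i)) (Q' := fun i => iota (w 0 i))) //=; last first.
  - by move=> i; rewrite mxE.
  - by move=> i; rewrite mxE.
  by rewrite restr_map_mpoly -fG E map_polyZ map_polyXn /= -mul_polyC mulrC.
have hGK : GK \is n.-homog by exact: map_homog.
apply: (intersection_mult_geE _ hGK tl _ _ k Ew).
- by rewrite /= -map_col_mx row_free_map.
- exact: (tangent_through hGK GP).
- by rewrite -coef1_restr_tangent Ew coefXnM d1.
by rewrite hornerC fmorph_eq0.
Qed.
End RationalInflections.

Section Types.
Variables (F : finFieldType) (d : nat) (e : 'I_3 -> F).
Hypotheses (cardF : #|F| = d.*2.+1) (d0 : (0 < d)%N) (char2 : (2%:R : F) != 0).
Hypotheses (nu : ~ (exists k, e k ^+ d = -1 /\ forall i, i != k -> e i = 0)).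
Local Notation chi := (@qchar F d).
Local Notation points ps := [set P : PG2 F | pattern d e (val P) \in ps].

Lemma qchar_signN1 : chi (-1) \in [:: 1; -1].
Proof.
have := qchar_sign d (-1 : F); rewrite !inE qchar_eq0 oppr_eq0 oner_eq0 /=.
by case/orP => ->; rewrite ?orbT.
Qed.

Lemma has_line_sign k :
  has_line e d k = (chi (e k) == -1) && (chi (e o0) * chi (e o1) * chi (e o2) == chi (-1)).
Proof.
rewrite /has_line !(qchar_eqP cardF d0 char2) ?inE ?eqxx ?orbT // -!(qcharM cardF d0 char2).
rewrite !(qchar_eqP cardF d0 char2) ?qchar_sign // -(qcharE cardF d0).
by congr (_ && _).
Qed.

Lemma line_typeE :
  line_type (chi (e o0)) (chi (e o1)) (chi (e o2)) (chi (-1)) = [exists k, has_line e d k].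
Proof.
apply/andP/existsP => [[t /or3P[] h]|[k]].
- by exists o0; rewrite has_line_sign h t.
- by exists o1; rewrite has_line_sign h t.
- by exists o2; rewrite has_line_sign h t.
by rewrite has_line_sign => /andP[h ->]; split=> //; case: (ord3P k) h => -> ->; rewrite ?orbT.
Qed.

Lemma not_union_type : ~~ union_type (chi (e o0)) (chi (e o1)) (chi (e o2)).
Proof.
have m1 x : chi x == -1 -> x ^+ d = -1.
  by rewrite (qchar_eqP cardF d0 char2) ?inE ?eqxx ?orbT // rmorphN rmorph1 => /eqP.
apply/negP; rewrite /union_type !qchar_eq0 => /or3P[] /andP[/andP[]].
- by move=> /eqP h0 /eqP h1 /m1 h2; case: nu; exists o2; split=> // i; case: (ord3P i) => -> //; rewrite eqxx.
- by move=> /eqP h0 /m1 h1 /eqP h2; case: nu; exists o1; split=> // i; case: (ord3P i) => -> //; rewrite eqxx.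
- by move=> /m1 h0 /eqP h1 /eqP h2; case: nu; exists o0; split=> // i; case: (ord3P i) => -> //; rewrite eqxx.
Qed.

Lemma card_root_points : (#|points root_patterns| = #|points balanced_patterns| + #|points two_zero_patterns|)%N.
Proof.
rewrite -cardsUI (_ : _ :&: _ = set0) ?cards0 ?addn0.
  by apply: eq_card => P; rewrite in_setU !in_set mem_cat.
apply/setP => P; rewrite in_setI !in_set; apply/andP => -[h1 h2].
have H : all (fun s => s \notin two_zero_patterns) balanced_patterns by vm_compute.
by move: (allP H _ h1); rewrite h2.
Qed.

Let cardE : (#|F|%:R = 2%:R * d%:R + 1 :> rat).
Proof. by rewrite cardF -addn1 natrD -mul2n natrM. Qed.

Lemma no_line_points : (forall k, ~~ has_line e d k) ->
  exists2 B, B \in [:: 0; 1; 2; 3; d; 3 * d]%N & #|points two_zero_patterns| = B /\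
    2%:R * #|points balanced_patterns|%:R = d%:R * (3%:R * d%:R - B%:R) :> rat.
Proof.
move=> nl; have nt : ~~ line_type (chi (e o0)) (chi (e o1)) (chi (e o2)) (chi (-1)).
  by rewrite line_typeE; apply/existsPn.
have d0' : (d%:R : rat) != 0 by rewrite Num.Theory.pnatr_eq0 -lt0n.
have [||||B hB [E2 E4]] := no_line_count d _ _ _ _ nt not_union_type; rewrite ?qchar_sign ?qchar_signN1 //.
exists B => //; split.
  apply/eqP; rewrite -(Num.Theory.eqr_nat rat); apply/eqP/(mulfI (_ : 2%:R * d%:R != 0)); first by rewrite mulf_neq0.
  by rewrite card_points // cardE.
apply: (mulfI d0'); rewrite mulrA [_ * 2%:R]mulrC card_points // cardE E4; ring.
Qed.

Lemma line_points N : (exists k, has_line e d k) ->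
  N = ((chi (e o0) == -1)%R + (chi (e o1) == -1)%R + (chi (e o2) == -1)%R)%N ->
  2%:R * d%:R * #|points root_patterns|%:R = 
    d%:R * (d%:R - N%:R) * (3%:R * d%:R - N%:R)
      + 2%:R * d%:R * nth 0 [:: 0; #|F|%:R + 1; 2%:R * #|F|%:R + 1; 3%:R * #|F|%:R] N :> rat.
Proof.
move=> /existsP; rewrite -line_typeE => t ->; rewrite card_root_points natrD mulrDr !card_points // cardE.
by rewrite addrC (line_count d _ _ _ _ t (erefl _)) ?qchar_sign ?qchar_signN1.
Qed.
End Types.

(** * Curves without linear components *)

Section NoLine.
Variables (F : finFieldType) (K : closedFieldType) (iota : {rmorphism F -> K}) (d : nat) (e : 'I_3 -> F).
Hypotheses (cardF : #|F| = d.*2.+1) (d1 : (1 < d)%N).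
Hypotheses (char2 : (2%:R : F) != 0) (char3 : (3%:R : F) != 0).
Hypotheses (dR : d%:R != 0 :> F) (dR1 : d.-1%:R != 0 :> F).
Hypotheses (frob : forall x y : K, (x + y) ^+ d.*2.+1 = x ^+ d.*2.+1 + y ^+ d.*2.+1).
Hypotheses (nu : ~ (exists k, e k ^+ d = -1 /\ forall i, i != k -> e i = 0)).
Hypothesis nl : forall k, ~~ has_line e d k.
Local Notation f := (four_term_form d e).
Local Notation points ps := [set P : PG2 F | pattern d e (val P) \in ps].

Let d0 : (0 < d)%N. Proof. exact: ltnW. Qed.

Let ksE (k : 'I_3) : (k \in [::]) = has_line e d k. Proof. by rewrite (negPf (nl k)). Qed.
Let fE : f = (\prod_(k <- [::]) comp_line e k) * f. Proof. by rewrite big_nil mul1r. Qed.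

Lemma nb_points_four_term : nb_points f = #|points root_patterns|.
Proof.
by apply: eq_card => P; rewrite !in_set -(four_term_root e cardF d0 char2 char3) ?normalized_neq0.
Qed.

Lemma no_line_nb_points : exists2 B, B \in [:: 0; 1; 2; 3; d; 3 * d]%N &
  #|points two_zero_patterns| = B /\
  (nb_points f)%:R = d%:R * (d%:R + #|F|%:R - 1) / 2 - B%:R * (d%:R - 2) / 2 :> rat.
Proof.
have [B hB [E2 E4]] := no_line_points cardF d0 char2 nu nl; exists B => //; split=> //.
apply: (mulfI (_ : 2%:R != 0)) => //.
rewrite nb_points_four_term card_root_points natrD mulrDr E4 E2.
have -> : (#|F|%:R = 2%:R * d%:R + 1 :> rat) by rewrite cardF -addn1 natrD -mul2n natrM.
by field.
Qed.

(** The tangent at such a point meets C with multiplicity d, which makes it an inflection only for d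
    > 2; for q = 5 the curve is a conic. *)
Lemma two_zero_inflection (P : PG2 F) :
  inflection_point (map_mpoly iota f) (PG2_map iota P) <->
  (pattern d e (val P) \in two_zero_patterns) && (2 < d)%N.
Proof.
have mult P k := two_zero_intersection iota cardF d1 char2 char3 dR dR1 frob nu ksE fE
  (four_term_homog e d) (P := P) k (erefl _).
split=> [IP|/andP[tP d2]].
  have GP : eval_pt f P = 0.
    by apply: (fmorph_inj iota); rewrite -eval_pt_map rmorph0; case: IP.
  have := residual_root_pattern cardF d1 char2 char3 fE GP; rewrite mem_cat => /orP[bP|tP].
    by have := balanced_not_inflection cardF d1 char2 char3 dR dR1 frob nu ksE fE (four_term_homog e d) bP IP.
  by rewrite tP; case: IP => _ /(mult P 3 tP).
split; last exact/(mult P 3 tP).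
rewrite eval_pt_map; apply/eqP; rewrite fmorph_eq0 (four_term_root e cardF d0) ?normalized_neq0 //.
by rewrite mem_cat tP orbT.
Qed.

Lemma no_line_attains : attains_Stohr_Voloch iota d f.
Proof.
have mult P k := two_zero_intersection iota cardF d1 char2 char3 dR dR1 frob nu ksE fE
  (four_term_homog e d) (P := P) k (erefl _).
exists [seq P <- enum (points two_zero_patterns) | (2 < d)%N], (fun=> d); split.
- by rewrite filter_uniq ?enum_uniq.
- by move=> P; rewrite two_zero_inflection mem_filter mem_enum in_set andbC.
- move=> P; rewrite mem_filter mem_enum in_set => /andP[d2 tP]; split=> //.
  by split; [apply/(mult P d tP)|move/(mult P d.+1 tP); rewrite ltnn].
have [B _ [E2 ->]] := no_line_nb_points.
(* For d = 2 the list is empty, in agreement with the factor d - 2 being zero. *)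
rewrite big_filter big_const_seq.
have -> : iter (count (fun=> (2 < d)%N) (enum (points two_zero_patterns))) (+%R (d%:R - 2)) 0 =
   B%:R * (d%:R - 2) :> rat.
  rewrite iter_addr_0 -[LHS]mulr_natl; case: (ltngtP 2 d) d1 => [_|//|<-] _.
    by rewrite count_predT -cardE E2.
  by rewrite subrr !mulr0.
by field.
Qed.
End NoLine.

(** * Rational points on the component lines *)

Section LinePoints.
Variables (F : finFieldType) (e : 'I_3 -> F).
Hypotheses (char2 : (2%:R : F) != 0) (e0 : forall i, e i != 0).
Local Notation x3 v := (fourth e v).
Local Notation q := #|F|.

Definition on_line k (v : 'rV[F]_3) := x3 (v 0) == e k * v 0 k.
Local Notation L k := [set v | on_line k v].

Lemma card_on_line k : #|L k| = (q * q)%N.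
Proof.
have [ka kb ab] := rot_neq k; have [Wk Wa Wb] := dir_lineE e k.
have Dk : dirac F k 0 k = 1 by rewrite mxE eqxx.
have Da : dirac F k 0 (rot1 k) = 0 by rewrite mxE (negPf ka).
have Db : dirac F k 0 (rot2 k) = 0 by rewrite mxE (negPf kb).
pose h (x : F * F) := x.1 *: dirac F k + x.2 *: dir_line e k.
have hE x i : h x 0 i = x.1 * dirac F k 0 i + x.2 * dir_line e k 0 i by rewrite mxE [in LHS]mxE [X in _ + X]mxE.
have -> : L k = [set h x | x in [set: F * F]].
  apply/setP => v; rewrite in_set; apply/idP/imsetP => [|[x _ ->]]; last first.
    by rewrite /on_line (fourth_rot e _ k) !hE Wk Wa Wb Dk Da Db; apply/eqP; ring.
  rewrite /on_line (fourth_rot e _ k) => /eqP E0.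
  have E : e (rot1 k) * v 0 (rot1 k) + e (rot2 k) * v 0 (rot2 k) = 0.
    by apply: (addrI (e k * v 0 k)); rewrite addrA E0 addr0.
  exists (v 0 k, v 0 (rot1 k) / e (rot2 k)) => //; apply/rowP => i; rewrite hE /=.
  have eb := e0 (rot2 k); case: (rotP k i) => ->; rewrite ?Wk ?Wa ?Wb ?Dk ?Da ?Db.
  - by ring.
  - by field.
  apply: (mulfI eb); transitivity (- (e (rot1 k) * v 0 (rot1 k))); last by field.
  by apply/eqP; rewrite -addr_eq0 addrC E.
rewrite card_imset ?cardsT ?card_prod // => -[x y] [x' y'] /rowP E; congr (_, _).
  by have := E k; rewrite !hE Dk Wk /= !mulr1 !mulr0 !addr0.
have := E (rot1 k); rewrite !hE Da Wa /= !mulr0 !add0r; exact: mulIf.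
Qed.

(** The common vectors are parametrized by t = X_3: the two lines fix e_k X_k = e_l X_l = t, and the
    remaining term must be -t. *)
Lemma card_on_two_lines k l : k != l -> #|L k :&: L l| = q.
Proof.
move=> kl; pose h (t : F) : 'rV[F]_3 := \row_i ((if (i == k) || (i == l) then t else - t) / e i).
have hE t i : e i * h t 0 i = if (i == k) || (i == l) then t else - t.
  by rewrite mxE mulrCA divff ?mulr1.
have Sh t : x3 (h t 0) = t.
  rewrite /fourth sum_ord3 !hE; case: (ord3P k) (ord3P l) kl => -> [] -> //= _; ring.
have -> : L k :&: L l = [set h t | t in [set: F]].
  apply/setP => v; rewrite in_setI !in_set; apply/andP/imsetP => [[/eqP vk /eqP vl]|[t _ ->]]; last first.
    by rewrite /on_line Sh !hE !eqxx ?orbT eqxx.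
  exists (x3 (v 0)) => //; apply/rowP => i; apply: (mulfI (e0 i)); rewrite hE.
  case: ifP => [/orP[] /eqP-> //|/norP[ik il]].
  have : x3 (v 0) = e k * v 0 k + e l * v 0 l + e i * v 0 i.
    rewrite /fourth sum_ord3; case: (ord3P k) (ord3P l) (ord3P i) kl ik il => -> [] -> [] -> //= _ _ _; ring.
  by rewrite -vk -vl => E; apply: (addrI (x3 (v 0) + x3 (v 0))); rewrite -E; ring.
rewrite card_imset ?cardsT // => t t' E; by rewrite -(Sh t) E Sh.
Qed.

(** On all three lines X_3 is the sum of three terms equal to X_3, so 2 X_3 = 0. *)
Lemma on_three_lines : L o0 :&: L o1 :&: L o2 = [set 0].
Proof.
apply/setP => v; rewrite !in_setI !in_set in_set1; apply/andP/eqP => [[/andP[/eqP v0 /eqP v1] /eqP v2]|->]; last first.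
  by rewrite /on_line /fourth big1 => [|i _]; rewrite !mxE ?mulr0 ?eqxx.
have S0 : x3 (v 0) = 0.
  apply: (mulfI char2); have E : x3 (v 0) = x3 (v 0) + x3 (v 0) + x3 (v 0).
    by rewrite {1}/fourth sum_ord3 -v0 -v1 -v2.
  by rewrite mulr0; apply: (addIr (x3 (v 0))); rewrite [RHS]add0r [RHS]E; ring.
apply/rowP => i; apply: (mulfI (e0 i)); rewrite [X in _ = _ * X]mxE mulr0 -[RHS]S0; apply: esym.
by case: (ord3P i) => ->.
Qed.

Lemma card_on_lines ks : uniq ks -> (0 < size ks)%N ->
  #|[set v | has (on_line^~ v) ks]|%:R - 1 =
  (q%:R - 1) * nth 0 [:: 0; q%:R + 1; 2%:R * q%:R + 1; 3%:R * q%:R] (size ks) :> rat.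
Proof.
have U (s : seq 'I_3) k : [set v | has (on_line^~ v) (k :: s)] = L k :|: [set v | has (on_line^~ v) s].
  by apply/setP => v; rewrite in_setU !in_set.
have U0 : [set v | has (on_line^~ v) [::]] = set0 by apply/setP => v; rewrite !in_set.
have C2 k l : k != l -> (#|L k :|: L l|%:R = 2%:R * q%:R * q%:R - q%:R :> rat).
  move=> kl; have := cardsUI (L k) (L l); rewrite !card_on_line card_on_two_lines // => E.
  have : (#|L k :|: L l|%:R + q%:R = q%:R * q%:R + q%:R * q%:R :> rat) by rewrite -!natrM -!natrD E.
  by move=> /(canRL (addrK _)) ->; ring.
case: ks => [|k [|l [|m [|j s]]]] // uks _.
- by rewrite U U0 setU0 card_on_line natrM /=; ring.
- have kl : k != l by move: uks; rewrite /= !inE andbT.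
  by rewrite !U U0 setU0 C2 //=; ring.
- have [kl km lm] : [/\ k != l, k != m & l != m].
    by move: uks; rewrite /= !inE negb_or andbT => /andP[/andP[-> ->] ->].
  rewrite !U U0 setU0 setUC.
  have := cardsUI (L l :|: L m) (L k); rewrite setIUl => E.
  have T : L l :&: L k :&: (L m :&: L k) = [set 0].
    rewrite -on_three_lines; apply/setP => v; rewrite !in_setI !in_set.
    move: kl km lm; case: (ord3P k) (ord3P l) (ord3P m) => -> [] -> [] -> //= _ _ _;
      by case: (on_line o0 v) (on_line o1 v) (on_line o2 v) => [] [] [].
  have := cardsUI (L l :&: L k) (L m :&: L k); rewrite T cards1 !card_on_two_lines 1?eq_sym // => E2.
  have E' : (#|L l :|: L m :|: L k|%:R + #|L l :&: L k :|: L m :&: L k|%:R = #|L l :|: L m|%:R + #|L k|%:R :> rat).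
    by rewrite -!natrD E.
  have E2' : (#|L l :&: L k :|: L m :&: L k|%:R + 1 = q%:R + q%:R :> rat).
    by rewrite -[1]/(1%:R) -!natrD E2.
  move: E'; rewrite C2 // card_on_line natrM => /(canRL (addrK _)) ->.
  by move: E2' => /(canRL (addrK _)) -> /=; ring.
have := max_card (mem [:: k, l, m, j & s]); rewrite (card_uniqP uks) card_ord /=.
by rewrite !ltnS ltn0.
Qed.

Lemma card_points_on_lines ks : uniq ks -> (0 < size ks)%N -> (1 < q)%N ->
  #|[set P : PG2 F | has (on_line^~ (val P)) ks]|%:R =
  nth 0 [:: 0; q%:R + 1; 2%:R * q%:R + 1; 3%:R * q%:R] (size ks) :> rat.
Proof.
move=> uks ks0 q1; have := card_on_lines uks ks0.
have q0 : q%:R - 1 != 0 :> rat.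
  by rewrite -[1]/(1%:R) subr_eq0 Num.Theory.eqr_nat neq_ltn q1 orbT.
have sc c v : c != 0 -> has (on_line^~ (c *: v)) ks = has (on_line^~ v) ks.
  move=> c0; apply: eq_has => k; rewrite /on_line !mxE mulrCA /fourth.
  under eq_bigr => i _ do rewrite mxE mulrCA.
  by rewrite -mulr_sumr (inj_eq (mulfI c0)).
have := card_cone sc; rewrite (cardsD1 0 [set v | has (on_line^~ v) ks]).
have -> : (0 : 'rV[F]_3) \in [set v | has (on_line^~ v) ks].
  rewrite in_set; case: ks ks0 {uks sc} => //= k ks _; rewrite /on_line !mxE /fourth big1 ?mulr0 ?eqxx // => i _.
  by rewrite mxE mulr0.
have -> : [set v | has (on_line^~ v) ks] :\ 0 = [set v | (v != 0) && has (on_line^~ v) ks].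
  by apply/setP => v; rewrite in_setD1 !in_set.
move=> ->; rewrite natrD addrAC subrr add0r natrM -subn1 natrB ?(ltnW q1) //.
exact: mulfI.
Qed.
End LinePoints.

(** * Curves with a linear component *)

Section SomeLine.
Variables (F : finFieldType) (K : closedFieldType) (iota : {rmorphism F -> K}).
Variables (d : nat) (e : 'I_3 -> F) (ks : seq 'I_3) (G : {mpoly F[3]}) (n : nat).
Hypotheses (cardF : #|F| = d.*2.+1) (d1 : (1 < d)%N).
Hypotheses (char2 : (2%:R : F) != 0) (char3 : (3%:R : F) != 0).
Hypotheses (dR : d%:R != 0 :> F) (dR1 : d.-1%:R != 0 :> F).
Hypotheses (frob : forall x y : K, (x + y) ^+ d.*2.+1 = x ^+ d.*2.+1 + y ^+ d.*2.+1).
Hypotheses (nu : ~ (exists k, e k ^+ d = -1 /\ forall i, i != k -> e i = 0)).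
Hypotheses (uks : uniq ks) (ks0 : (0 < size ks)%N) (ksE : forall k, (k \in ks) = has_line e d k).
Hypothesis fE : four_term_form d e = (\prod_(k <- ks) comp_line e k) * G.
Hypotheses (hG : G \is n.-homog) (nks : (n + size ks = d)%N).
Local Notation f := (four_term_form d e).
Local Notation chi := (@qchar F d).

Let d0 : (0 < d)%N. Proof. exact: ltnW. Qed.

Let hk : exists k, has_line e d k.
Proof. by case: ks ks0 ksE => // k s _ H; exists k; rewrite -H inE eqxx. Qed.

Let cardE : (#|F|%:R = 2%:R * d%:R + 1 :> rat).
Proof. by rewrite cardF -addn1 natrD -mul2n natrM. Qed.

Lemma size_lines : size ks = ((chi (e o0) == -1)%R + (chi (e o1) == -1)%R + (chi (e o2) == -1)%R)%N.
Proof.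
have [k0] := hk; rewrite (has_line_sign e cardF d0 char2) => /andP[_ t].
rewrite -(card_uniqP uks) -sum1_card big_mkcond /= sum_ord3 !ksE !(has_line_sign e cardF d0 char2) t !andbT.
by do 3! case: (_ == _).
Qed.

(** Every e_i is nonzero, so chi(-1) = chi(e_0) chi(e_1) chi(e_2) = (-1)^N with N the number of
    lines. In F this sign is (-1)^d, and d = n + N, so (-1)^n = 1. In particular degree 1 is
    excluded. *)
Lemma odd_residual_degree : ~~ odd n.
Proof.
have := hk; case=> k /andP[_]; have /existsP := hk.
rewrite -(line_typeE e cardF d0 char2) => t /eqP; rewrite (qcharE cardF d0) !(qcharM cardF d0 char2).
move: (t); rewrite /line_type => /andP[/eqP -> _].
rewrite (line_type_parity _ _ _ _ t size_lines) ?qchar_sign ?qchar_signN1 // rmorphXn rmorphN rmorph1.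
rewrite -nks exprD -[LHS]mul1r => /(mulIf _) E.
have /E : (-1 : F) ^+ size ks != 0 by rewrite signr_eq0.
rewrite -signr_odd; case: (odd n) => // /eqP.
by rewrite expr1 (negPf (one_neq_m1 char2)).
Qed.

Lemma eval_comp_lines_eq0 (P : PG2 F) :
  (eval_pt (\prod_(k <- ks) comp_line e k) P == 0) = has (on_line e^~ (val P)) ks.
Proof.
rewrite /eval_pt rmorph_prod prodf_seq_eq0; apply: eq_has => k /=.
by rewrite meval_comp_line subr_eq0.
Qed.

Lemma points_off_lines (P : PG2 F) : eval_pt G P = 0 -> ~~ has (on_line e^~ (val P)) ks.
Proof.
move=> GP; apply/hasPn => k; rewrite ksE => hl.
exact: (rational_off_lines cardF d1 char2 dR dR1 ksE fE (point_coord_neq0 P) GP hl).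
Qed.

Lemma some_line_nb_points : (nb_points G)%:R = n%:R * (n%:R + #|F|%:R - 1) / 2 :> rat.
Proof.
have e0 i : e i != 0 by case: hk => k; apply: has_line_neq0.
have q1 : (1 < #|F|)%N by rewrite cardF ltnS double_gt0.
have := line_points cardF d0 char2 hk size_lines.
rewrite -(nb_points_four_term e cardF d1 char2 char3).
have -> : nb_points f = (nb_points G + #|[set P : PG2 F | has (on_line e^~ (val P)) ks]|)%N.
  rewrite /nb_points -cardsUI (_ : _ :&: _ = set0) ?cards0 ?addn0; last first.
    by apply/setP => P; rewrite in_setI !in_set; apply/andP => -[/eqP /points_off_lines/negPf ->].
  apply: eq_card => P; rewrite in_setU !in_set fE {1}/eval_pt mevalM mulf_eq0 orbC.
  by have := eval_comp_lines_eq0 P; rewrite /eval_pt => ->.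
rewrite natrD mulrDr card_points_on_lines // => /addIr.
have dq : (d%:R : rat) != 0 by rewrite Num.Theory.pnatr_eq0 -lt0n.
have nE : n%:R = d%:R - (size ks)%:R :> rat by rewrite -nks natrD addrK.
rewrite cardE -nE => E; apply: (mulfI dq); apply: (mulfI (_ : 2%:R != 0)) => //.
rewrite mulrA E; have -> : 3%:R * d%:R - (size ks)%:R = n%:R + 2%:R * d%:R :> rat by rewrite nE; ring.
by field.
Qed.

(** The list of rational inflections is empty here, and the full value n (n + q - 1) / 2 is
    reached. *)
Lemma some_line_attains : attains_Stohr_Voloch iota n G.
Proof.
exists [::], (fun=> 0%N); split=> //; last by rewrite big_nil subr0 some_line_nb_points.
move=> P; split=> // IP.
have GP : eval_pt G P = 0.
  by apply: (fmorph_inj iota); rewrite -eval_pt_map rmorph0; case: IP.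
have := residual_root_pattern cardF d1 char2 char3 fE GP; rewrite mem_cat => /orP[bP|tP].
  by have := balanced_not_inflection cardF d1 char2 char3 dR dR1 frob nu ksE fE hG bP IP.
have [k hl] := hk; have [l] := two_zero_on_line cardF d1 hl tP.
rewrite -ksE => lk E; have := points_off_lines GP.
by case/hasP; exists l => //; rewrite /on_line E.
Qed.
End SomeLine.

(** * Arithmetic of q and d, and assembly of the two cases *)

(** Since p divides q = 2 d + 1 = 2 (d - 1) + 3, it would divide 1 if it divided d, and 3 if it
    divided d - 1. *)
Lemma field_order_facts (p h d : nat) (F : finFieldType) :
  prime p -> (3 < p)%N -> #|F| = (p ^ h)%N -> d = ((#|F| - 1) %/ 2)%N ->
  [/\ p \in [pchar F], #|F| = d.*2.+1, (1 < d)%N &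
    [/\ (2%:R : F) != 0, (3%:R : F) != 0, (d%:R : F) != 0 & (d.-1%:R : F) != 0]].
Proof.
move=> pp p3 qE dE; have pF := card_finPcharP qE pp.
have odd_p : odd p by case: (even_prime pp) p3 => [->|].
have h0 : (0 < h)%N by case: h qE (finNzRing_gt1 F) => // ->.
have q4 : (4 < #|F|)%N.
  have p4 : (4 < p)%N by case: (ltngtP 4 p) p3 odd_p => // <-.
  by apply: leq_trans p4 _; rewrite qE -[X in (X <= _)%N]expn1 leq_exp2l // ltnW // ltnW.
have cardF : #|F| = d.*2.+1.
  have qo : odd #|F| by rewrite qE oddX odd_p orbT.
  rewrite dE divn2 -[in RHS](odd_double_half #|F|) qo add1n subn1 doubleK.
  by rewrite -[LHS]odd_double_half qo.
have q0 : (p %| #|F|)%N by rewrite qE dvdn_exp.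
have ndvd m : (0 < m < p)%N -> (m%:R : F) != 0.
  by case/andP=> m0 mp; rewrite -(dvdn_pcharf pF) gtnNdvd.
split=> //; first by move: q4; rewrite cardF ltnS; case: (d) => [|[]].
split; [by apply: ndvd; rewrite ltnW // ltnW|exact: ndvd| |]; rewrite -(dvdn_pcharf pF).
  apply: contraL (prime_gt1 pp) => pd; rewrite -leqNgt.
  apply: dvdn_leq => //; have := q0.
  by rewrite cardF -addn1 dvdn_addr // -muln2 dvdn_mulr.
apply: contraL p3 => pd; rewrite -leqNgt; apply: dvdn_leq => //.
have d0 : (0 < d)%N by move: q4; rewrite cardF; case: (d).
have := q0; rewrite cardF -(prednK d0) doubleS -[X in (p %| X)%N]addn3 dvdn_addr //.
by rewrite -muln2 dvdn_mulr.
Qed.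

Theorem theorem1p1 (p h q d : nat) (F : finFieldType) (K : closedFieldType)
    (iota : {rmorphism F -> K}) (e : 'I_3 -> F)
    (p_prime : prime p) (p_gt3 : (3 < p)%N) (q_def : q = (p ^ h)%N)
    (card_F : #|F| = q) (d_def : d = ((q - 1) %/ 2)%N)
    (K_algebraic : integralRange iota)
    (not_lines : ~ union_of_lines d (map_mpoly iota (four_term_form d e))) :
  exists (lines : seq {mpoly F[3]}) (G : {mpoly F[3]}) (n : nat),
    union_of_nonlinear_components (map_mpoly iota (four_term_form d e))
                                  (map_mpoly iota G) /\
    (* (i) *)
    [/\ (size lines <= 3)%N,
        all (@is_line F) lines,
        distinct_curves lines,
        four_term_form d e = (\prod_(l <- lines) l) * G &
        [/\ G \is n.-homog,
            nonsingular (map_mpoly iota G) &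
            classical_curve (map_mpoly iota G)]] /\
    (* (ii) *)
    (exists2 i : nat, i \in [:: 0; 1; 2; 3; n; 3 * n]%N &
       (nb_points G)%:R =
         n%:R * (n%:R + q%:R - 1) / 2 - i%:R * (n%:R - 2) / 2 :> rat) /\
    attains_Stohr_Voloch iota n G.
Proof.
subst q; rewrite -card_F in d_def.
have [pF cardF d1 [char2 char3 dR dR1]] := field_order_facts p_prime p_gt3 card_F d_def.
have d0 := ltnW d1; have dK : d%:R != 0 :> K by rewrite -(rmorph_nat iota) fmorph_eq0.
have frob (x y : K) : (x + y) ^+ d.*2.+1 = x ^+ d.*2.+1 + y ^+ d.*2.+1.
  apply: exprDn_pchar; rewrite -cardF card_F pnatX; apply/orP; left.
  by rewrite pnatE // (rmorph_pchar iota pF).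
rewrite !map_four_term in not_lines *.
have nu : ~ exists k, e k ^+ d = -1 /\ forall i, i != k -> e i = 0.
  case=> k [ek e0]; apply: not_lines; apply: (union_of_lines_degenerate (k := k) d0 dK).
    by rewrite -rmorphXn ek rmorphN rmorph1.
  by move=> i /e0 ->; rewrite rmorph0.
pose ks := [seq k <- enum 'I_3 | has_line e d k].
have uks : uniq ks by rewrite filter_uniq ?enum_uniq.
have ksE k : (k \in ks) = has_line e d k by rewrite mem_filter mem_enum andbT.
have ksF : {in ks, forall k, has_line e d k} by move=> k; rewrite ksE.
have esq i : e i != 0 -> e i ^+ d * e i ^+ d = 1 by exact: sqr_pow_d.
have [G [n [fE hG nks]]] := comp_lines_dvd d0 esq d1 dR uks ksF.
have ksK : {in ks, forall k, has_line (fun i => iota (e i)) d k}.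
  by move=> k; rewrite has_line_map ksE.
have fK := map_factorization iota fE; have hGK := map_homog iota hG.
have n0 : (0 < n)%N.
  by rewrite lt0n; apply/eqP => /(union_of_lines_const d1 dK uks ksK fK hGK nks).
(* Without component lines n = d; otherwise n is even. *)
have n1 : (1 < n)%N.
  have [s0|s0] := posnP (size ks); first by move: nks; rewrite s0 addn0 => ->.
  have := odd_residual_degree cardF d1 char2 uks s0 ksE nks.
  by case: (n) n0 => [|[]].
have ns : nonsingular (map_mpoly iota G).
  exact: residual_nonsingular_closed cardF d1 char2 char3 dR dR1 frob nu ksE fE.
exists [seq comp_line e k | k <- ks], G, n; split.
  exact: residual_components d1 dK uks ksK fK hGK n1 ns.
split.
  split.
  - by rewrite size_map size_filter (leq_trans (count_size _ _)) // size_enum_ord.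
  - by apply/allP => l ls; exact: (lines_are_lines d1 ksF ls).
  - exact: lines_distinct d1 uks ksF.
  - by rewrite big_map.
  by split=> //; apply: residual_classical cardF d1 char2 char3 dR dR1 frob nu ksE fE hG n0.
(* The integer i is 0 when there is a component line, and otherwise the number of rational points
   with two vanishing terms. *)
have [s0|s0] := posnP (size ks); last first.
  split; last exact: some_line_attains cardF d1 char2 char3 dR dR1 frob nu uks s0 ksE fE hG nks.
  exists 0%N; first by rewrite inE eqxx.
  rewrite (some_line_nb_points cardF d1 char2 char3 dR dR1 uks s0 ksE fE nks) card_F.
  by rewrite !mul0r subr0.
have nl k : ~~ has_line e d k by rewrite -ksE (size0nil s0).
have En : n = d by rewrite -nks s0 addn0.
have EG : G = four_term_form d e by rewrite fE (size0nil s0) big_nil mul1r.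
rewrite EG En; split; last exact: no_line_attains cardF d1 char2 char3 dR dR1 frob nu nl.
have [B hB [_ E]] := no_line_nb_points cardF d1 char2 char3 nu nl.
by exists B => //; rewrite E card_F.
Qed.
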